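(* Let $D=D(\mathbf{x})$ be a smooth, time-independent function on $\mathbb{R}^2$, bounded together with all its derivatives, let $\varepsilon,\sigma>0$, and let $a,b,c,d\in\mathbb{R}$ with $a\le0$, $c\le0$ and $b=d\ge0$. Let $(\eta,\mathbf{u})\in C^1([0,T];H^s(\mathbb{R}^2)^3)$, with $s$ large enough, be a solution of $$\eta_t+\nabla\cdot[(D+\varepsilon\eta)\mathbf{u}]+\sigma^2\nabla\cdot\{a\nabla(D^3\nabla\cdot\mathbf{u})-bD^2\nabla\eta_t\}=0,$$ $$\mathbf{u}_t+\nabla\eta+\tfrac{\varepsilon}{2}\nabla|\mathbf{u}|^2+\sigma^2\nabla\{c\,\nabla\cdot(D^2\nabla\eta)-d\,\nabla\cdot(D^2\mathbf{u}_t)\}=0 .$$ Then the energy functional $$E(t)=\frac12\int_{\mathbb{R}^2}\eta^2+(D+\varepsilon\eta)|\mathbf{u}|^2-\sigma^2\left[cD^2|\nabla\eta|^2+aD^3(\nabla\cdot\mathbf{u})^2\right]d\mathbf{x}$$ is conserved: $\frac{d}{dt}E(t)=0$ for all $t\in[0,T]$.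
   Context: Here $\eta(\mathbf{x},t)\in\mathbb{R}$ is the (nondimensional) free-surface elevation and $\mathbf{u}(\mathbf{x},t)\in\mathbb{R}^2$ the horizontal velocity, with $\mathbf{x}\in\mathbb{R}^2$; $\nabla$ and $\nabla\cdot$ are the gradient and divergence in $\mathbf{x}$. *)

(* Defs.v *)
From HB Require Import structures.
From mathcomp Require Import all_boot all_order all_algebra.
From mathcomp Require Import all_classical all_reals all_analysis.
Set Implicit Arguments.
Unset Strict Implicit.
Unset Printing Implicit Defensive.
Import Order.TTheory GRing.Theory Num.Theory numFieldNormedType.Exports.
Local Open Scope classical_set_scope.
Local Open Scope ring_scope.

(* The plane is R * R; a multi-index is a pair (m, n) of naturals, standing for
   d^(m+n) / dx^m dy^n. *)

Section Plane.
Context {R : realType}.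
Implicit Types (f g phi : R * R -> R).

Definition leb2 : {measure set (measurableTypeR R * measurableTypeR R) -> \bar R} :=
  (@lebesgue_measure R \x @lebesgue_measure R)%E.

(* Euclidean: the norm that the library puts on R * R is the sup norm. *)
Definition sqnorm2 (v : R * R) : R := v.1 ^+ 2 + v.2 ^+ 2.

Definition dx f : R * R -> R := fun p => 'D_((1, 0) : R * R) f p.
Definition dy f : R * R -> R := fun p => 'D_((0, 1) : R * R) f p.
Definition pderiv (al : nat * nat) f : R * R -> R :=
  iter al.1 dx (iter al.2 dy f).

(* Differentiability of all the pderiv al f makes each of them continuous and
   lets partial derivatives commute, so the order chosen in pderiv is
   immaterial and this is C^oo. *)
Definition smooth f := forall al p, differentiable (pderiv al f) p.

Definition smooth_bounded f :=
  smooth f /\ forall al, exists M : R, forall p, `|pderiv al f p| <= M.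

Definition test_function phi :=
  smooth phi /\ compact (closure [set p | phi p != 0]).

Definition L1loc f := forall K : set (R * R), compact K ->
  leb2.-integrable K (fun p => (f p)%:E).

Definition is_wderiv (al : nat * nat) f g :=
  [/\ L1loc f, L1loc g &
    forall phi, test_function phi ->
      (\int[leb2]_(p in setT) (f p * pderiv al phi p) =
       (-1) ^+ (al.1 + al.2) * \int[leb2]_(p in setT) (g p * phi p))%R].

(* A weak derivative is unique up to a null set; wderiv selects one of them
   when there is one. *)
Definition wderiv (al : nat * nat) f : R * R -> R :=
  get [set g | is_wderiv al f g].

(* grad and div are in the weak (distributional) sense. *)
Definition grad f : R * R -> R * R :=
  fun p => (wderiv (1, 0)%N f p, wderiv (0, 1)%N f p).

Definition div (v : R * R -> R * R) : R * R -> R :=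
  fun p => wderiv (1, 0)%N (fun q => (v q).1) p
         + wderiv (0, 1)%N (fun q => (v q).2) p.

(* Squared Gagliardo (Sobolev-Slobodeckij) seminorm of order 0 < th < 1: in
   dimension 2 the denominator is |p - q|^(2 + 2 th). *)
Definition gagliardo (th : R) g : \bar R :=
  (\int[leb2]_(p in setT) \int[leb2]_(q in setT)
     ((g p - g q) ^+ 2 / (sqnorm2 (p - q) `^ (1 + th)))%:E)%E.

(* H^s(R^2) for a real s >= 0, with k = floor s and th = s - k: the weak
   derivatives of order at most k are in L^2 and, if th > 0, those of order k
   have a finite Gagliardo seminorm of order th. *)
Definition Hs_sqnorm (s : R) f : \bar R :=
  let k := Num.truncn s in
  (\sum_(m < k.+1) \sum_(n < k.+1 | (m + n <= k)%N)
      \int[leb2]_(p in setT) ((wderiv (m : nat, n : nat) f p) ^+ 2)%:E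
   + if (k%:R < s)%R then
       \sum_(m < k.+1) gagliardo (s - k%:R)%R (wderiv (m : nat, k - m)%N f)
     else 0)%E.

Definition Hs_norm (s : R) f : \bar R := (Hs_sqnorm s f `^ 2^-1)%E.

Definition Hs (s : R) : set (R * R -> R) :=
  [set f | (forall al : nat * nat, (al.1 + al.2 <= Num.truncn s)%N ->
              exists g, is_wderiv al f g)
           /\ (Hs_norm s f < +oo)%E].

(* F is in C^1([0,T]; H^s(R^2)) and F' is its time derivative (one-sided at
   t = 0 and t = T). *)
Definition C1_Hs (T s : R) (F F' : R -> R * R -> R) :=
  forall t, t \in `[0, T] ->
  [/\ Hs s (F t), Hs s (F' t),
      Hs_norm s (fun p => (r - t)^-1 * (F r p - F t p) - F' t p)
        @[r --> within `[0, T] t^'] --> 0%E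
    & Hs_norm s (fun p => F' r p - F' t p)
        @[r --> within `[0, T] (nbhs t)] --> 0%E].

Definition energy_density (eps sigma a c : R) (D eta : R * R -> R)
    (u : R * R -> R * R) : R * R -> R :=
  fun p => eta p ^+ 2 + (D p + eps * eta p) * sqnorm2 (u p)
    - sigma ^+ 2 * (c * D p ^+ 2 * sqnorm2 (grad eta p)
                    + a * D p ^+ 3 * (div u p) ^+ 2).

Definition energy (eps sigma a c : R) (D eta : R * R -> R)
    (u : R * R -> R * R) : R :=
  2^-1 * \int[leb2]_(p in setT) energy_density eps sigma a c D eta u p.

End Plane.

(* Main.v *)
Require Import Defs.
From HB Require Import structures.
From mathcomp Require Import all_boot all_order all_algebra.
From mathcomp Require Import all_classical all_reals all_analysis.
From mathcomp Require Import measurable_realfun ring lra zify.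
Set Implicit Arguments.
Unset Strict Implicit.
Unset Printing Implicit Defensive.
Import Order.TTheory GRing.Theory Num.Theory numFieldNormedType.Exports.
Local Open Scope classical_set_scope.
Local Open Scope ring_scope.

(* Every H^s function with s >= 9 is shown to agree almost everywhere with a
   classical one: in one dimension a function k supported in [0, 1], polynomial
   there and equal to x^2 / 2 + O(x^5) at 0, satisfies psi = (k * psi)''' + l * psi
   with l of class C^1, so a weakly differentiable f equals a sum of four
   convolutions of its weak derivatives with compactly supported C^1 kernels.
   These convolutions are C^1 and are bounded by the L^2 norms of the weak
   derivatives, which replaces the Sobolev embedding.

   With P and Q the potential and the flux, the system reads eta_t + div Q = 0,
   u_t + grad P = 0, and dE/dt is the integral of
     eta_t P + u_t . Q
       - sigma^2 div (c eta_t D^2 grad eta + a D^3 (div u) u_t - d eta_t D^2 u_t),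
   whose first two terms add up to - div (P Q); the last divergence is complete
   because b = d.  Divergences of products of square integrable functions have
   integral zero.  The energy is differentiated in time through pairings of
   L^2-differentiable curves; in the cubic term eta |u|^2 this also uses the sup
   bound on the difference quotients of eta. *)

(** [wderiv] is a mere choice among functions that agree almost everywhere, and the equations nest
    it around products with [D]. Instead of building a calculus of weak derivatives, the proof
    matches every weak expression with a classical one; an equation between continuous functions
    that holds almost everywhere then holds everywhere, and the ordinary rules apply.

    The parametrix aims at the third derivative because x^2 / 2 on the positive half-line is the
    fundamental solution of d^3/dx^3 and is of class C^1. The formula for the representative can
    therefore be differentiated once by differentiating its kernels, and the result is recognized as
    the representative of the next weak derivative; this step is iterated.

    Square integrability gives no pointwise decay, so boundary terms at infinity are removed by a
    dilated cutoff, whose derivative is O(1/n).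

    L^2 estimates are stated with a positive upper bound d and an inequality between an integral of
    squares and d^2. Weighted arithmetic-geometric inequalities then replace square roots and the
    division by a norm that could vanish. *)

Notation intg mu f := (mu.-integrable setT (fun x => (f x)%:E)).

(** * Real-valued integrals *)

Section RealIntegral.
Context d (T : measurableType d) (R : realType).
Variable mu : {measure set T -> \bar R}.
Implicit Types f g h : T -> R.

Lemma aeS (P Q : T -> Prop) : (forall x, P x -> Q x) ->
  {ae mu, forall x, P x} -> {ae mu, forall x, Q x}.
Proof. by move=> PQ; apply: filterS. Qed.

Lemma aeS2 (P Q S : T -> Prop) : (forall x, P x -> Q x -> S x) ->
  {ae mu, forall x, P x} -> {ae mu, forall x, Q x} -> {ae mu, forall x, S x}.
Proof. by move=> PQ; apply: filterS2. Qed.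

Lemma intg_meas f : intg mu f -> measurable_fun setT f.
Proof. by move=> /measurable_int/measurable_EFinP. Qed.

Lemma intg_le f g : measurable_fun setT f -> (forall x, `|f x| <= g x) ->
  intg mu g -> intg mu f.
Proof.
move=> mf fg ig; apply: le_integrable ig => //; first exact/measurable_EFinP.
by move=> x _; rewrite !abse_EFin lee_fin (le_trans (fg x))// ler_norm.
Qed.

Lemma intgD f g : intg mu f -> intg mu g -> intg mu (fun x => f x + g x).
Proof.
move=> fi gi; have := integrableD measurableT fi gi.
by apply: eq_integrable.
Qed.

Lemma intgZ k f : intg mu f -> intg mu (fun x => k * f x).
Proof. by move=> fi; have := integrableZl measurableT k fi. Qed.

Lemma intgN f : intg mu f -> intg mu (fun x => - f x).
Proof. by move=> fi; have := integrableN fi. Qed.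

Lemma intgB f g : intg mu f -> intg mu g -> intg mu (fun x => f x - g x).
Proof. by move=> fi gi; apply: intgD => //; exact: intgN. Qed.

Lemma intg_norm f : intg mu f -> intg mu (fun x => `|f x|).
Proof. by move=> /integrable_abse; apply: eq_integrable. Qed.

Lemma intgMb f g (M : R) : intg mu f -> measurable_fun setT g ->
  (forall x, `|g x| <= M) -> intg mu (fun x => g x * f x).
Proof.
move=> fi mg gM; apply: (@intg_le _ (fun x => M * `|f x|)).
- by apply: measurable_funM => //; exact: intg_meas fi.
- by move=> x; rewrite normrM ler_wpM2r.
- exact/intgZ/intg_norm.
Qed.

(** Measurability of [f] is asked for separately: the measure need not be complete, and the product
    measure on the plane is not, so almost everywhere equality does not transfer it. *)
Lemma intg_ae f g : measurable_fun setT f -> {ae mu, forall x, f x = g x} ->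
  intg mu g -> intg mu f.
Proof.
move=> mf fg /integrableP[mg gi]; apply/integrableP; split.
  exact/measurable_EFinP.
have -> : (\int[mu]_x `|(f x)%:E| = \int[mu]_x `|(g x)%:E|)%E.
  apply: ae_eq_integral => //.
  - by apply: measurableT_comp => //; exact/measurable_EFinP.
  - exact: measurableT_comp.
  - by apply: filterS fg => x fgx _; rewrite fgx.
by [].
Qed.

Lemma RI_ae f g : measurable_fun setT f -> measurable_fun setT g ->
  {ae mu, forall x, f x = g x} ->
  \int[mu]_(x in setT) f x = \int[mu]_(x in setT) g x.
Proof.
move=> mf mg fg; congr fine; apply: ae_eq_integral => //.
- exact/measurable_EFinP.
- exact/measurable_EFinP.
- by apply: filterS fg => x fgx _; rewrite fgx.
Qed.

Lemma RI_eq f g : f =1 g ->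
  \int[mu]_(x in setT) f x = \int[mu]_(x in setT) g x.
Proof. by move=> fg; apply: eq_Rintegral => x _. Qed.

Lemma RI0 : \int[mu]_(x in setT) (0 : R) = 0.
Proof. by rewrite /Rintegral integral0. Qed.

Lemma RID f g : intg mu f -> intg mu g ->
  \int[mu]_(x in setT) (f x + g x) =
  \int[mu]_(x in setT) f x + \int[mu]_(x in setT) g x.
Proof. by move=> fi gi; rewrite RintegralD. Qed.

Lemma RIB f g : intg mu f -> intg mu g ->
  \int[mu]_(x in setT) (f x - g x) =
  \int[mu]_(x in setT) f x - \int[mu]_(x in setT) g x.
Proof. by move=> fi gi; rewrite RintegralB. Qed.

Lemma RIZ k f : intg mu f ->
  \int[mu]_(x in setT) (k * f x) = k * \int[mu]_(x in setT) f x.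
Proof. by move=> fi; rewrite RintegralZl. Qed.

Lemma RI_le f g : intg mu f -> intg mu g -> (forall x, f x <= g x) ->
  \int[mu]_(x in setT) f x <= \int[mu]_(x in setT) g x.
Proof. by move=> fi gi fg; apply: le_Rintegral. Qed.

Lemma RI_ge0 f : (forall x, 0 <= f x) -> 0 <= \int[mu]_(x in setT) f x.
Proof. by move=> f0; apply: Rintegral_ge0. Qed.

Lemma RI_norm_le f g : intg mu f -> intg mu g -> (forall x, `|f x| <= g x) ->
  `|\int[mu]_(x in setT) f x| <= \int[mu]_(x in setT) g x.
Proof.
move=> fi gi fg; apply: le_trans (le_normr_Rintegral _ fi) _ => //.
by apply: RI_le => //; exact: intg_norm.
Qed.

Lemma RI_dct (F : nat -> T -> R) f g :
  (forall n, measurable_fun setT (F n)) -> measurable_fun setT f ->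
  (forall x, F n x @[n --> \oo] --> f x) ->
  (forall n x, `|F n x| <= g x) -> intg mu g ->
  \int[mu]_(x in setT) F n x @[n --> \oo] --> \int[mu]_(x in setT) f x.
Proof.
move=> mF mf Ff Fg gi.
have fg x : `|f x| <= g x.
  have : `|F n x| @[n --> \oo] --> `|f x| by apply: cvg_norm; exact: Ff.
  by apply: limr_le_near || (move/cvg_lim => <- //; apply: limr_le;
    [by apply: is_cvg_norm; apply/cvg_ex; exists (f x); exact: Ff|exact: nearW]).
have fi : intg mu f by exact: intg_le gi.
have Hc : {ae mu, forall x, setT x -> (F n x)%:E @[n --> \oo] --> (f x)%:E}.
  by apply: aeW => x _; apply: cvg_EFin; [exact: nearW|exact: Ff].
have [_ _ H] := @dominated_convergence _ _ _ mu setT measurableT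
  (fun n x => (F n x)%:E) (fun x => (f x)%:E) (fun x => (g x)%:E)
  (fun n => (measurable_EFinP _ _).2 (mF n)) ((measurable_EFinP _ _).2 mf)
  Hc gi
  (aeW mu (fun x n _ => Fg n x)).
apply: fine_cvg; rewrite fineK//.
by apply: integrable_fin_num => //.
Qed.

End RealIntegral.

(** * Fubini's theorem for real-valued integrals *)

Section RealFubini.
Context d1 d2 (T1 : measurableType d1) (T2 : measurableType d2) (R : realType).
Variables (m1 : {sigma_finite_measure set T1 -> \bar R}).
Variables (m2 : {sigma_finite_measure set T2 -> \bar R}).
Variable f : T1 * T2 -> R.
Hypothesis fi : (m1 \x m2)%E.-integrable setT (fun x => (f x)%:E).

(** Only almost every section is integrable. On the others [fine] may replace an infinite inner
    integral by 0, which does no harm on a null set. *)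
Let ae_fin1 : {ae m1, forall x, fubini_F m2 (fun z => (f z)%:E) x
   = (\int[m2]_(y in setT) f (x, y))%:E}.
Proof.
have := ae_integrable1 fi; apply: filterS => x ix.
by rewrite /fubini_F /Rintegral fineK//; apply: integrable_fin_num.
Qed.

Let mRI : measurable_fun setT (fun x => \int[m2]_(y in setT) f (x, y)).
Proof.
rewrite /Rintegral.
apply: (@measurableT_comp _ _ _ _ _ _ fine) => //; exact: measurable_fubini_F fi.
Qed.

Lemma RI_fubini : \int[(m1 \x m2)%E]_(z in setT) f z =
  \int[m1]_(x in setT) \int[m2]_(y in setT) f (x, y).
Proof.
rewrite /Rintegral -(integral12_prod_meas1 fi); congr fine.
apply: ae_eq_integral => //.
- exact: measurable_fubini_F fi.
- exact/measurable_EFinP.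
- by apply: filterS ae_fin1 => x -> _.
Qed.

Let ae_fin2 : {ae m2, forall y, fubini_G m1 (fun z => (f z)%:E) y
   = (\int[m1]_(x in setT) f (x, y))%:E}.
Proof.
have := ae_integrable2 fi; apply: filterS => x ix.
by rewrite /fubini_G /Rintegral fineK//; apply: integrable_fin_num.
Qed.

Lemma RI_fubini2 : \int[(m1 \x m2)%E]_(z in setT) f z =
  \int[m2]_(y in setT) \int[m1]_(x in setT) f (x, y).
Proof.
rewrite /Rintegral -(integral21_prod_meas1 fi); congr fine.
apply: ae_eq_integral => //.
- exact: measurable_fubini_G fi.
- apply/measurable_EFinP; rewrite /Rintegral.
  apply: (@measurableT_comp _ _ _ _ _ _ fine) => //.
  exact: measurable_fubini_G fi.
- by apply: filterS ae_fin2 => x -> _.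
Qed.

End RealFubini.

(** * Integration on the plane *)

Section Planar.
Context {R : realType}.
Notation leb := (@lebesgue_measure R).
Implicit Types (f g : R * R -> R).

Lemma leb2E : @leb2 R = (leb \x leb)%E :> (set _ -> \bar R).
Proof. by []. Qed.

Lemma planar_fubini f : intg leb2 f ->
  \int[leb2]_(z in setT) f z =
  \int[leb]_(x in setT) \int[leb]_(y in setT) f (x, y).
Proof. by move=> fi; apply: RI_fubini. Qed.

Lemma planar_fubini2 f : intg leb2 f ->
  \int[leb2]_(z in setT) f z =
  \int[leb]_(y in setT) \int[leb]_(x in setT) f (x, y).
Proof. by move=> fi; apply: RI_fubini2. Qed.

Definition obox (a b c d : R) : set (R * R) := `]a, b[ `*` `]c, d[.
Definition cbox (a b c d : R) : set (R * R) := `[a, b] `*` `[c, d].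

Lemma measurable_obox a b c d :
  measurable (obox a b c d : set (measurableTypeR R * measurableTypeR R)).
Proof. by apply: measurableX; exact: measurable_itv. Qed.

Lemma measurable_cbox a b c d :
  measurable (cbox a b c d : set (measurableTypeR R * measurableTypeR R)).
Proof. by apply: measurableX; exact: measurable_itv. Qed.

(** An open set is the union of the boxes with rational corners that it contains. The union runs
    over all quadruples of rationals, a box that does not fit being replaced by the empty set. *)
Lemma open_measurable2 (U : set (R * R)) : open U ->
  measurable (U : set (measurableTypeR R * measurableTypeR R)).
Proof.
move=> oU.
pose q (i : rat * rat * rat * rat) : set (R * R) :=
  obox (ratr i.1.1.1) (ratr i.1.1.2) (ratr i.1.2) (ratr i.2).
pose F i : set (measurableTypeR R * measurableTypeR R) :=
  if `[< q i `<=` U >] then q i else set0.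
have -> : U = \bigcup_i F i.
  apply/seteqP; split => [p Up|p [i _]]; last first.
    by rewrite /F; case: asboolP => // + qi; apply.
  have /nbhs_ballP[e /= e0 eU] : nbhs p U by exact: open_nbhs_nbhs.
  have d1 : p.1 - e < p.1 by rewrite ltrBlDr ltrDl.
  have d2 : p.2 - e < p.2 by rewrite ltrBlDr ltrDl.
  have u1 : p.1 < p.1 + e by rewrite ltrDl.
  have u2 : p.2 < p.2 + e by rewrite ltrDl.
  have [a /[!in_itv]/= /andP[ae ap]] := rat_in_itvoo d1.
  have [b /[!in_itv]/= /andP[pb be]] := rat_in_itvoo u1.
  have [c /[!in_itv]/= /andP[ce cp]] := rat_in_itvoo d2.
  have [d /[!in_itv]/= /andP[pd de]] := rat_in_itvoo u2.
  exists (a, b, c, d) => //; rewrite /F asboolT; last first.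
    move=> z [/=]; rewrite !in_itv/= => /andP[z1 z2] /andP[z3 z4].
    apply: eU; split; rewrite /ball/= ltr_norml; apply/andP; split; lra.
  by split; rewrite /= in_itv/= ?ap ?cp.
apply: countable_bigcupT_measurable => // i; rewrite /F.
by case: asboolP => // _; exact: measurable_obox.
Qed.

Lemma compact_cbox a b c d : compact (cbox a b c d).
Proof. by apply: compact_setX; exact: segment_compact. Qed.

Lemma cbox_fin a b c d : (leb2 (cbox a b c d) < +oo)%E.
Proof.
rewrite leb2E /cbox product_measure1E; [|exact: measurable_itv..].
rewrite lte_mul_pinfty//.
- by rewrite ge0_fin_numE// compact_finite_measure//; exact: segment_compact.
- by rewrite compact_finite_measure//; exact: segment_compact.
Qed.

Lemma compact_sub_cbox (K : set (R * R)) : compact K ->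
  exists2 N, 0 < N & K `<=` cbox (-N) N (-N) N.
Proof.
move=> /compact_bounded[M [Mr MK]].
exists (Num.max 0 M + 1); first by rewrite ltr_pwDr// le_max lexx.
move=> p Kp.
have /MK/(_ p Kp) : M < Num.max 0 M + 1.
  by rewrite (@le_lt_trans _ _ (Num.max 0 M)) ?ltrDl// le_max lexx orbT.
rewrite /= prod_normE ge_max => /andP[].
by rewrite !ler_norml => h1 h2; split; rewrite /= in_itv.
Qed.

Lemma continuous_measurable2 f : continuous f ->
  measurable_fun (setT : set (measurableTypeR R * measurableTypeR R)) f.
Proof.
move=> /continuousP cf; apply: (measurability _ (RGenOpens.measurableE R)).
move=> _ [_ [a [b ->] <-]]; rewrite setTI.
by apply: open_measurable2; apply: cf; exact: interval_open.
Qed.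

Lemma cbox_bigcup : \bigcup_n cbox (- n%:R) n%:R (- n%:R) n%:R = setT.
Proof.
apply/seteqP; split => // p _.
have [n pn] : exists n, Num.max `|p.1| `|p.2| <= n%:R.
  exists (Num.truncn (Num.max `|p.1| `|p.2|)).+1.
  by rewrite ltW// truncnS_gt.
exists n => //; move: pn; rewrite ge_max !ler_norml => /andP[].
by move=> h1 h2; split; rewrite /= in_itv.
Qed.

Lemma L1loc_measurable f : L1loc f ->
  measurable_fun (setT : set (measurableTypeR R * measurableTypeR R)) f.
Proof.
move=> fl; rewrite -cbox_bigcup; apply/measurable_fun_bigcup.
  by move=> n; exact: measurable_cbox.
move=> n; apply/measurable_EFinP; apply: measurable_int.
by apply: fl; exact: compact_cbox.
Qed.

Lemma compact_measurable2 (K : set (R * R)) : compact K ->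
  measurable (K : set (measurableTypeR R * measurableTypeR R)).
Proof.
move=> cK; rewrite -[K]setCK; apply: measurableC; apply: open_measurable2.
by rewrite openC; apply: compact_closed => //; exact: norm_hausdorff.
Qed.

Lemma intg_cst_cbox N (c : R) :
  intg leb2 (fun p => c * \1_(cbox (-N) N (-N) N) p).
Proof.
apply: intgZ; apply/integrableP; split.
  apply/measurable_EFinP; apply: measurable_indic; exact: measurable_cbox.
under eq_integral do rewrite gee0_abs//.
rewrite integral_indic// ?setIT//; last exact: measurable_cbox.
exact: cbox_fin.
Qed.

(* Only the integrals over the boxes matter, so local integrability may be
   tested against indicators of boxes, with all integrals over the plane. *)
Lemma L1locP f : L1loc f <->
  measurable_fun (setT : set (measurableTypeR R * measurableTypeR R)) f /\
  forall N, intg leb2 (fun p => \1_(cbox (-N) N (-N) N) p * f p).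
Proof.
have eqf N : (fun p => (\1_(cbox (-N) N (-N) N) p * f p)%:E) =
    (fun p => (f p)%:E) \_ (cbox (-N) N (-N) N).
  apply/funext => p; rewrite patchE indicE.
  by case: ifPn => h; rewrite ?mul1r ?mul0r.
split=> [fl|[mf fb] K cK].
  split; first exact: L1loc_measurable.
  move=> N; rewrite eqf; apply/integrable_restrict => //.
    exact: measurable_cbox.
  by rewrite setTI; apply: fl; exact: compact_cbox.
have [N N0 KN] := compact_sub_cbox cK.
have fbN : leb2.-integrable (cbox (-N) N (-N) N) (fun p => (f p)%:E).
  have := fb N; rewrite eqf => /integrable_restrict.
  by rewrite setTI; apply => //; exact: measurable_cbox.
have := integrableS (@measurable_cbox (-N) N (-N) N) (compact_measurable2 cK)
  KN fbN.
by [].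
Qed.

Lemma L1loc_mul f g (N M : R) : L1loc f -> measurable_fun setT g ->
  (forall p, `|g p| <= M) -> (forall p, ~ cbox (-N) N (-N) N p -> g p = 0) ->
  intg leb2 (fun p => f p * g p).
Proof.
move=> /L1locP[mf fb] mg gM g0.
have := intgMb (fb N) mg gM; apply: eq_integrable => // p _.
rewrite indicE; case: (boolP (p \in _)) => [_|pN]; first by rewrite mul1r mulrC.
by rewrite g0 ?mulr0 ?mul0r// => /mem_set; apply/negP.
Qed.

Lemma compact_bounded_fun (K : set (R * R)) f : compact K ->
  continuous f -> exists2 M, 0 <= M & forall p, K p -> `|f p| <= M.
Proof.
move=> cK cf; have : compact (f @` K).
  by apply: continuous_compact => //; exact: continuous_subspaceT.
move=> /compact_bounded[M [Mr MK]]; exists (Num.max 0 M + 1).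
  by rewrite addr_ge0// le_max lexx.
move=> p Kp; apply: (MK (Num.max 0 M + 1)); last by exists p.
by rewrite (@le_lt_trans _ _ (Num.max 0 M)) ?ltrDl// le_max lexx orbT.
Qed.

Lemma continuous_L1loc f : continuous f -> L1loc f.
Proof.
move=> cf; apply/L1locP; split; first exact: continuous_measurable2.
move=> N; have [M M0 fM] := compact_bounded_fun (@compact_cbox (-N) N (-N) N) cf.
apply: (intg_le _ _ (intg_cst_cbox N M)).
  apply: measurable_funM; last exact: continuous_measurable2.
  by apply: measurable_indic; exact: measurable_cbox.
move=> p; rewrite indicE; case: (boolP (p \in _)) => [|_].
  by rewrite inE => /fM; rewrite mul1r mulr1.
by rewrite mul0r normr0 mulr0.
Qed.

Lemma L1loc_ae f g : measurable_fun setT f -> {ae leb2, forall p, f p = g p} ->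
  L1loc g -> L1loc f.
Proof.
move=> mf fg /L1locP[mg gb]; apply/L1locP; split => // N.
apply: intg_ae (gb N).
  apply: measurable_funM => //.
  by apply: measurable_indic; exact: measurable_cbox.
by apply: aeS fg => p ->.
Qed.
End Planar.

(** * Test functions *)

Section Smooth1.
Context {R : realType}.
Implicit Types f g : R -> R.

(** Dividing a remainder of size C h^2 by h leaves C |h|. The direction [v] in a normed module lets
    the criterion serve both the flat function at 0 and the partial derivatives of [K]. *)
Lemma quadratic_is_derive (V : normedModType R) (F : V -> R) (x v : V) (d C : R) :
  (forall h : R, `|h| <= 1 -> `|F (h *: v + x) - F x - h * d| <= C * h ^+ 2) ->
  is_derive x v F d.
Proof.
move=> HC.
have C0 : 0 <= C.
  have h1 : `|1 : R| <= 1 by rewrite normr1.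
  by have /(le_trans (normr_ge0 _)) := HC 1 h1; rewrite expr1n mulr1.
have L : h^-1 *: (F (h *: v + x) - F x) @[h --> 0^'] --> d.
  apply/cvgrPdist_le => e e0.
  near=> h.
  have h0 : h != 0 by near: h; exact: nbhs_dnbhs_neq.
  have h1 : `|h| <= 1.
    near: h; apply: dnbhs0_le; exact: ltr01.
  have hd : `|h| <= e / (C + 1).
    by near: h; apply: dnbhs0_le; rewrite divr_gt0// ltr_wpDl.
  have -> : d - h^-1 *: (F (h *: v + x) - F x) =
      - (h^-1 * (F (h *: v + x) - F x - h * d)).
    by rewrite mulrBr mulrA mulVf// mul1r opprB.
  rewrite normrN normrM normfV ler_pdivrMl ?normr_gt0//.
  apply: le_trans (HC h h1) _.
  rewrite -real_normK ?num_real// expr2 mulrCA ler_wpM2l//.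
  apply: (@le_trans _ _ ((C + 1) * `|h|)); first by rewrite ler_wpM2r// lerDl.
  by rewrite mulrC -ler_pdivlMr// ltr_wpDl.
apply: DeriveDef; first by apply/cvg_ex; exists d.
exact/cvg_lim.
Unshelve. all: by end_near. Qed.

Lemma near_is_derive f g (x d : R) : (\near x, f x = g x) ->
  is_derive x (1 : R) f d -> is_derive x (1 : R) g d.
Proof. exact: near_eq_is_derive. Qed.

Fixpoint Ck (k : nat) f : Prop :=
  if k is k'.+1 then (forall x, derivable f x 1) /\ Ck k' (derive1 f) else True.

Definition smooth1 f := forall k, Ck k f.

Lemma smooth1_derivable f x : smooth1 f -> derivable f x 1.
Proof. by move=> /(_ 1%N)[]. Qed.

Lemma smooth1_derive f : smooth1 f -> smooth1 (derive1 f).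
Proof. by move=> sf k; have [] := sf k.+1. Qed.

Lemma smooth1_derive1n n f : smooth1 f -> smooth1 (derive1n n f).
Proof. by elim: n => //= n IH /IH/smooth1_derive. Qed.

Lemma smooth1_continuous f : smooth1 f -> continuous f.
Proof.
move=> sf x; apply: differentiable_continuous; apply/derivable1_diffP.
exact: smooth1_derivable.
Qed.

(** A coinduction principle: smoothness follows from membership in a family closed under derivation.
    It is applied to the functions [flatp p] and to the convolutions [conv p g]. *)
Lemma smooth1P (P : (R -> R) -> Prop) f :
  (forall g, P g -> (forall x, derivable g x 1) /\ P (derive1 g)) -> P f -> smooth1 f.
Proof. by move=> HP Pf k; elim: k f Pf => //= k IH f /HP[df /IH]. Qed.

Lemma CkS k f : Ck k.+1 f -> Ck k f.
Proof. by elim: k f => //= k IH f [df /IH]. Qed.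

Lemma derive1_eq f df : (forall x : R, is_derive x (1 : R) f (df x)) ->
  (forall x, derivable f x 1) /\ (derive1 f) = df.
Proof.
move=> H; split=> [x|]; first by have [] := H x.
by apply/funext => x; rewrite derive1E; have [] := H x.
Qed.

Lemma is_derive1 f x : derivable f x 1 -> is_derive x 1 f ((derive1 f) x).
Proof. by move=> /derivableP; rewrite derive1E. Qed.

Lemma CkD k f g : Ck k f -> Ck k g -> Ck k (fun x => f x + g x).
Proof.
elim: k f g => //= k IH f g [df cf] [dg cg].
have [] := @derive1_eq (fun x => f x + g x) (fun x => (derive1 f) x + (derive1 g) x).
  by move=> x; apply: is_deriveD; exact: is_derive1.
by move=> ? ->; split => //; exact: IH.
Qed.

Lemma CkM k f g : Ck k f -> Ck k g -> Ck k (fun x => f x * g x).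
Proof.
elim: k f g => //= k IH f g [df cf] [dg cg].
have [] := @derive1_eq (fun x => f x * g x)
    (fun x => f x * (derive1 g) x + g x * (derive1 f) x).
  move=> x; have h1 := is_derive1 (df x); have h2 := is_derive1 (dg x).
  by apply: is_deriveM.
move=> ? ->; split => //; apply: CkD; apply: IH => //.
- by apply: CkS; exact: conj df cf.
- by apply: CkS; exact: conj dg cg.
Qed.

Lemma derive1_affine f a b x : derivable f (a * x + b) 1 ->
  is_derive x 1 (fun x => f (a * x + b)) (a * derive1 f (a * x + b)).
Proof.
move=> df; rewrite mulrC.
have h : is_derive x 1 (fun x => a * x + b) a.
  rewrite -[X in is_derive _ _ _ X]addr0; apply: is_deriveD.
  rewrite -[X in is_derive _ _ _ X]mulr1.
  exact: (@is_deriveZ _ _ _ (@idfun R) a x 1 1 (is_derive_id _ _)).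
exact: (@is_derive1_comp _ f (fun x => a * x + b) x _ _ (is_derive1 df) h).
Qed.

Lemma Ck_cst k (c : R) : Ck k (fun=> c).
Proof.
elim: k c => //= k IH c.
have [h ->] := @derive1_eq (fun=> c) (fun=> 0) (fun x => is_derive_cst c x (1 : R)).
by [].
Qed.

Lemma Ck_affine k f a b : Ck k f -> Ck k (fun x => f (a * x + b)).
Proof.
elim: k f => //= k IH f [df cf].
have [] := @derive1_eq (fun x => f (a * x + b))
  (fun x => a * derive1 f (a * x + b)).
  by move=> x; exact: derive1_affine.
by move=> ? ->; split => //; apply: CkM; [exact: Ck_cst|exact: IH].
Qed.

Lemma poly_expN_bounded (p : {poly R}) :
  exists2 C, 0 <= C & forall y, 0 <= y -> `|p.[y]| * expR (- y) <= C.
Proof.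
(* The factor y^n strengthens the induction: the leading part p X of p X + c is handled by the
   hypothesis for p with n + 1. *)
suff: forall n, exists2 C, 0 <= C &
    forall y, 0 <= y -> y ^+ n * `|p.[y]| * expR (- y) <= C.
  move=> /(_ 0%N)[C C0 H]; exists C => // y y0.
  by have := H y y0; rewrite expr0 mul1r.
elim/poly_ind: p => [|p c IH] n.
  by exists 0 => // y _; rewrite horner0 normr0 mulr0 mul0r.
have [C C0 HC] := IH n.+1.
exists (C + `|c| * n.+1%:R ^+ n); first by rewrite addr_ge0// mulr_ge0// exprn_ge0.
move=> y y0; rewrite hornerMXaddC.
apply: (@le_trans _ _ ((y ^+ n.+1 * `|p.[y]| + `|c| * y ^+ n) * expR (- y))).
  rewrite ler_wpM2r ?expR_ge0//.
  apply: (@le_trans _ _ (y ^+ n * (`|p.[y] * y| + `|c|))).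
    by rewrite ler_wpM2l ?exprn_ge0// ler_normD.
  by rewrite normrM (ger0_norm y0) mulrDr exprSr -!mulrA (mulrC y) (mulrC _ `|c|).
rewrite mulrDl lerD ?HC// -mulrA ler_wpM2l//.
rewrite expRN ler_pdivrMr ?expR_gt0//.
(* Each of n factors exp (y / (n + 1)) absorbs one power of y, by exp x >= x; the remaining factor
   is at least 1. *)
have -> : expR y = expR (n.+1%:R^-1 * y) ^+ n.+1.
  by rewrite -expRM_natl -mulr_natl mulrA divff ?mul1r.
have h1 : y <= n.+1%:R * expR (n.+1%:R^-1 * y).
  rewrite -ler_pdivrMl//; apply: le_trans (expR_ge1Dx _).
  by rewrite lerDr.
have h2 : 1 <= expR (n.+1%:R^-1 * y).
  by rewrite -expR0 ler_expR mulr_ge0.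
rewrite exprS mulrCA -exprMn.
apply: (@le_trans _ _ (y ^+ n)).
  by [].
apply: (@le_trans _ _ ((n.+1%:R * expR (n.+1%:R^-1 * y)) ^+ n)).
  by rewrite lerXn2r ?nnegrE// mulr_ge0// expR_ge0.
by rewrite ler_peMl// exprn_ge0// mulr_ge0// expR_ge0.
Qed.

(** The family contains exp (-1/x) and is closed under derivation: differentiating p(1/x) exp (-1/x)
    replaces p by X^2 (p - p'). *)
Definition flatp (p : {poly R}) (x : R) : R :=
  if 0 < x then p.[x^-1] * expR (- x^-1) else 0.

Lemma flatp_is_derive p (x : R) :
  is_derive x (1 : R) (flatp p) (flatp ('X^2 * (p - deriv p)) x).
Proof.
rewrite /flatp; case: ltgtP => x0.
- apply: (@near_is_derive (fun x => p.[x^-1] * expR (- x^-1))).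
    near=> z; rewrite ifT//; near: z; exact: lt_nbhsr.
  have xn0 : x != 0 by rewrite gt_eqF.
  have hV : is_derive x 1 (fun x => x^-1) (- x ^- 2).
    have := @is_deriveV _ (@idfun R) x 1 1 xn0 _.
    by rewrite scaler1 => /(_ (is_derive_id _ _)).
  have hp := @is_derive1_comp _ (horner p) (fun x => x^-1) x _ _
    (is_derive_poly _ _) hV.
  have he := @is_derive1_comp _ (@expR R) (fun x => - x^-1) x _ _
    (is_derive_expR _) (is_deriveN hV).
  apply: (is_derive_eq (is_deriveM hp he)).
  rewrite hornerM hornerXn hornerD hornerN /= /GRing.scale /= opprK.
  by rewrite exprVn; ring.
- have h0 : is_derive x (1 : R) (fun=> 0 : R) 0 by exact: is_derive_cst.
  apply: near_is_derive h0.
  near=> z; rewrite ifF//; apply/negbTE; rewrite -leNgt ltW//.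
  by near: z; exact: lt_nbhsl.
(* At 0 the derivative vanishes because |flatp p h| <= C h^2: with y = 1/h this is the boundedness
   of y^2 p(y) exp (-y). *)
- rewrite -x0; have [C C0 HC] := poly_expN_bounded ('X^2 * p).
  apply: (@quadratic_is_derive _ _ _ _ _ C) => h h1.
  rewrite addr0 ltxx subr0 mulr0 subr0 /GRing.scale/= mulr1.
  case: ifPn => h0; last by rewrite normr0 mulr_ge0// sqr_ge0.
  have := HC h^-1; rewrite invr_ge0 (ltW h0) => /(_ isT).
  rewrite hornerM hornerXn => H.
  have -> : `|p.[h^-1] * expR (- h^-1)| =
      `|h^-1 ^+ 2 * p.[h^-1]| * expR (- h^-1) * h ^+ 2.
    have e2 : `|h^-1 ^+ 2| = h^-1 ^+ 2.
      by rewrite ger0_norm// exprn_ge0// invr_ge0 ltW.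
    rewrite normrM (ger0_norm (expR_ge0 _)) [in RHS]normrM e2.
    by field; rewrite gt_eqF.
  by rewrite ler_wpM2r ?sqr_ge0.
Unshelve. all: by end_near. Qed.

Lemma flatp_smooth p : smooth1 (flatp p).
Proof.
apply: (@smooth1P (fun f => exists q, f = flatp q)); last by exists p.
move=> _ [q ->].
have [h1 h2] := derive1_eq (flatp_is_derive q).
by split => //; rewrite h2; eexists.
Qed.

Definition flat := flatp 1.

Lemma flatE x : flat x = if 0 < x then expR (- x^-1) else 0.
Proof. by rewrite /flat /flatp hornerC mul1r. Qed.

Lemma flat_ge0 x : 0 <= flat x.
Proof. by rewrite flatE; case: ifP => // _; exact: expR_ge0. Qed.

Lemma flat_le1 x : flat x <= 1.
Proof.
rewrite flatE; case: ifP => // x0; rewrite -expR0 ler_expR oppr_le0 invr_ge0.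
exact: ltW.
Qed.

Lemma flat_cvg x : flat (n.+1%:R * x) @[n --> \oo] --> ((0 < x)%R%:R : R).
Proof.
case: (ltP 0 x) => x0; last first.
  rewrite (_ : (fun n => _) = cst 0); first exact: cvg_cst.
  by apply/funext => n; rewrite flatE ifF//; apply/negbTE; rewrite -leNgt pmulr_rle0.
rewrite (_ : (fun n => _) = (fun n => expR (- (n.+1%:R^-1 * x^-1)))); last first.
  by apply/funext => n; rewrite flatE pmulr_rgt0// x0 invfM.
rewrite [X in _ --> X](_ : _ = expR (- (0 * x^-1))); last first.
  by rewrite mul0r oppr0 expR0.
apply: continuous_cvg; first exact: continuous_expR.
apply: cvgN; apply: cvgMl; exact: cvg_harmonic.
Qed.

Definition test1 f :=
  smooth1 f /\ exists N : R, forall x, N < `|x| -> f x = 0.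

(** All these functions vanish off ]a, b[ and, as n grows, tend pointwise to its indicator. The one
    with n = 0 on ]-1, 1[ is reused as the profile of the cutoff. *)
Definition bump (a b : R) (n : nat) (x : R) :=
  flat (n.+1%:R * (x - a)) * flat (n.+1%:R * (b - x)).

Lemma bump_ge0 a b n x : 0 <= bump a b n x.
Proof. by rewrite mulr_ge0// flat_ge0. Qed.

Lemma bump_le1 a b n x : bump a b n x <= 1.
Proof. by rewrite -[leRHS]mulr1 ler_pM// ?flat_ge0 ?flat_le1. Qed.

Lemma bump_cvg a b x : bump a b n x @[n --> \oo] --> (\1_`]a, b[ x : R).
Proof.
rewrite [X in _ --> X](_ : _ = (0 < x - a)%R%:R * (0 < b - x)%R%:R); last first.
  by rewrite indicE mem_setE in_itv/= !subr_gt0; case: (_ < _); case: (_ < _);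
    rewrite ?mulr1 ?mulr0.
apply: cvgM; exact: flat_cvg.
Qed.

Lemma bump_out a b n x : ~~ (a < x < b) -> bump a b n x = 0.
Proof.
rewrite negb_and -!leNgt /bump => /orP[xa|bx].
  by rewrite flatE ifF ?mul0r//; apply/negbTE; rewrite -leNgt pmulr_rle0// subr_le0.
rewrite mulrC flatE ifF ?mul0r//; apply/negbTE.
by rewrite -leNgt pmulr_rle0// subr_le0.
Qed.

Lemma bump_test a b n : test1 (bump a b n).
Proof.
split.
  move=> k; apply: CkM.
    rewrite (_ : (fun x => _) = (fun x => flat (n.+1%:R * x + (- n.+1%:R * a)))).
      exact/Ck_affine/flatp_smooth.
    by apply/funext => x; rewrite mulrBr mulNr.
  rewrite (_ : (fun x => _) = (fun x => flat (- n.+1%:R * x + (n.+1%:R * b)))).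
    exact/Ck_affine/flatp_smooth.
  by apply/funext => x; rewrite mulrBr mulNr addrC.
exists (Num.max `|a| `|b|) => x; rewrite gt_max => /andP[xa xb].
apply: bump_out; apply/negP => /andP[ax xb'].
have [x0|x0] := leP 0 x.
  by move: xb; rewrite (ger0_norm x0) => /(le_lt_trans (ler_norm b)); lra.
move: xa; rewrite (ltr0_norm x0); have := ler_norm (- a); rewrite normrN; lra.
Qed.

Lemma test1_derive f : test1 f -> test1 (derive1 f).
Proof.
move=> [sf [N fN]]; split; first exact: smooth1_derive.
exists N => x Nx; rewrite derive1E.
have h0 : is_derive x (1 : R) (fun=> 0 : R) 0 by exact: is_derive_cst.
have : is_derive x (1 : R) f 0.
  apply: near_is_derive h0.
  near=> z; rewrite [RHS]fN//; near: z.
  exact: (@cvgr_norm_gt _ _ _ _ _ id x cvg_id).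
by case.
Unshelve. all: by end_near. Qed.

Lemma test1_derive1n n f : test1 f -> test1 (derive1n n f).
Proof. by elim: n => //= n IH /IH/test1_derive. Qed.

Lemma test1_bounded f : test1 f -> exists2 M, 0 <= M & forall x, `|f x| <= M.
Proof.
move=> [sf [N fN]].
have : compact (f @` `[-N, N]).
  apply: continuous_compact; last exact: segment_compact.
  by apply: continuous_subspaceT; exact: smooth1_continuous.
move=> /compact_bounded[M [Mr MK]]; exists (Num.max 0 M + 1).
  by rewrite addr_ge0// le_max lexx.
move=> x; have [xN|xN] := leP `|x| N; last first.
  by rewrite fN// normr0 addr_ge0// le_max lexx.
apply: (MK (Num.max 0 M + 1)).
  by rewrite (@le_lt_trans _ _ (Num.max 0 M)) ?ltrDl// le_max lexx orbT.
by exists x => //=; rewrite in_itv/= -ler_norml.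
Qed.

End Smooth1.

(** * Products of one-variable test functions *)

Section Tensor.
Context {R : realType}.
Implicit Types (f g : R * R -> R) (psi chi : R -> R).

Lemma is_derive_x f (x y d : R) : is_derive (x, y) ((1, 0) : R * R) f d <->
  is_derive x (1 : R) (fun z => f (z, y)) d.
Proof.
have E : (fun h : R => h^-1 *: (f (h *: ((1, 0) : R * R) + (x, y)) - f (x, y))) =
   (fun h : R => h^-1 *: (f (h *: (1 : R) + x, y) - f (x, y))).
  apply/funext => h; congr (_ *: (f _ - _)).
  by rewrite -[LHS]/(h * 1 + x, h * 0 + y) mulr0 add0r.
by split=> -[d1 d2]; apply: DeriveDef; move: d1 d2; rewrite /derivable /derive/= E.
Qed.

Lemma is_derive_y f (x y d : R) : is_derive (x, y) ((0, 1) : R * R) f d <->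
  is_derive y (1 : R) (fun z => f (x, z)) d.
Proof.
have E : (fun h : R => h^-1 *: (f (h *: ((0, 1) : R * R) + (x, y)) - f (x, y))) =
   (fun h : R => h^-1 *: (f (x, h *: (1 : R) + y) - f (x, y))).
  apply/funext => h; congr (_ *: (f _ - _)).
  by rewrite -[LHS]/(h * 0 + x, h * 1 + y) mulr0 add0r.
by split=> -[d1 d2]; apply: DeriveDef; move: d1 d2; rewrite /derivable /derive/= E.
Qed.

(** Testing against products alone already determines a locally integrable function almost
    everywhere, and it reduces the parametrix to one variable at a time. *)
Definition tensor psi chi (p : R * R) : R := psi p.1 * chi p.2.

Lemma dx_tensor psi chi : (forall x, derivable psi x 1) ->
  dx (tensor psi chi) = tensor (derive1 psi) chi.
Proof.
move=> dpsi; apply/funext => -[x y].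
have : is_derive (x, y) ((1, 0) : R * R) (tensor psi chi)
    (tensor (derive1 psi) chi (x, y)).
  apply/is_derive_x; rewrite /tensor/=.
  have -> : derive1 psi x * chi y = chi y *: derive1 psi x by rewrite mulrC.
  rewrite (_ : (fun z => _) = chi y *: psi); last first.
    by apply/funext => z; rewrite mulrC.
  exact/is_deriveZ/is_derive1.
by case.
Qed.

Lemma dy_tensor psi chi : (forall x, derivable chi x 1) ->
  dy (tensor psi chi) = tensor psi (derive1 chi).
Proof.
move=> dpsi; apply/funext => -[x y].
have : is_derive (x, y) ((0, 1) : R * R) (tensor psi chi)
    (tensor psi (derive1 chi) (x, y)).
  apply/is_derive_y; rewrite /tensor/=.
  exact: (is_deriveZ (psi x) (is_derive1 (dpsi y))).
by case.
Qed.

Lemma pderiv_tensor m n psi chi : smooth1 psi -> smooth1 chi ->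
  pderiv (m, n) (tensor psi chi) = tensor (derive1n m psi) (derive1n n chi).
Proof.
move=> spsi schi; rewrite /pderiv/=.
have -> : iter n dy (tensor psi chi) = tensor psi (derive1n n chi).
  elim: n => //= n ->; rewrite dy_tensor// => x.
  exact/smooth1_derivable/smooth1_derive1n.
elim: m => //= m ->; rewrite dx_tensor// => x.
exact/smooth1_derivable/smooth1_derive1n.
Qed.

Lemma differentiable_tensor psi chi p : smooth1 psi -> smooth1 chi ->
  differentiable (tensor psi chi) p.
Proof.
move=> spsi schi.
have c1 : continuous (fst : R * R -> R) by move=> z; exact: cvg_fst.
have c2 : continuous (snd : R * R -> R) by move=> z; exact: cvg_snd.
have d1 : differentiable (fst : R * R -> R) p by exact: linear_differentiable.
have d2 : differentiable (snd : R * R -> R) p by exact: linear_differentiable.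
apply: differentiableM.
- apply: (differentiable_comp d1); apply/derivable1_diffP.
  exact: smooth1_derivable.
- apply: (differentiable_comp d2); apply/derivable1_diffP.
  exact: smooth1_derivable.
Qed.

Lemma continuous_tensor psi chi : continuous psi -> continuous chi ->
  continuous (tensor psi chi).
Proof.
move=> cpsi cchi p; apply: cvgM.
- by apply: (@cvg_comp _ _ _ fst psi); [exact: cvg_fst|exact: cpsi].
- by apply: (@cvg_comp _ _ _ snd chi); [exact: cvg_snd|exact: cchi].
Qed.

Lemma test_function_tensor psi chi : test1 psi -> test1 chi ->
  test_function (tensor psi chi).
Proof.
move=> [spsi [M psiM]] [schi [N chiN]]; split.
  move=> [m n] p; rewrite pderiv_tensor//.
  by apply: differentiable_tensor; exact: smooth1_derive1n.
pose K := cbox (-M) M (-N) N.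
have cK : compact K by exact: compact_cbox.
apply: (subclosed_compact _ cK); first exact: closed_closure.
have clK : closed K by apply: compact_closed => //; exact: norm_hausdorff.
rewrite -[K]/K; move/closure_id : clK => ->.
apply: closure_subset => p /=; rewrite /tensor => pn0.
split; rewrite /= in_itv/= -ler_norml leNgt; apply/negP => h; move: pn0.
- by rewrite psiM// mul0r eqxx.
- by rewrite chiN// mulr0 eqxx.
Qed.

Lemma test1_tensor_box psi chi : test1 psi -> test1 chi ->
  exists2 N, 0 < N & forall p, ~ cbox (-N) N (-N) N p -> tensor psi chi p = 0.
Proof.
move=> [spsi [M psiM]] [schi [N chiN]].
exists (Num.max 1 (Num.max M N)); first by rewrite lt_max ltr01.
move=> p pN; rewrite /tensor.
have [h|h] := ltP M `|p.1|; first by rewrite psiM// mul0r.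
have [h'|h'] := ltP N `|p.2|; first by rewrite chiN// mulr0.
exfalso; apply: pN; split; rewrite /= in_itv/= -ler_norml !le_max ?h ?h' !orbT//.
Qed.

Lemma test1_tensor_bounded psi chi : test1 psi -> test1 chi ->
  exists2 M, 0 <= M & forall p, `|tensor psi chi p| <= M.
Proof.
move=> /test1_bounded[M M0 HM] /test1_bounded[N N0 HN].
by exists (M * N); [exact: mulr_ge0|move=> p; rewrite normrM ler_pM].
Qed.

Lemma L1loc_mul_tensor f psi chi : L1loc f -> test1 psi -> test1 chi ->
  intg leb2 (fun p => f p * tensor psi chi p).
Proof.
move=> fl tpsi tchi.
have [N N0 HN] := test1_tensor_box tpsi tchi.
have [M M0 HM] := test1_tensor_bounded tpsi tchi.
apply: (L1loc_mul fl _ HM HN).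
by apply: continuous_measurable2; apply: continuous_tensor;
  apply: smooth1_continuous; [case: tpsi|case: tchi].
Qed.
End Tensor.

(** * The fundamental lemma of the calculus of variations *)

Section FundamentalLemma.
Context {R : realType}.
Notation leb := (@lebesgue_measure R).
Notation R2 := (measurableTypeR R * measurableTypeR R)%type.
Implicit Types (h f g : R * R -> R).

(** Products of bumps tend to the indicator of the box and vanish outside one fixed compact box, on
    which [h] is integrable; dominated convergence applies. *)
Lemma obox_integral0 h : L1loc h ->
  (forall psi chi, test1 psi -> test1 chi ->
    \int[leb2]_(p in setT) (h p * tensor psi chi p) = 0) ->
  forall a b c d, \int[leb2]_(p in setT) (h p * \1_(obox a b c d) p) = 0.
Proof.
move=> hl h0 a b c d.
pose N := Num.max (Num.max `|a| `|b|) (Num.max `|c| `|d|).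
have abN (x y z : R) : `|x| <= N -> `|y| <= N -> x < z < y -> `[-N, N]%classic z.
  by rewrite /= in_itv/= !ler_norml => /andP[? ?] /andP[? ?] /andP[? ?]; lra.
have oN p : obox a b c d p -> cbox (-N) N (-N) N p.
  move=> [/=]; rewrite !in_itv/= => hx hy; split.
    by apply: abN hx; rewrite /N !le_max lexx ?orbT.
  by apply: abN hy; rewrite /N !le_max lexx ?orbT.
pose F n p := h p * tensor (bump a b n) (bump c d n) p.
have mh := L1loc_measurable hl.
have mt n : measurable_fun (setT : set R2) (tensor (bump a b n) (bump c d n)).
  have [sb _] := bump_test a b n; have [sc _] := bump_test c d n.
  by apply: continuous_measurable2; apply: continuous_tensor;
    exact: smooth1_continuous.
have [_ hN] := (L1locP h).1 hl.
have cv : \int[leb2]_(p in setT) F n p @[n --> \oo] -->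
    \int[leb2]_(p in setT) (h p * \1_(obox a b c d) p).
  apply: (@RI_dct _ _ _ leb2 F _ (fun p => `|\1_(cbox (-N) N (-N) N) p * h p|)).
  - by move=> n; apply: measurable_funM.
  - apply: measurable_funM => //; apply: measurable_indic.
    exact: measurable_obox.
  - move=> p; rewrite /F; apply: cvgMr.
    rewrite (_ : \1_(obox a b c d) p = \1_`]a, b[ p.1 * \1_`]c, d[ p.2).
      by apply: cvgM; exact: bump_cvg.
    rewrite !indicE; case: (boolP (p \in obox a b c d)).
      by rewrite inE => -[/mem_set -> /mem_set ->]; rewrite mulr1.
    move=> /negP; rewrite inE /obox /= => pn.
    case: (boolP (p.1 \in _)); rewrite ?mul0r// inE => p1.
    case: (boolP (p.2 \in _)); rewrite ?mulr0// inE => p2.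
    by exfalso; apply: pn.
  - move=> n p; rewrite /F [leRHS]normrM normrM indicE.
    case: (boolP (p \in cbox _ _ _ _)) => pN.
      rewrite normr1 mul1r ler_piMr// /tensor normrM mulr_ile1//;
      by rewrite ger0_norm ?bump_ge0 ?bump_le1.
    rewrite (_ : tensor _ _ p = 0) ?normr0 ?mulr0 ?mul0r//.
    rewrite /tensor; have [p1|p1] := boolP (a < p.1 < b); last first.
      by rewrite bump_out// mul0r.
    have [p2|p2] := boolP (c < p.2 < d); last first.
      by rewrite [X in _ * X]bump_out// mulr0.
    exfalso; move/negP: pN; apply; rewrite inE; apply: oN.
    by split; rewrite /= in_itv.
  - by apply: intg_norm; exact: hN.
have F0 n : \int[leb2]_(p in setT) F n p = 0 by apply: h0; exact: bump_test.
move: cv; under eq_fun do rewrite F0.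
by move/cvg_lim => <- //; rewrite lim_cst.
Qed.

(* Dynkin's lemma, with the whole line recovered from growing intervals. *)
Lemma measurable_ind_itv (P : set R -> Prop) : P setT ->
  (forall a b, P `]a, b[%classic) ->
  (forall A, measurable A -> P A -> P (~` A)) ->
  (forall F : (set R)^nat, trivIset setT F -> (forall n, measurable (F n)) ->
     (forall n, P (F n)) -> P (\bigcup_n F n)) ->
  forall A, measurable A -> P A.
Proof.
move=> PT Pitv PC PU.
pose H (A : set (measurableTypeR R)) := measurable A /\ P A.
have dH : dynkin H.
  split.
  - by split => //; exact: measurableT.
  - by move=> A [mA PA]; split; [exact: measurableC|exact: PC].
  - move=> F tF HF; split.
      by apply: bigcupT_measurable => n; have [] := HF n.
    by apply: PU => // n; have [] := HF n.
have lH : lambda_system setT H by apply/dynkin_lambda_system.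
have GH : @RGenOpens.G R `<=` H.
  by move=> _ [a [b ->]]; split => //; exact: measurable_itv.
have IG : setI_closed (@RGenOpens.G R).
  move=> _ _ [a [b ->]] [c [d ->]].
  exists (Num.max a c), (Num.min b d); apply/seteqP; split=> x /=.
    rewrite !in_itv/= gt_max lt_min => -[/andP[-> ->] /andP[-> ->]]//.
  by rewrite !in_itv/= gt_max lt_min => /andP[/andP[-> ->] /andP[-> ->]].
have sub := lambda_system_subset IG lH GH (fun X _ => @subsetT _ X).
move=> A mA; have : (@RGenOpens.G R).-sigma.-measurable A by rewrite -RGenOpens.measurableE.
by move/sub => [].
Qed.

Lemma integral0_setC h (A B : set R2) : intg leb2 h -> measurable A ->
  measurable B -> A `&` B = set0 ->
  \int[leb2]_(p in setT) (h p * \1_(A `|` B) p) =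
  \int[leb2]_(p in setT) (h p * \1_A p) + \int[leb2]_(p in setT) (h p * \1_B p).
Proof.
move=> hi mA mB AB.
have hI (C : set R2) : measurable C -> intg leb2 (fun p => h p * \1_C p).
  move=> mC; apply: (intg_le _ _ (intg_norm hi)).
    apply: measurable_funM; [exact: intg_meas hi|exact: measurable_indic].
  by move=> p; rewrite normrM ler_piMr// indicE; case: (_ \in _);
    rewrite ?normr1 ?normr0.
rewrite -RID; [|exact: hI..].
apply: RI_eq => p; rewrite -mulrDr; congr (_ * _).
rewrite !indicE in_setU.
case: (boolP (p \in A)) => pA; case: (boolP (p \in B)) => pB //=;
  rewrite ?addr0 ?add0r//.
have : (A `&` B) p by split; exact: set_mem.
by rewrite AB.
Qed.

Lemma intg_indic h (C : set R2) : intg leb2 h -> measurable C ->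
  intg leb2 (fun p => h p * \1_C p).
Proof.
move=> hi mC; apply: (intg_le _ _ (intg_norm hi)).
  apply: measurable_funM; [exact: intg_meas hi|exact: measurable_indic].
by move=> p; rewrite normrM ler_piMr// indicE; case: (_ \in _);
  rewrite ?normr1 ?normr0.
Qed.

Lemma integral0_lim h (F : (set R2)^nat) (A : set R2) : intg leb2 h ->
  (forall n, measurable (F n)) -> measurable A -> (forall n, F n `<=` A) ->
  (forall p, A p -> exists n0, forall n, (n0 <= n)%N -> F n p) ->
  (forall n, \int[leb2]_(p in setT) (h p * \1_(F n) p) = 0) ->
  \int[leb2]_(p in setT) (h p * \1_A p) = 0.
Proof.
move=> hi mF mA FA AF F0.
have cv : \int[leb2]_(p in setT) (h p * \1_(F n) p) @[n --> \oo] -->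
    \int[leb2]_(p in setT) (h p * \1_A p).
  apply: (@RI_dct _ _ _ leb2 (fun n p => h p * \1_(F n) p) _ (fun p => `|h p|)).
  - by move=> n; apply: intg_meas; exact: intg_indic.
  - by apply: intg_meas; exact: intg_indic.
  - move=> p; apply: cvgMr.
    have [Ap|nA] := pselect (A p).
      have [n0 Hn0] := AF p Ap.
      rewrite indicE mem_set//; apply: cvg_near_cst; exists n0 => // m /= nm.
      by rewrite indicE mem_set//; exact: Hn0.
    rewrite indicE memNset//; apply: cvg_near_cst; apply: nearW => m.
    by rewrite indicE memNset// => /FA.
  - by move=> n p; rewrite normrM ler_piMr// indicE; case: (_ \in _);
      rewrite ?normr1 ?normr0.
  - exact: intg_norm.
move: cv; under eq_fun do rewrite F0.
by move/cvg_lim => <- //; rewrite lim_cst.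
Qed.

Lemma integral0_bigcup h (F : (set R2)^nat) : intg leb2 h ->
  trivIset setT F -> (forall n, measurable (F n)) ->
  (forall n, \int[leb2]_(p in setT) (h p * \1_(F n) p) = 0) ->
  \int[leb2]_(p in setT) (h p * \1_(\bigcup_n F n) p) = 0.
Proof.
move=> hi tF mF F0.
pose G n := \big[setU/set0]_(i < n) F i.
have mG n : measurable (G n) by apply: bigsetU_measurable.
apply: (integral0_lim hi mG).
- exact: bigcupT_measurable.
- by move=> n p; rewrite /G -bigcup_mkord => -[k _ Fkp]; exists k.
- move=> p [k _ Fkp]; exists k.+1 => n kn.
  by rewrite /G -bigcup_mkord; exists k.
elim=> [|n IH].
  rewrite /G big_ord0 (@RI_eq _ _ _ _ _ (fun=> 0)) ?RI0// => p.
  by rewrite indic0 mulr0.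
rewrite /G big_ord_recr/= integral0_setC//; [by rewrite IH F0 addr0|exact: mG|].
apply/seteqP; split => // p []; rewrite -bigcup_mkord => -[k /= kn Fkp] Fnp.
have kn' : k = n by apply: tF => //; exists p.
by move: kn; rewrite kn' ltnn.
Qed.

Lemma integral0_setD h (A B : set R2) : intg leb2 h -> measurable A ->
  measurable B -> A `&` B = set0 ->
  \int[leb2]_(p in setT) (h p * \1_A p) = 0 ->
  \int[leb2]_(p in setT) (h p * \1_(A `|` B) p) = 0 ->
  \int[leb2]_(p in setT) (h p * \1_B p) = 0.
Proof. by move=> hi mA mB AB A0; rewrite integral0_setC// A0 add0r. Qed.

Let nat_gt (x : R) : exists n0, forall n, (n0 <= n)%N -> `](- n%:R), n%:R[%classic x.
Proof.
exists (Num.truncn `|x|).+1 => n xn.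
have : `|x| < n%:R by apply: lt_le_trans (truncnS_gt _) _; rewrite ler_nat.
by rewrite ltr_norml /= in_itv/=.
Qed.

(** The Dynkin argument runs once in each variable: first for a measurable first factor and an open
    interval as second factor, then for a measurable second factor. *)
Lemma integral0_rect h : intg leb2 h ->
  (forall a b c d, \int[leb2]_(p in setT) (h p * \1_(obox a b c d) p) = 0) ->
  forall A B : set R, measurable A -> measurable B ->
  \int[leb2]_(p in setT) (h p * \1_(A `*` B) p) = 0.
Proof.
move=> hi h0.
have step1 c d A : measurable A ->
    \int[leb2]_(p in setT) (h p * \1_(A `*` `]c, d[) p) = 0.
  move: A.
  have hT : \int[leb2]_(p in setT) (h p * \1_(setT `*` `]c, d[) p) = 0.
    apply: (@integral0_lim _ (fun n => obox (- n%:R) n%:R c d)) => //.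
    - by move=> n; exact: measurable_obox.
    - by apply: measurableX => //; exact: measurable_itv.
    - by move=> n p [].
    - by move=> p [_ pcd]; have [n0 Hn0] := nat_gt p.1; exists n0 => n /Hn0.
  apply: measurable_ind_itv => //.
  - by move=> a b; exact: h0.
  - move=> A mA A0; apply: (@integral0_setD _ (A `*` `]c, d[)) => //.
    + by apply: measurableX => //; exact: measurable_itv.
    + by apply: measurableX; [exact: measurableC|exact: measurable_itv].
    + by apply/seteqP; split => // p [[]] ? _ [].
    + rewrite (_ : _ `|` _ = setT `*` `]c, d[)//; apply/seteqP; split=> p.
        by case=> -[].
      by move=> [_ ?]; have [?|?] := pselect (A p.1); [left|right].
  - move=> F tF mF F0; rewrite (_ : _ `*` _ = \bigcup_n (F n `*` `]c, d[)).
      apply: integral0_bigcup => //.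
      + by move=> i j _ _ [p [[pi _] [pj _]]]; apply: tF => //; exists p.1.
      + by move=> n; apply: measurableX; [exact: mF|exact: measurable_itv].
    apply/seteqP; split=> [p [[n _ Fn] ?]|p [n _ [? ?]]]; first by exists n.
    by split => //; exists n.
move=> A B mA; move: B.
have hT : \int[leb2]_(p in setT) (h p * \1_(A `*` setT) p) = 0.
  apply: (@integral0_lim _ (fun n => A `*` `](- n%:R), n%:R[)) => //.
  - by move=> n; apply: measurableX => //; exact: measurable_itv.
  - by apply: measurableX.
  - by move=> n p [].
  - by move=> p [pA _]; have [n0 Hn0] := nat_gt p.2; exists n0 => n /Hn0.
  - by move=> n; exact: step1.
apply: measurable_ind_itv => //.
- by move=> a b; exact: step1.
- move=> B mB B0; apply: (@integral0_setD _ (A `*` B)) => //.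
  + by apply: measurableX.
  + by apply: measurableX => //; exact: measurableC.
  + by apply/seteqP; split => // p [[]] _ ? [].
  + rewrite (_ : _ `|` _ = A `*` setT)//; apply/seteqP; split=> p.
      by case=> -[].
    by move=> [? _]; have [?|?] := pselect (B p.2); [left|right].
- move=> F tF mF F0; rewrite (_ : _ `*` _ = \bigcup_n (A `*` F n)).
    apply: integral0_bigcup => //.
    + by move=> i j _ _ [p [[_ pi] [_ pj]]]; apply: tF => //; exists p.2.
    + by move=> n; apply: measurableX; [exact: mA|exact: mF].
  apply/seteqP; split=> [p [? [n _ Fn]]|p [n _ [? ?]]]; first by exists n.
  by split => //; exists n.
Qed.

(** Measurable rectangles are closed under intersection and generate the product sigma-algebra, so a
    last Dynkin argument makes the integral of [h] vanish over every measurable set. *)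
Lemma integral0_ae h : intg leb2 h ->
  (forall a b c d, \int[leb2]_(p in setT) (h p * \1_(obox a b c d) p) = 0) ->
  {ae leb2, forall p, h p = 0}.
Proof.
move=> hi h0; have hr := integral0_rect hi h0.
pose H (C : set R2) := measurable C /\
  \int[leb2]_(p in setT) (h p * \1_C p) = 0.
have dH : dynkin H.
  have HT : H setT.
    split; first exact: measurableT.
    by have := hr setT setT measurableT measurableT; rewrite setXTT.
  split => //.
  - move=> A [mA A0]; split; first exact: measurableC.
    apply: (@integral0_setD _ A) => //; first exact: measurableC.
      by rewrite setICr.
    by rewrite setUv; case: HT.
  - move=> F tF HF; split.
      by apply: bigcupT_measurable => n; have [] := HF n.
    by apply: integral0_bigcup => // n; have [] := HF n.
pose G := [set A `*` B | A in @measurable _ (measurableTypeR R) &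
  B in @measurable _ (measurableTypeR R)].
have lH : lambda_system setT H by apply/dynkin_lambda_system.
have GH : G `<=` H.
  by move=> _ [A mA [B mB <-]]; split; [exact: measurableX|exact: hr].
have IG : setI_closed G.
  move=> _ _ [A mA [B mB <-]] [C mC [E mE <-]].
  exists (A `&` C); first exact: measurableI.
  by exists (B `&` E); [exact: measurableI|rewrite setXI].
have sub := lambda_system_subset IG lH GH (fun X _ => @subsetT _ X).
have all0 (C : set R2) : measurable C ->
    \int[leb2]_(p in setT) (h p * \1_C p) = 0.
  move=> mC; have : <<s G >> C by rewrite -measurable_prod_measurableType.
  by move/sub => [].
have := @integral_ae_eq _ _ R leb2 setT measurableT (fun=> 0%E)
  (fun p => (h p)%:E) hi (measurable_cst _) _.
move=> H1; apply: (aeS _ (H1 _)); first by move=> p /(_ I)[].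
move=> E _ mE; rewrite integral0 integral_mkcond.
have := all0 E mE; rewrite /Rintegral.
have -> : (\int[leb2]_x (((fun p => (h p)%:E) \_ E) x) =
   \int[leb2]_x (h x * \1_E x)%:E)%E.
  apply: eq_integral => p _; rewrite patchE indicE.
  by case: ifP; rewrite ?mulr1 ?mulr0.
(* A real integral equal to 0 could hide an infinite one; integrability allows the return through
   [fine]. *)
move=> E0; rewrite -(@fineK _ (\int[leb2]_x _)%E) ?E0//.
apply: integrable_fin_num => //.
exact: intg_indic.
Qed.

(** [h] is only locally integrable, so its truncations to the boxes ]-n, n[^2 are treated one by
    one. The intersection of two boxes is a box, hence the truncations inherit vanishing integrals
    over boxes, and countably many null sets are united. *)
Theorem fundamental_lemma h : L1loc h ->
  (forall psi chi, test1 psi -> test1 chi ->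
    \int[leb2]_(p in setT) (h p * tensor psi chi p) = 0) ->
  {ae leb2, forall p, h p = 0}.
Proof.
move=> hl h0; have ho := obox_integral0 hl h0.
have [mh hN] := (L1locP h).1 hl.
have aeN n : {ae leb2, forall p, h p * \1_(obox (- n%:R) n%:R (- n%:R) n%:R) p = 0}.
  have E p : h p * \1_(obox (- n%:R) n%:R (- n%:R) n%:R) p =
      \1_(cbox (- n%:R) n%:R (- n%:R) n%:R) p * h p *
      \1_(obox (- n%:R) n%:R (- n%:R) n%:R) p.
    rewrite [X in _ = X * _]mulrC -mulrA; congr (_ * _).
    rewrite !indicE; case: (boolP (p \in obox _ _ _ _)) => pn; last by rewrite mulr0.
    rewrite mem_set ?mulr1//; move: pn; rewrite inE => -[/= h1 h2].
    by split; exact: subset_itv_oo_cc.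
  apply: (@aeS _ _ _ leb2 (fun p => \1_(cbox (- n%:R) n%:R (- n%:R) n%:R) p * h p *
      \1_(obox (- n%:R) n%:R (- n%:R) n%:R) p = 0)).
    by move=> p; rewrite E.
  apply: integral0_ae.
    by apply: intg_indic => //; exact: measurable_obox.
  move=> a b c d.
  rewrite -(ho (Num.max (- n%:R) a) (Num.min n%:R b)
               (Num.max (- n%:R) c) (Num.min n%:R d)).
  apply: RI_eq => p; rewrite [\1_(cbox _ _ _ _) p * h p]mulrC -!mulrA; congr (_ * _).
  set K := cbox _ _ _ _; set O := obox (- _) _ _ _; set Q := obox a _ _ _.
  have OK : O `<=` K by move=> z [z1 z2]; split; exact: subset_itv_oo_cc.
  have -> : obox (Num.max (- n%:R) a) (Num.min n%:R b)
      (Num.max (- n%:R) c) (Num.min n%:R d) = O `&` Q.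
    apply/seteqP; split=> z; rewrite /O /Q /obox /=.
      rewrite !in_itv/= !gt_max !lt_min.
      by move=> [/andP[/andP[-> ->] /andP[-> ->]] /andP[/andP[-> ->] /andP[-> ->]]].
    rewrite !in_itv/= !gt_max !lt_min.
    by move=> [[/andP[-> ->] /andP[-> ->]] [/andP[-> ->] /andP[-> ->]]].
  rewrite !indicE in_setI; case: (boolP (p \in O)) => pO; last first.
    by rewrite mul0r mulr0.
  by rewrite (mem_set (OK _ (set_mem pO))) !mul1r.
have := ae_foralln aeN.
apply: aeS => p Hp.
have [n pn] : exists n, obox (- n%:R) n%:R (- n%:R) n%:R p.
  have [n Hn] := nat_gt p.1; have [m Hm] := nat_gt p.2.
  exists (maxn n m); split; [exact/Hn/leq_maxl|exact/Hm/leq_maxr].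
by have := Hp n; rewrite indicE mem_set// mulr1.
Qed.
End FundamentalLemma.

(** * Uniqueness of weak derivatives *)

Section WeakUniqueness.
Context {R : realType}.
Implicit Types (h f g : R * R -> R).

Lemma is_wderiv_unique al f g1 g2 : is_wderiv al f g1 -> is_wderiv al f g2 ->
  {ae leb2, forall p, g1 p = g2 p}.
Proof.
move=> [_ l1 H1] [_ l2 H2].
have h0 : {ae leb2, forall p, g1 p - g2 p = 0}; last first.
  by apply: aeS h0 => p /eqP; rewrite subr_eq0 => /eqP.
have [m1 i1] := (L1locP g1).1 l1; have [m2 i2] := (L1locP g2).1 l2.
apply: fundamental_lemma.
  apply/L1locP; split; first exact: measurable_funB.
  move=> N; apply: (@eq_integrable _ _ _ _ _ _ _ _ _ (intgB (i1 N) (i2 N))) => //.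
  by move=> p _; rewrite mulrBr.
move=> psi chi tpsi tchi.
have tt := test_function_tensor tpsi tchi.
have := H1 _ tt; rewrite (H2 _ tt) => /(mulfI _) => E.
transitivity (\int[leb2]_(p in setT)
    (g1 p * tensor psi chi p - g2 p * tensor psi chi p)).
  by apply: RI_eq => p; rewrite mulrBl.
rewrite RIB; [|exact: L1loc_mul_tensor..].
by rewrite -E ?subrr// signr_eq0.
Qed.

Lemma wderiv_is_wderiv al f g : is_wderiv al f g -> is_wderiv al f (wderiv al f).
Proof. by move=> fg; rewrite /wderiv; apply: (getPex (ex_intro _ g fg)). Qed.

Lemma wderiv_ae al f g : is_wderiv al f g -> {ae leb2, forall p, wderiv al f p = g p}.
Proof. by move=> fg; exact: is_wderiv_unique (wderiv_is_wderiv fg) fg. Qed.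

Lemma wderiv_L1loc al f g : is_wderiv al f g -> L1loc (wderiv al f).
Proof. by move=> /wderiv_is_wderiv[]. Qed.

End WeakUniqueness.

(** * A parametrix for the third derivative *)

Section Kernel1D.
Context {R : realType}.
Notation leb := (@lebesgue_measure R).
Implicit Types (p q : {poly R}) (psi chi : R -> R).

Definition clamp (s : R) : R := Num.max 0 (Num.min 1 s).

Lemma clamp01 s : 0 <= clamp s <= 1.
Proof. by rewrite /clamp le_max lexx ge_max ler01 ge_min lexx. Qed.

Lemma clamp_id s : 0 <= s <= 1 -> clamp s = s.
Proof. by move=> /andP[s0 s1]; rewrite /clamp (min_idPr s1) (max_idPr s0). Qed.

Lemma clamp_le0 s : s <= 0 -> clamp s = 0.
Proof.
move=> s0; rewrite /clamp; apply/max_idPl; rewrite ge_min s0 orbT//.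
Qed.

Lemma clamp_ge1 s : 1 <= s -> clamp s = 1.
Proof. by move=> s1; rewrite /clamp (min_idPl s1) (max_idPr ler01). Qed.

Lemma clamp_lip s t : `|clamp s - clamp t| <= `|s - t|.
Proof.
rewrite /clamp.
have H (a b : R) : a <= b -> `|clamp a - clamp b| <= `|a - b|.
  move=> ab; rewrite ler_norml ler0_norm ?subr_le0// opprB.
  have [a0|a0] := leP a 0; first rewrite (clamp_le0 a0).
    have [b0|b0] := leP b 0; first by rewrite (clamp_le0 b0); lra.
    have [b1|b1] := leP b 1; first by rewrite (@clamp_id b); lra.
    by rewrite (@clamp_ge1 b); lra.
  have [a1|a1] := leP a 1; last by rewrite !clamp_ge1; lra.
  rewrite (@clamp_id a); last by lra.
  have [b1|b1] := leP b 1; first by rewrite (@clamp_id b); lra.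
  by rewrite (@clamp_ge1 b); lra.
have [st|/ltW ts] := leP s t; first exact: H.
by rewrite distrC (distrC s); exact: H.
Qed.

(** Composition with the projection onto [0, 1] makes every polynomial kernel bounded and Lipschitz
    on the line. When p vanishes at 0 and 1 it is the extension of p by zero. *)
Definition ker p (s : R) : R := p.[clamp s].

Lemma poly_bounded01 p : exists2 M, 0 <= M & forall s, 0 <= s <= 1 -> `|p.[s]| <= M.
Proof.
elim/poly_ind: p => [|p c [M M0 HM]].
  by exists 0 => // s _; rewrite horner0 normr0.
exists (M + `|c|); first by rewrite addr_ge0.
move=> s s01; rewrite hornerMXaddC (le_trans (ler_normD _ _))// lerD2r normrM.
have /andP[s0 s1] := s01.
by rewrite -[leRHS]mulr1 ler_pM ?HM// ger0_norm.
Qed.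

Lemma poly_lip01 p : exists2 L, 0 <= L &
  forall s t, 0 <= s <= 1 -> 0 <= t <= 1 -> `|p.[s] - p.[t]| <= L * `|s - t|.
Proof.
elim/poly_ind: p => [|p c [L L0 HL]].
  by exists 0 => // s t _ _; rewrite !horner0 subrr normr0 mul0r.
have [M M0 HM] := poly_bounded01 p.
exists (L + M); first by rewrite addr_ge0.
move=> s t s01 t01; rewrite !hornerMXaddC.
have -> : p.[s] * s + c - (p.[t] * t + c) = (p.[s] - p.[t]) * s + p.[t] * (s - t).
  by ring.
have /andP[s0 s1] := s01.
apply: le_trans (ler_normD _ _) _; rewrite [leRHS]mulrDl !normrM; apply: lerD.
  by rewrite -[leRHS]mulr1 ler_pM ?mulr_ge0 ?HL// ger0_norm.
by rewrite ler_wpM2r// HM.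
Qed.

(** In passing from p to p X + c the new remainder is s times the old one plus (t - s)(p(t) - p(s)),
    and the latter is quadratic by the Lipschitz bound. *)
Lemma poly_taylor01 p : exists2 L, 0 <= L & forall s t, 0 <= s <= 1 ->
  0 <= t <= 1 -> `|p.[t] - p.[s] - p^`().[s] * (t - s)| <= L * (t - s) ^+ 2.
Proof.
elim/poly_ind: p => [|p c [L L0 HL]].
  by exists 0 => // s t _ _; rewrite deriv0 !horner0 mul0r !subr0 normr0 mul0r.
have [K K0 HK] := poly_lip01 p.
exists (L + K); first by rewrite addr_ge0.
move=> s t s01 t01; rewrite derivMXaddC hornerD hornerMX !hornerMXaddC.
have -> : p.[t] * t + c - (p.[s] * s + c) - (p.[s] + p^`().[s] * s) * (t - s) =
    (p.[t] - p.[s] - p^`().[s] * (t - s)) * s + (t - s) * (p.[t] - p.[s]).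
  by ring.
have /andP[s0 s1] := s01.
apply: le_trans (ler_normD _ _) _; rewrite [leRHS]mulrDl !normrM; apply: lerD.
  by rewrite -[leRHS]mulr1 ler_pM ?HL// ger0_norm.
rewrite -real_normK ?num_real// expr2 mulrCA ler_wpM2l//.
exact: HK.
Qed.

Lemma ker_bounded p : exists2 M, 0 <= M & forall s, `|ker p s| <= M.
Proof.
have [M M0 HM] := poly_bounded01 p; exists M => // s.
by apply: HM; exact: clamp01.
Qed.

Lemma ker_lip p : exists2 L, 0 <= L & forall s t, `|ker p s - ker p t| <= L * `|s - t|.
Proof.
have [L L0 HL] := poly_lip01 p; exists L => // s t.
rewrite (le_trans (HL _ _ (clamp01 _) (clamp01 _)))// ler_wpM2l//.
exact: clamp_lip.
Qed.

Lemma ker_continuous p : continuous (ker p).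
Proof.
have [L L0 HL] := ker_lip p; move=> s.
apply/cvgrPdist_le => e e0; near=> t.
apply: le_trans (HL s t) _.
have : `|s - t| <= e / (L + 1).
  near: t; apply: cvgr_dist_le => //; rewrite divr_gt0// ltr_wpDl//.
rewrite ler_pdivlMr ?ltr_wpDl// => /(le_trans _); apply.
by rewrite mulrC ler_wpM2l// lerDl.
Unshelve. all: by end_near. Qed.

Definition flat_ends p := p.[0] = 0 /\ p.[1] = 0.

Lemma ker_out p s : flat_ends p -> ~~ (0 < s < 1) -> ker p s = 0.
Proof.
move=> [p0 p1]; rewrite negb_and -!leNgt => /orP[/clamp_le0|/clamp_ge1] => h;
by rewrite /ker h.
Qed.

Lemma ker_in p s : 0 <= s <= 1 -> ker p s = p.[s].
Proof. by move=> /clamp_id h; rewrite /ker h. Qed.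

(* A point is clamped only when it leaves [0,1], and then it is within |h| of an
   endpoint, where the derivative of p vanishes. *)
Lemma ker_taylor p : flat_ends p^`() ->
  exists2 C, 0 <= C &
  forall s h, `|ker p (s + h) - ker p s - ker p^`() s * h| <= C * h ^+ 2.
Proof.
move=> [d0 d1]; have [L L0 HL] := poly_taylor01 p.
have [K K0 HK] := poly_lip01 p^`().
exists (L + K); first exact: addr_ge0.
move=> s h; rewrite /ker; set a := clamp s; set b := clamp (s + h).
have -> : p.[b] - p.[a] - p^`().[a] * h =
  (p.[b] - p.[a] - p^`().[a] * (b - a)) + p^`().[a] * (b - a - h) by ring.
have ab : `|b - a| <= `|h| by rewrite (le_trans (clamp_lip _ _))// addrC addKr.
apply: le_trans (ler_normD _ _) _; rewrite [leRHS]mulrDl; apply: lerD.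
  rewrite (le_trans (HL _ _ (clamp01 _) (clamp01 _)))// ler_wpM2l//.
  by rewrite -real_normK ?num_real// -[leRHS]real_normK ?num_real// lerXn2r.
rewrite normrM -real_normK ?num_real// expr2 mulrA.
have [s0|s0] := leP s 0.
  rewrite {1}/a (clamp_le0 s0) d0 normr0 mul0r !mulr_ge0//.
have [s1|s1] := leP 1 s.
  rewrite {1}/a (clamp_ge1 s1) d1 normr0 mul0r !mulr_ge0//.
have as_ : a = s by rewrite /a clamp_id// !ltW.
have [sh0|sh0] := leP (s + h) 0.
  have hn : `|h| = - h by rewrite ler0_norm//; lra.
  rewrite hn; apply: ler_pM => //.
    have := HK a 0 (clamp01 _); rewrite lexx ler01 d0 !subr0 => /(_ isT).
    move=> /le_trans; apply; apply: ler_wpM2l => //.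
    by rewrite as_ (ger0_norm (ltW s0)); lra.
  by rewrite /b (clamp_le0 sh0) as_ ler_norml; lra.
have [sh1|sh1] := leP 1 (s + h).
  have hn : `|h| = h by rewrite ger0_norm//; lra.
  rewrite hn; apply: ler_pM => //.
    have := HK a 1 (clamp01 _); rewrite lexx ler01 d1 !subr0 => /(_ isT).
    move=> /le_trans; apply; rewrite ler_wpM2l// as_ ler0_norm; last lra.
    by lra.
  by rewrite /b (clamp_ge1 sh1) as_ ler_norml; lra.
have e01 : 0 <= s + h <= 1 by rewrite !ltW.
rewrite /b (clamp_id e01) as_ (_ : s + h - s - h = 0); last by ring.
by rewrite normr0 mulr0; apply: mulr_ge0 => //; exact: mulr_ge0.
Qed.

Definition mono (c : R) (n : nat) : {poly R} := c *: 'X^n.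

Lemma mono_deriv c n : (mono c n.+1)^`() = mono (c * n.+1%:R) n.
Proof. by rewrite /mono derivZ derivXn/= -scaler_nat scalerA. Qed.

Lemma mono_deriv0 c : (mono c 0)^`() = 0.
Proof. by rewrite /mono derivZ derivXn mulr0n scaler0. Qed.

Lemma mono_at1 c n : (mono c n).[1] = c.
Proof. by rewrite /mono hornerZ hornerXn expr1n mulr1. Qed.

Lemma mono_at0 c n : (mono c n.+1).[0] = 0.
Proof. by rewrite /mono hornerZ hornerXn expr0n mulr0. Qed.

Lemma mono0_at0 c : (mono c 0).[0] = c.
Proof. by rewrite /mono hornerZ hornerXn expr0 mulr1. Qed.

(* s^2 (1 - s)^5 (1 + 5 s + 15 s^2) / 2, expanded: the last factor truncates the
   Taylor series of (1 - s)^-5, so that this is s^2 / 2 + O(s^5) at 0. *)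
Definition kP : {poly R} := mono (1/2) 2 + mono (- (35/2)) 5 + mono (105/2) 6 +
  mono (- 63) 7 + mono 35 8 + mono (- (15/2)) 9.
(** The part of k''' off the origin, with the sign it takes on the other side of the identity. Since
    k is s^2 / 2 + O(s^5) at 0 and has the factor (1 - s)^5, its third derivative vanishes to second
    order at both ends, which makes the kernel [ker kQ] of class C^1. *)
Definition kQ : {poly R} := - kP^`()^`()^`().

Lemma kQE s : kQ.[s] = - kP^`()^`()^`().[s].
Proof. by rewrite /kQ hornerN. Qed.

Lemma kP0 : kP.[0] = 0.
Proof. by rewrite /kP !(hornerD, mono_at0, mono0_at0); lra. Qed.
Lemma kP1 : kP.[1] = 0.
Proof. by rewrite /kP !(hornerD, mono_at1); lra. Qed.
Lemma dkP0 : kP^`().[0] = 0.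
Proof. by rewrite /kP !(derivN, derivD, mono_deriv) !(hornerD, mono_at0, mono0_at0); lra. Qed.
Lemma dkP1 : kP^`().[1] = 0.
Proof. by rewrite /kP !(derivN, derivD, mono_deriv) !(hornerD, mono_at1); lra. Qed.
(** The only nonzero boundary value: it is the jump of k'' at 0, that is, the Dirac mass of k'''
    that reproduces the test function. *)
Lemma ddkP0 : kP^`()^`().[0] = 1.
Proof. by rewrite /kP !(derivN, derivD, mono_deriv) !(hornerD, mono_at0, mono0_at0); lra. Qed.
Lemma ddkP1 : kP^`()^`().[1] = 0.
Proof. by rewrite /kP !(derivN, derivD, mono_deriv) !(hornerD, mono_at1); lra. Qed.
Lemma kQ0 : kQ.[0] = 0.
Proof. by rewrite /kQ /kP !(derivN, derivD, mono_deriv, mono_deriv0, deriv0) !(hornerN, hornerD, horner0, mono_at0, mono0_at0); lra. Qed.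
Lemma kQ1 : kQ.[1] = 0.
Proof. by rewrite /kQ /kP !(derivN, derivD, mono_deriv, mono_deriv0, deriv0) !(hornerN, hornerD, horner0, mono_at1); lra. Qed.
Lemma dkQ0 : kQ^`().[0] = 0.
Proof. by rewrite /kQ /kP !(derivN, derivD, mono_deriv, mono_deriv0, deriv0) !(hornerN, hornerD, horner0, mono_at0, mono0_at0); lra. Qed.
Lemma dkQ1 : kQ^`().[1] = 0.
Proof. by rewrite /kQ /kP !(derivN, derivD, mono_deriv, mono_deriv0, deriv0) !(hornerN, hornerD, horner0, mono_at1); lra. Qed.
End Kernel1D.

Opaque kP kQ.

(** * Convolution with a polynomial kernel on the line *)

Section Conv1D.
Context {R : realType}.
Notation leb := (@lebesgue_measure R).
Implicit Types (p q : {poly R}) (psi chi : R -> R).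

Definition conv p psi (x : R) : R := \int[leb]_(s in `[0, 1]) (p.[s] * psi (x - s)).

Lemma continuous_itv_intg (f : R -> R) (a b : R) : continuous f ->
  leb.-integrable `[a, b] (fun s => (f s)%:E).
Proof.
move=> cf; apply: continuous_compact_integrable; first exact: segment_compact.
exact: continuous_subspaceT.
Qed.

Lemma conv_integrand_continuous p psi x : continuous psi ->
  continuous (fun s => p.[s] * psi (x - s)).
Proof.
move=> cpsi s; apply: cvgM; first exact: continuous_horner.
apply: (@cvg_comp _ _ _ (fun s => x - s) psi _ _ _ _ (cpsi (x - s))).
by apply: cvgB; [exact: cvg_cst|exact: cvg_id].
Qed.

(** The derivative passes under the integral over [0, 1], dominated by a constant: p is bounded
    there and psi' everywhere. *)
Lemma conv_is_derive p psi x : test1 psi ->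
  is_derive x (1 : R) (conv p psi) (conv p (derive1 psi) x).
Proof.
move=> tpsi; have [spsi _] := tpsi.
have cpsi := smooth1_continuous spsi.
have cdpsi := smooth1_continuous (smooth1_derive spsi).
have [M M0 HM] := test1_bounded (test1_derive tpsi).
have [K K0 HK] := poly_bounded01 p.
have Ix : `](x - 1), (x + 1)[%classic x by rewrite /= in_itv/=; lra.
have intf z : `](x - 1), (x + 1)[%classic z ->
  leb.-integrable `[0, 1] (EFin \o (fun s => p.[s] * psi (z - s))).
  by move=> _; apply: continuous_itv_intg; exact: conv_integrand_continuous.
have der z s : is_derive z (1 : R) (fun z => p.[s] * psi (z - s))
    (p.[s] * derive1 psi (z - s)).
  have ds : derivable psi (z - s) 1 by exact: smooth1_derivable.
  have := @derive1_affine _ psi 1 (- s) z.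
  rewrite mul1r => /(_ ds) h.
  have h2 : is_derive z (1 : R) (fun z => psi (z - s)) (derive1 psi (z - s)).
    move: h; rewrite mul1r; congr (is_derive _ _ _ _).
    by apply/funext => w; rewrite mul1r.
  exact: (is_deriveZ p.[s] h2).
have dpart z s : partial1of2 (fun z s => p.[s] * psi (z - s)) z s =
    p.[s] * derive1 psi (z - s).
  by rewrite partial1of2E; have [] := der z s.
have Gub z s : `](x - 1), (x + 1)[%classic z -> `[0, 1]%classic s ->
    `|partial1of2 (fun z s => p.[s] * psi (z - s)) z s| <= (cst (K * M)) s.
  by move=> _ s01; rewrite dpart normrM ler_pM// HK.
have derf z s : `](x - 1), (x + 1)[%classic z -> `[0, 1]%classic s ->
    derivable (fun z => p.[s] * psi (z - s)) z 1.
  by move=> _ _; have [] := der z s.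
have intG : leb.-integrable `[0, 1] (EFin \o (cst (K * M))).
  by apply: continuous_itv_intg; exact: cst_continuous.
have KM0 (s : measurableTypeR R) : 0 <= cst (K * M) s by exact: mulr_ge0.
have d1 := @derivable_under_integral R _ _ leb
  (fun z s => p.[s] * psi (z - s)) `[0, 1]%classic (measurable_itv _) x _ _ Ix intf derf (cst (K * M)) KM0 intG Gub.
have d2 := @differentiation_under_integral R _ _ leb
  (fun z s => p.[s] * psi (z - s)) `[0, 1]%classic (measurable_itv _) x _ _ Ix intf derf (cst (K * M)) KM0 intG Gub.
apply: DeriveDef; first exact: d1.
rewrite -derive1E [LHS]d2.
by apply: eq_Rintegral => s _; exact: dpart.
Qed.

Lemma conv_out p psi N x : (forall z, N < `|z| -> psi z = 0) ->
  N + 1 < `|x| -> conv p psi x = 0.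
Proof.
move=> psiN xN; rewrite /conv (@eq_Rintegral _ _ _ _ _ (fun=> 0)).
  by rewrite /Rintegral integral0.
move=> s; rewrite inE/= in_itv/= => /andP[s0 s1].
rewrite psiN ?mulr0//; have := ler_normB x s; rewrite (ger0_norm s0).
have := ler_dist_dist x s; have := lerB_dist x s; rewrite (ger0_norm s0); lra.
Qed.

Lemma conv_test p psi : test1 psi -> test1 (conv p psi).
Proof.
move=> tpsi; split.
  apply: (@smooth1P _ (fun f => exists2 g, test1 g & f = conv p g)); last by exists psi.
  move=> _ [g tg ->].
  have [h1 h2] := derive1_eq (fun x => conv_is_derive p x tg).
  by split => //; exists (derive1 g) => //; exact: test1_derive.
have [_ [N HN]] := tpsi; exists (N + 1) => x; exact: conv_out.
Qed.

Lemma derive1_conv p psi : test1 psi -> derive1 (conv p psi) = conv p (derive1 psi).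
Proof.
by move=> tpsi; have [] := derive1_eq (fun x => conv_is_derive p x tpsi).
Qed.

Lemma derive1n_conv n p psi : test1 psi ->
  derive1n n (conv p psi) = conv p (derive1n n psi).
Proof.
move=> tpsi; elim: n => //= n IH.
by rewrite /derive1n/= -/(derive1n n _) IH derive1_conv//; exact: test1_derive1n.
Qed.

(* Three integrations by parts: the boundary terms vanish except p''(0) = 1. *)
Lemma conv_parametrix psi x : test1 psi ->
  psi x = derive1n 3 (conv kP psi) x + conv kQ psi x.
Proof.
move=> tpsi; rewrite derive1n_conv// /conv.
have t3 := test1_derive1n 3 tpsi.
have [spsi _] := tpsi; have [s3 _] := t3.
have i1 : leb.-integrable `[0, 1] (EFin \o (fun s => kP.[s] * derive1n 3 psi (x - s))).
  by apply: continuous_itv_intg; apply: conv_integrand_continuous; exact: smooth1_continuous.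
have i2 : leb.-integrable `[0, 1] (EFin \o (fun s => kQ.[s] * psi (x - s))).
  by apply: continuous_itv_intg; apply: conv_integrand_continuous; exact: smooth1_continuous.
rewrite -RintegralD//.
pose F s := - (kP.[s] * derive1n 2 psi (x - s) + kP^`().[s] * derive1n 1 psi (x - s) +
   kP^`()^`().[s] * psi (x - s)).
pose f s := kP.[s] * derive1n 3 psi (x - s) + kQ.[s] * psi (x - s).
have der g s : smooth1 g -> is_derive s (1 : R) (fun s => g (x - s)) (- derive1 g (x - s)).
  move=> sg; have ds : derivable g (x - s) 1 by exact: smooth1_derivable.
  have := @derive1_affine _ g (-1) x s.
  have -> : -1 * s + x = x - s by rewrite mulN1r addrC.
  move=> /(_ ds); rewrite mulN1r; congr (is_derive _ _ _ _).
  by apply/funext => w; rewrite mulN1r addrC.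
have dF s : is_derive s (1 : R) F (f s).
  have s2 := smooth1_derive1n 2 spsi; have s1 := smooth1_derive1n 1 spsi.
  have d3 : is_derive s (1 : R) (fun s => derive1n 2 psi (x - s))
    (- derive1n 3 psi (x - s)) := der _ s s2.
  have d2 : is_derive s (1 : R) (fun s => derive1n 1 psi (x - s))
    (- derive1n 2 psi (x - s)) := der _ s s1.
  have d1 : is_derive s (1 : R) (fun s => psi (x - s))
    (- derive1n 1 psi (x - s)) := der _ s spsi.
  have h2 := is_deriveM (is_derive_poly kP s) d3.
  have h1 := is_deriveM (is_derive_poly kP^`() s) d2.
  have h0 := is_deriveM (is_derive_poly kP^`()^`() s) d1.
  have := is_deriveN (is_deriveD (is_deriveD h2 h1) h0).
  move=> h; apply: (is_derive_eq h).
  rewrite /f kQE.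
  move: kP.[s] (kP^`().[s]) (kP^`()^`().[s]) (kP^`()^`()^`().[s]) => A B C D.
  move: (psi _) (derive1n 1 _ _) (derive1n 2 _ _) (derive1n 3 _ _) => p0 p1 p2 p3.
  by rewrite /GRing.scale /=; ring.
have cF : continuous F.
  move=> s; apply: differentiable_continuous; apply/derivable1_diffP.
  by have [] := dF s.
have cf : continuous f.
  move=> s; apply: cvgD.
    by apply: conv_integrand_continuous; exact: smooth1_continuous.
  by apply: conv_integrand_continuous; exact: smooth1_continuous.
have FTC := @continuous_FTC2 R f F 0 1 ltr01 (continuous_subspaceT cf).
rewrite /Rintegral FTC.
- rewrite -EFinB /F kP0 kP1 dkP0 dkP1 ddkP0 ddkP1 subr0 !mul0r mul1r !addr0.
  by rewrite !add0r oppr0 add0r opprK.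
- split.
  + by move=> s _; have [] := dF s.
  + exact/cvg_at_right_filter/cF.
  + exact/cvg_at_left_filter/cF.
- by move=> s _; rewrite derive1E; have [] := dF s.
Qed.

(** Substituting z = x - s gives an integral over [x - 1, x]. The vanishing of p at both ends makes
    [ker p] zero elsewhere, so the domain extends to the whole line. *)
Lemma conv_ker p psi x : flat_ends p -> test1 psi ->
  conv p psi x = \int[leb]_(z in setT) (ker p (x - z) * psi z).
Proof.
move=> fp [spsi _].
have cpsi := smooth1_continuous spsi.
pose G s := p.[s] * psi (x - s).
have cG : continuous G by exact: conv_integrand_continuous.
have dF z : is_derive z (1 : R) (fun z => x - z) (-1).
  rewrite -[X in is_derive _ _ _ X]add0r; apply: is_deriveD.
have F1 : (fun z : R => x - z)^`()%classic = cst (-1).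
  by have [] := derive1_eq dF.
have := @integration_by_substitution_decreasing R (fun z => x - z) G (x - 1) x.
rewrite subKr subrr => H.
transitivity (\int[leb]_(z in `[x - 1, x]) (ker p (x - z) * psi z)).
  rewrite /conv /Rintegral H.
  - congr fine; apply: eq_integral => z; rewrite inE/= in_itv/= => /andP[z0 z1].
    rewrite F1 /G /= !fctE/= opprK mulr1 subKr; congr (_ * _)%:E.
    by rewrite ker_in//; lra.
  - by lra.
  - by move=> y z _ _ yz; rewrite ltrD2l ltrN2.
  - by rewrite F1 => z _; exact: cvg_cst.
  - by rewrite F1; exact: is_cvg_cst.
  - by rewrite F1; exact: is_cvg_cst.
  - have cB : continuous (fun z : R => x - z).
      by move=> z; apply: cvgB; [exact: cvg_cst|exact: cvg_id].
    split.
    + by move=> z _; have [] := dF z.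
    + exact/cvg_at_right_filter/cB.
    + exact/cvg_at_left_filter/cB.
  - exact: continuous_subspaceT.
rewrite Rintegral_mkcond; apply: RI_eq => z; rewrite patchE.
case: ifPn => //; rewrite notin_setE/= in_itv/= => zx.
rewrite ker_out ?mul0r//; apply/negP => /andP[h1 h2]; apply: zx; lra.
Qed.
End Conv1D.

(** * Product kernels acting on locally integrable functions *)

Section PlanarKernel.
Context {R : realType}.
Notation leb := (@lebesgue_measure R).
Notation R2 := (measurableTypeR R * measurableTypeR R)%type.
Implicit Types (p q : {poly R}) (psi chi : R -> R) (h : R * R -> R) (z w : R * R).

(* The library derives sigma-finiteness of a product only for probabilities. *)
Definition planar : set R2 -> \bar R := @leb2 R.
HB.instance Definition _ := Measure.on planar.

Lemma planar_sigma_finite : sigma_finite setT planar.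
Proof.
exists (fun n => cbox (- n%:R) n%:R (- n%:R) n%:R); first by rewrite cbox_bigcup.
by move=> n; split; [exact: measurable_cbox|exact: cbox_fin].
Qed.

HB.instance Definition _ :=
  Measure_isSigmaFinite.Build _ _ _ planar planar_sigma_finite.

Definition leb2s : {sigma_finite_measure set R2 -> \bar R} := planar.

(** The arguments are w - z: [K] is the transpose of convolution by the two kernels, as obtained
    when a convolution is moved from the test function to [h]. This reflection causes the minus sign
    in the derivatives of [K]. *)
Definition kk p q z w : R := ker p (w.1 - z.1) * ker q (w.2 - z.2).

Definition K p q h z : R := \int[leb2]_(w in setT) (kk p q z w * h w).

Lemma kk_bounded p q : exists2 M, 0 <= M & forall z w, `|kk p q z w| <= M.
Proof.
have [M M0 HM] := ker_bounded p; have [N N0 HN] := ker_bounded q.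
by exists (M * N); [exact: mulr_ge0|move=> z w; rewrite normrM ler_pM].
Qed.

Lemma kk_out p q z w N : flat_ends p -> flat_ends q -> `|z.1| + 1 <= N ->
  `|z.2| + 1 <= N -> ~ cbox (-N) N (-N) N w -> kk p q z w = 0.
Proof.
move=> fp fq z1 z2 wN; rewrite /kk.
have [h1|h1] := boolP (0 < w.1 - z.1 < 1); last by rewrite ker_out// mul0r.
have [h2|h2] := boolP (0 < w.2 - z.2 < 1); last by rewrite mulrC ker_out// mul0r.
exfalso; apply: wN.
have := ler_norm z.1; have := ler_norm z.2; have := ler_norm (- z.1).
have := ler_norm (- z.2); rewrite !normrN.
by split; rewrite /= in_itv/=; lra.
Qed.

Lemma continuous_kk p q z : continuous (kk p q z).
Proof.
move=> w; apply: cvgM.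
- apply: (@cvg_comp _ _ _ (fun w => w.1 - z.1) (ker p) _ _ _ _ (@ker_continuous _ p _)).
  by apply: cvgB; [exact: cvg_fst|exact: cvg_cst].
- apply: (@cvg_comp _ _ _ (fun w => w.2 - z.2) (ker q) _ _ _ _ (@ker_continuous _ q _)).
  by apply: cvgB; [exact: cvg_snd|exact: cvg_cst].
Qed.

Lemma intg_kk p q h z : flat_ends p -> flat_ends q -> L1loc h ->
  intg leb2 (fun w => kk p q z w * h w).
Proof.
move=> fp fq hl.
have [M M0 HM] := kk_bounded p q.
have := @L1loc_mul R h (kk p q z) (Num.max (`|z.1| + 1) (`|z.2| + 1)) M hl _ (HM z) _.
move=> H; apply: (@eq_integrable _ _ _ _ _ _ _ _ _ (H _ _)) => //.
- by move=> w _; rewrite mulrC.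
- by apply: continuous_measurable2; exact: continuous_kk.
- by move=> w; apply: kk_out => //; rewrite le_max lexx ?orbT.
Qed.

Definition boxmass h N : R := \int[leb2]_(w in setT) (\1_(cbox (-N) N (-N) N) w * `|h w|).

Lemma boxmass_ge0 h N : 0 <= boxmass h N.
Proof. by apply: RI_ge0 => w; rewrite mulr_ge0// indicE. Qed.

Lemma boxmass_bound h (phi : R * R -> R) N C : L1loc h -> 0 <= C ->
  intg leb2 (fun w => phi w * h w) -> (forall w, `|phi w| <= C) ->
  (forall w, ~ cbox (-N) N (-N) N w -> phi w = 0) ->
  `|\int[leb2]_(w in setT) (phi w * h w)| <= C * boxmass h N.
Proof.
move=> hl C0 phii phiC phi0.
have [mh hN] := (L1locP h).1 hl.
have i1 : intg leb2 (fun w => \1_(cbox (-N) N (-N) N) w * `|h w|).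
  have := intg_norm (hN N); apply: eq_integrable => // w _.
  by rewrite normrM indicE; case: (_ \in _); rewrite ?normr1 ?normr0.
rewrite /boxmass -RIZ//; apply: RI_norm_le => //; first exact: intgZ.
move=> w; rewrite normrM indicE; case: (boolP (w \in _)) => [wN|].
  by rewrite mul1r ler_wpM2r.
by move/negP; rewrite inE => /phi0 ->; rewrite normr0 !mul0r mulr0.
Qed.

Lemma K_lipschitz p q h z0 : flat_ends p -> flat_ends q -> L1loc h ->
  exists2 C, 0 <= C & forall z, `|z - z0| <= 1 ->
    `|K p q h z - K p q h z0| <= C * `|z - z0|.
Proof.
move=> fp fq hl.
have [Mp Mp0 HMp] := ker_bounded p; have [Mq Mq0 HMq] := ker_bounded q.
have [Lp Lp0 HLp] := ker_lip p; have [Lq Lq0 HLq] := ker_lip q.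
(* The box holds the supports of the kernels for all z within distance 1 of z0: one unit for the
   displacement of z, one for the width of the kernel. *)
pose N := Num.max (`|z0.1| + 2) (`|z0.2| + 2).
exists ((Lp * Mq + Mp * Lq) * boxmass h N).
  by rewrite mulr_ge0 ?boxmass_ge0// addr_ge0// mulr_ge0.
move=> z zz0; rewrite /K -RIB; [|exact: intg_kk..].
have -> : (\int[leb2]_(w in setT) (kk p q z w * h w - kk p q z0 w * h w))%R =
   (\int[leb2]_(w in setT) ((kk p q z w - kk p q z0 w) * h w))%R.
  by apply: RI_eq => w; rewrite mulrBl.
rewrite mulrAC; apply: boxmass_bound => //.
- by rewrite mulr_ge0// addr_ge0// mulr_ge0.
- have := intgB (@intg_kk p q h z fp fq hl) (@intg_kk p q h z0 fp fq hl).
  by apply: eq_integrable => // w _; rewrite mulrBl.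
- have z1 : `|z.1 - z0.1| <= `|z - z0| by rewrite prod_normE le_max lexx.
  have z2 : `|z.2 - z0.2| <= `|z - z0| by rewrite prod_normE le_max lexx orbT.
  move=> w; rewrite /kk.
  have -> : ker p (w.1 - z.1) * ker q (w.2 - z.2) - ker p (w.1 - z0.1) * ker q (w.2 - z0.2) =
    (ker p (w.1 - z.1) - ker p (w.1 - z0.1)) * ker q (w.2 - z.2) +
    ker p (w.1 - z0.1) * (ker q (w.2 - z.2) - ker q (w.2 - z0.2)) by ring.
  apply: le_trans (ler_normD _ _) _; rewrite !normrM mulrDl; apply: lerD.
    rewrite mulrAC; apply: ler_pM => //; apply: le_trans (HLp _ _) _.
    by apply: ler_wpM2l => //; rewrite (_ : _ - _ = - (z.1 - z0.1)) ?normrN//; ring.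
  rewrite -mulrA; apply: ler_pM => //; apply: le_trans (HLq _ _) _.
  by apply: ler_wpM2l => //; rewrite (_ : _ - _ = - (z.2 - z0.2)) ?normrN//; ring.
- move=> w wN; rewrite !(@kk_out p q _ w N) ?subrr//.
  + by rewrite /N le_max lerD2l ler1n.
  + by rewrite /N le_max !lerD2l ler1n orbT.
  + have : `|z.1| <= `|z0.1| + 1.
      rewrite -(subrK z0.1 z.1) (le_trans (ler_normD _ _))// addrC lerD2l.
      by apply: le_trans zz0; rewrite prod_normE le_max lexx.
    by rewrite /N le_max; lra.
  + have : `|z.2| <= `|z0.2| + 1.
      rewrite -(subrK z0.2 z.2) (le_trans (ler_normD _ _))// addrC lerD2l.
      by apply: le_trans zz0; rewrite prod_normE le_max lexx orbT.
    by rewrite /N le_max; lra.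
Qed.

Lemma K_continuous p q h : flat_ends p -> flat_ends q -> L1loc h ->
  continuous (K p q h).
Proof.
move=> fp fq hl z0; have [C C0 HC] := K_lipschitz z0 fp fq hl.
apply/cvgrPdist_le => e e0; near=> z.
have z1 : `|z - z0| <= 1.
  by rewrite distrC; near: z; exact: cvgr_dist_le.
rewrite distrC; apply: le_trans (HC z z1) _.
have : `|z - z0| <= e / (C + 1).
  by rewrite distrC; near: z; apply: cvgr_dist_le => //; rewrite divr_gt0// ltr_wpDl.
rewrite ler_pdivlMr ?ltr_wpDl// => /(le_trans _); apply.
by rewrite mulrC ler_wpM2l// lerDl.
Unshelve. all: by end_near. Qed.

(** The Taylor estimate of [ker p] is uniform, so integrating it against [h] over a fixed box gives
    a remainder quadratic in the increment. All the regularity comes from the kernel. *)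
Lemma K_is_derive_x p q h z : flat_ends p -> flat_ends q -> flat_ends p^`() ->
  L1loc h -> is_derive z ((1, 0) : R * R) (K p q h) (- K p^`() q h z).
Proof.
move=> fp fq fdp hl.
have [C C0 HC] := ker_taylor fdp; have [Mq Mq0 HMq] := ker_bounded q.
pose N := Num.max (`|z.1| + 2) (`|z.2| + 2).
apply: (@quadratic_is_derive _ _ _ _ _ _ (C * Mq * boxmass h N)) => t t1.
set zt : R * R := t *: (1, 0) + z.
have zt1 : zt.1 = z.1 + t by rewrite /zt -[LHS]/(t * 1 + z.1) mulr1 addrC.
have zt2 : zt.2 = z.2 by rewrite /zt -[LHS]/(t * 0 + z.2) mulr0 add0r.
rewrite /K mulrN opprK -RIB; [|exact: intg_kk..].
rewrite -RIZ; last exact: intg_kk.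
rewrite -RID; [|by apply: intgB; exact: intg_kk|by apply: intgZ; exact: intg_kk].
rewrite mulrAC.
have -> : (\int[leb2]_(w in setT) (kk p q zt w * h w - kk p q z w * h w +
    t * (kk p^`() q z w * h w)))%R =
   (\int[leb2]_(w in setT) ((kk p q zt w - kk p q z w + t * kk p^`() q z w) * h w))%R.
  by apply: RI_eq => w; rewrite !mulrDl mulNr mulrA.
apply: boxmass_bound => //.
- by apply: mulr_ge0; [exact: mulr_ge0|exact: sqr_ge0].
- have := intgD (intgB (@intg_kk p q h zt fp fq hl) (@intg_kk p q h z fp fq hl))
    (intgZ t (@intg_kk p^`() q h z fdp fq hl)).
  by apply: eq_integrable => // w _; rewrite !mulrDl mulNr mulrA.
- move=> w; rewrite /kk zt1 zt2.
  have -> : ker p (w.1 - (z.1 + t)) * ker q (w.2 - z.2) -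
      ker p (w.1 - z.1) * ker q (w.2 - z.2) +
      t * (ker p^`() (w.1 - z.1) * ker q (w.2 - z.2)) =
      (ker p (w.1 - z.1 + - t) - ker p (w.1 - z.1) - ker p^`() (w.1 - z.1) * - t) *
      ker q (w.2 - z.2) by rewrite opprD addrA; ring.
  rewrite normrM mulrAC; apply: ler_pM => //.
  by have := HC (w.1 - z.1) (- t); rewrite sqrrN.
- move=> w wN.
  have e1 : `|z.1| + 1 <= N by rewrite /N le_max lerD2l ler1n.
  have e2 : `|z.2| + 1 <= N by rewrite /N le_max !lerD2l ler1n orbT.
  have e3 : `|zt.1| + 1 <= N.
    rewrite zt1; have : `|z.1 + t| <= `|z.1| + 1 by rewrite (le_trans (ler_normD _ _))// lerD2l.
    by rewrite /N le_max; lra.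
  by rewrite !(@kk_out _ q _ w N) ?zt2 ?mulr0 ?addr0 ?subrr.
Qed.

Lemma K_is_derive_y p q h z : flat_ends p -> flat_ends q -> flat_ends q^`() ->
  L1loc h -> is_derive z ((0, 1) : R * R) (K p q h) (- K p q^`() h z).
Proof.
move=> fp fq fdq hl.
have [C C0 HC] := ker_taylor fdq; have [Mp Mp0 HMp] := ker_bounded p.
pose N := Num.max (`|z.1| + 2) (`|z.2| + 2).
apply: (@quadratic_is_derive _ _ _ _ _ _ (C * Mp * boxmass h N)) => t t1.
set zt : R * R := t *: (0, 1) + z.
have zt1 : zt.1 = z.1 by rewrite /zt -[LHS]/(t * 0 + z.1) mulr0 add0r.
have zt2 : zt.2 = z.2 + t by rewrite /zt -[LHS]/(t * 1 + z.2) mulr1 addrC.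
rewrite /K mulrN opprK -RIB; [|exact: intg_kk..].
rewrite -RIZ; last exact: intg_kk.
rewrite -RID; [|by apply: intgB; exact: intg_kk|by apply: intgZ; exact: intg_kk].
rewrite mulrAC.
have -> : (\int[leb2]_(w in setT) (kk p q zt w * h w - kk p q z w * h w +
    t * (kk p q^`() z w * h w)))%R =
   (\int[leb2]_(w in setT) ((kk p q zt w - kk p q z w + t * kk p q^`() z w) * h w))%R.
  by apply: RI_eq => w; rewrite !mulrDl mulNr mulrA.
apply: boxmass_bound => //.
- by apply: mulr_ge0; [exact: mulr_ge0|exact: sqr_ge0].
- have := intgD (intgB (@intg_kk p q h zt fp fq hl) (@intg_kk p q h z fp fq hl))
    (intgZ t (@intg_kk p q^`() h z fp fdq hl)).
  by apply: eq_integrable => // w _; rewrite !mulrDl mulNr mulrA.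
- move=> w; rewrite /kk zt1 zt2.
  have -> : ker p (w.1 - z.1) * ker q (w.2 - (z.2 + t)) -
      ker p (w.1 - z.1) * ker q (w.2 - z.2) +
      t * (ker p (w.1 - z.1) * ker q^`() (w.2 - z.2)) =
      (ker q (w.2 - z.2 + - t) - ker q (w.2 - z.2) - ker q^`() (w.2 - z.2) * - t) *
      ker p (w.1 - z.1) by rewrite opprD addrA; ring.
  rewrite normrM mulrAC; apply: ler_pM => //.
  by have := HC (w.2 - z.2) (- t); rewrite sqrrN.
- move=> w wN.
  have e1 : `|z.1| + 1 <= N by rewrite /N le_max lerD2l ler1n.
  have e2 : `|z.2| + 1 <= N by rewrite /N le_max !lerD2l ler1n orbT.
  have e3 : `|zt.2| + 1 <= N.
    rewrite zt2; have : `|z.2 + t| <= `|z.2| + 1 by rewrite (le_trans (ler_normD _ _))// lerD2l.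
    by rewrite /N le_max => ?; apply/orP; right; lra.
  by rewrite !(@kk_out p _ _ w N) ?zt1 ?mulr0 ?addr0 ?subrr.
Qed.

Lemma intg_tensor2 (u v : R * R -> R) : intg leb2 u -> intg leb2 v ->
  intg (leb2s \x leb2s)%E (fun a => u a.1 * v a.2).
Proof.
move=> ui vi.
have mu_ : measurable_fun setT (fun a : R2 * R2 => u a.1).
  by apply: (measurableT_comp (intg_meas ui)); exact: measurable_fst.
have mv_ : measurable_fun setT (fun a : R2 * R2 => v a.2).
  by apply: (measurableT_comp (intg_meas vi)); exact: measurable_snd.
apply/integrable12ltyP.
  by apply/measurable_EFinP; exact: measurable_funM.
have /integrableP[mu1 ui1] := ui.
have /integrableP[mv1 vi1] := vi.
pose V := (\int[leb2]_y `|(v y)%:E|)%E.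
have V0 : (0 <= V)%E by apply: integral_ge0.
have Vfin : V \is a fin_num by rewrite ge0_fin_numE.
have -> : (\int[leb2s]_x \int[leb2s]_y `|(u (x, y).1 * v (x, y).2)%:E|)%E =
    (\int[leb2]_x (`|(u x)%:E| * V))%E.
  apply: eq_integral => x _ /=.
  rewrite -ge0_integralZl//; last exact: measurableT_comp.
  by apply: eq_integral => y _; rewrite /= normrM EFinM.
rewrite ge0_integralZr//; last exact: measurableT_comp.
have U0 : (0 <= \int[leb2]_x `|(u x)%:E|)%E by apply: integral_ge0.
have Ufin : (\int[leb2]_x `|(u x)%:E|)%E \is a fin_num by rewrite ge0_fin_numE.
exact: lte_mul_pinfty.
Qed.

Lemma intg_mul_test1 (k : R -> R) psi (M : R) : continuous k ->
  (forall x, `|k x| <= M) -> test1 psi -> intg leb (fun x => k x * psi x).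
Proof.
move=> ck kM tpsi; have [spsi [N psiN]] := tpsi.
have [L L0 HL] := test1_bounded tpsi.
have i1 : intg leb (fun x => (M * L) * \1_(`[- N, N]%classic) x).
  by apply: intgZ; have := @integrable_indic_itv R (- N) N true false.
apply: (intg_le _ _ i1).
  apply: measurable_funM; first exact: continuous_measurable_fun.
  by apply: continuous_measurable_fun; exact: smooth1_continuous.
move=> x; rewrite normrM indicE; case: (boolP (x \in _)) => [_|].
  by rewrite mulr1 ler_pM.
move/negP; rewrite inE/= in_itv/= -ler_norml => /negP; rewrite -ltNge => /psiN ->.
by rewrite normr0 !mulr0.
Qed.

Lemma kk_conv p q psi chi w : flat_ends p -> flat_ends q -> test1 psi -> test1 chi ->
  \int[leb2]_(z in setT) (kk p q z w * tensor psi chi z) =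
  conv p psi w.1 * conv q chi w.2.
Proof.
move=> fp fq tpsi tchi.
have cB (k : R -> R) (c : R) : continuous k -> continuous (fun x => k (c - x)).
  move=> ck x; apply: (@cvg_comp _ _ _ (fun x => c - x) k _ _ _ _ (ck _)).
  by apply: cvgB; [exact: cvg_cst|exact: cvg_id].
have i2 : intg leb2 (fun z => kk p q z w * tensor psi chi z).
  apply: L1loc_mul_tensor => //; apply: continuous_L1loc.
  exact: (@continuous_tensor _ (fun x => ker p (w.1 - x)) (fun y => ker q (w.2 - y))
    (cB _ _ (@ker_continuous _ p)) (cB _ _ (@ker_continuous _ q))).
have [Mp Mp0 HMp] := ker_bounded p; have [Mq Mq0 HMq] := ker_bounded q.
have ip := intg_mul_test1 (cB _ w.1 (@ker_continuous _ p)) (fun x => HMp (w.1 - x)) tpsi.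
have iq := intg_mul_test1 (cB _ w.2 (@ker_continuous _ q)) (fun x => HMq (w.2 - x)) tchi.
rewrite planar_fubini// !conv_ker//.
transitivity (\int[leb]_(x in setT) ((\int[leb]_(z in setT) (ker q (w.2 - z) * chi z)) *
     (ker p (w.1 - x) * psi x))).
  apply: RI_eq => x; rewrite mulrC -RIZ//.
  by apply: RI_eq => y; rewrite /kk /tensor/=; ring.
by rewrite RIZ// mulrC.
Qed.

(** Fubini on the product of the plane with itself: integrating h(w) kk(z, w) psi(z1) chi(z2) first
    in z produces the convolutions, first in w it produces [K]. *)
Lemma K_pairing p q h psi chi : flat_ends p -> flat_ends q -> L1loc h ->
  test1 psi -> test1 chi ->
  \int[leb2]_(w in setT) (h w * tensor (conv p psi) (conv q chi) w) =
  \int[leb2]_(z in setT) (K p q h z * tensor psi chi z).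
Proof.
move=> fp fq hl tpsi tchi.
have [mh hN] := (L1locP h).1 hl.
have [N N0 HN] := test1_tensor_box tpsi tchi.
have [M M0 HM] := kk_bounded p q.
pose G (a : R2 * R2) := h a.1 * (kk p q a.2 a.1 * tensor psi chi a.2).
have ct : continuous (tensor psi chi).
  by apply: continuous_tensor; apply: smooth1_continuous; [case: tpsi|case: tchi].
have it : intg leb2 (tensor psi chi).
  have c1 : continuous (fun _ : R * R => 1 : R) by move=> z; exact: cvg_cst.
  have := L1loc_mul_tensor (continuous_L1loc c1) tpsi tchi.
  by apply: eq_integrable => // z _; rewrite mul1r.
have mf1 : measurable_fun (setT : set (R2 * R2)) (fun a => a.1.1 : R).
  by apply: (measurableT_comp measurable_fst); exact: measurable_fst.
have mf2 : measurable_fun (setT : set (R2 * R2)) (fun a => a.1.2 : R).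
  by apply: (measurableT_comp measurable_snd); exact: measurable_fst.
have mg1 : measurable_fun (setT : set (R2 * R2)) (fun a => a.2.1 : R).
  by apply: (measurableT_comp measurable_fst); exact: measurable_snd.
have mg2 : measurable_fun (setT : set (R2 * R2)) (fun a => a.2.2 : R).
  by apply: (measurableT_comp measurable_snd); exact: measurable_snd.
have mker r : measurable_fun (setT : set (measurableTypeR R)) (ker r).
  by apply: continuous_measurable_fun; exact: ker_continuous.
have iG : intg (leb2s \x leb2s)%E G.
  (* For z in the box of half-width N the kernel, of width 1, confines w to the box of half-width N
     + 1; there [h] is integrable. *)
  have ib := intg_tensor2 (intg_norm (hN (N + 1))) (intg_norm it).
  apply: (intg_le _ _ (intgZ M ib)).
    apply: measurable_funM.
      by apply: (measurableT_comp mh); exact: measurable_fst.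
    apply: measurable_funM.
      apply: measurable_funM.
        by apply: (measurableT_comp (mker p)); exact: measurable_funB.
      by apply: (measurableT_comp (mker q)); exact: measurable_funB.
    apply: (measurableT_comp (continuous_measurable2 ct)); exact: measurable_snd.
  move=> [w z]; rewrite /G/=.
  have [zN|zN] := pselect (cbox (- N) N (- N) N z); last first.
    by rewrite (HN _ zN) !mulr0 normr0 !mulr0.
  have [wN|wN] := pselect (cbox (- (N + 1)) (N + 1) (- (N + 1)) (N + 1) w).
    rewrite indicE mem_set// mul1r normrM [`|kk _ _ _ _ * _|]normrM mulrCA.
    by apply: ler_wpM2r; [exact: mulr_ge0|exact: HM].
  rewrite (@kk_out p q z w (N + 1))// ?mul0r ?mulr0 ?normr0 ?mulr_ge0//.
    by move: zN => [/=]; rewrite !in_itv/= -ler_norml lerD2r.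
  by move: zN => [/=]; rewrite !in_itv/= -!ler_norml lerD2r.
have := RI_fubini2 iG; rewrite (RI_fubini iG) => E.
transitivity (\int[leb2s]_(x in setT) \int[leb2s]_(y in setT) G (x, y))%R.
  apply: RI_eq => w; rewrite /tensor -kk_conv// -RIZ//.
  apply: L1loc_mul_tensor => //; apply: continuous_L1loc.
  have cB (k : R -> R) (c : R) : continuous k -> continuous (fun x => k (c - x)).
    move=> ck x; apply: (@cvg_comp _ _ _ (fun x => c - x) k _ _ _ _ (ck _)).
    by apply: cvgB; [exact: cvg_cst|exact: cvg_id].
  exact: (@continuous_tensor _ (fun x => ker p (w.1 - x)) (fun y => ker q (w.2 - y))
    (cB _ _ (@ker_continuous _ p)) (cB _ _ (@ker_continuous _ q))).
rewrite E; apply: RI_eq => z; rewrite mulrC /K -RIZ; last exact: intg_kk.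
by apply: RI_eq => w; rewrite /G/=; ring.
Qed.

Lemma leb2_unit_square a b : \int[leb2]_(w in setT) (\1_(cbox a (a + 1) b (b + 1)) w) = 1 :> R.
Proof.
rewrite /Rintegral integral_indic//; last exact: measurable_cbox.
rewrite setIT leb2E /cbox product_measure1E; [|exact: measurable_itv..].
have H (c : R) : lebesgue_measure `[c, c + 1]%classic = 1%:E.
  rewrite lebesgue_measure_itv/= lte_fin ltrDl ltr01 -EFinD.
  by rewrite addrAC subrr add0r.
by rewrite [X in (X * _)%E](H a) [X in (_ * X)%E](H b) mule1.
Qed.

(** The kernel lives on the unit square with corner z, where |h| <= (d + h^2 / d) / 2. Over this
    square of area 1 each half contributes at most d / 2. The constant depends on the kernels alone,
    not on [h] or z. *)
Lemma K_sup_bound p q : flat_ends p -> flat_ends q -> exists2 M, 0 <= M &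
  forall h (d : R) z, measurable_fun setT h -> intg leb2 (fun w => h w ^+ 2) ->
    0 < d -> \int[leb2]_(w in setT) (h w ^+ 2) <= d ^+ 2 -> L1loc h ->
    `|K p q h z| <= M * d.
Proof.
move=> fp fq; have [M M0 HM] := kk_bounded p q.
exists M => // h d z mh ih d0 hd hl.
pose B := cbox z.1 (z.1 + 1) z.2 (z.2 + 1).
have iB : intg leb2 (fun w => \1_B w).
  apply/integrableP; split.
    by apply/measurable_EFinP; apply: measurable_indic; exact: measurable_cbox.
  under eq_integral do rewrite gee0_abs//.
  rewrite integral_indic// ?setIT//; last exact: measurable_cbox.
  exact: cbox_fin.
pose g w := M * (2^-1 * (d * \1_B w + d^-1 * h w ^+ 2)).
have ig : intg leb2 g by apply: intgZ; apply: intgZ; apply: intgD; exact: intgZ.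
have E : \int[leb2]_(w in setT) g w <= M * d.
  rewrite /g RIZ; last by apply: intgZ; apply: intgD; exact: intgZ.
  rewrite ler_wpM2l// RIZ; last by apply: intgD; exact: intgZ.
  rewrite RID; [|exact: intgZ..].
  rewrite !RIZ// leb2_unit_square mulr1 ler_pdivrMl// mulr2n mulrDl !mul1r lerD2l.
  by rewrite ler_pdivrMl// -expr2.
apply: le_trans E; apply: RI_norm_le => //; first exact: intg_kk.
move=> w; rewrite /g normrM.
(* AM-GM: 2 |h| <= d + h^2 / d *)
have amgm : `|h w| <= 2^-1 * (d + d^-1 * h w ^+ 2).
  have dn0 : d != 0 by rewrite gt_eqF.
  rewrite -subr_ge0 -real_normK ?num_real//.
  have -> : 2^-1 * (d + d^-1 * `|h w| ^+ 2) - `|h w| = 2^-1 * d^-1 * (d - `|h w|) ^+ 2.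
    by field.
  have d0' := ltW d0.
  by apply: mulr_ge0; [apply: mulr_ge0; rewrite invr_ge0|exact: sqr_ge0].
rewrite indicE; case: (boolP (w \in B)) => wB.
  by rewrite mulr1 ler_pM.
have pos : 0 <= M * (2^-1 * (d * 0 + d^-1 * h w ^+ 2)).
  rewrite mulr0 add0r; apply: mulr_ge0 => //; apply: mulr_ge0; first by rewrite invr_ge0.
  by apply: mulr_ge0; [rewrite invr_ge0 ltW|exact: sqr_ge0].
rewrite /kk.
have [h1|h1] := boolP (0 < w.1 - z.1 < 1); last first.
  by rewrite (ker_out fp h1) mul0r normr0 mul0r.
have [h2|h2] := boolP (0 < w.2 - z.2 < 1); last first.
  by rewrite (ker_out fq h2) mulr0 normr0 mul0r.
exfalso; move/negP: wB; apply; rewrite inE; split; rewrite /= in_itv/=; lra.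
Qed.
End PlanarKernel.

(** * Integration by parts *)

Section PlanarParts.
Context {R : realType}.
Notation leb := (@lebesgue_measure R).
Notation R2 := (measurableTypeR R * measurableTypeR R)%type.
Implicit Types (f g F dF W dW phi : R * R -> R).

Lemma compact_integral_derive0 (w dw : R -> R) N :
  (forall x, is_derive x (1 : R) w (dw x)) -> continuous dw ->
  (forall x, N < `|x| -> w x = 0) -> (forall x, N < `|x| -> dw x = 0) ->
  \int[leb]_(x in setT) dw x = 0.
Proof.
move=> wdw cdw w0 dw0.
pose M := `|N| + 1.
have NM : N < M by rewrite /M (le_lt_trans (ler_norm N))// ltrDl.
have M0 : 0 < M by rewrite ltr_wpDl.
have cw : continuous w.
  move=> x; apply: differentiable_continuous; apply/derivable1_diffP.
  by have [] := wdw x.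
have MM : - M < M by rewrite gtrN.
have FTC := @continuous_FTC2 R dw w (- M) M MM (continuous_subspaceT cdw).
transitivity (\int[leb]_(x in `[- M, M]) dw x).
  rewrite [RHS]Rintegral_mkcond; apply: RI_eq => x; rewrite patchE.
  case: ifPn => //; rewrite notin_setE/= in_itv/= -ler_norml => /negP.
  by rewrite -ltNge => Mx; apply: dw0; exact: lt_trans Mx.
rewrite /Rintegral FTC.
- have wM : w M = 0 by apply: w0; rewrite gtr0_norm.
  have wNM : w (- M) = 0 by apply: w0; rewrite normrN gtr0_norm.
  by rewrite wM wNM subee.
- split.
  + by move=> x _; have [] := wdw x.
  + exact/cvg_at_right_filter/cw.
  + exact/cvg_at_left_filter/cw.
- by move=> x _; rewrite derive1E; have [] := wdw x.
Qed.

(** Joint continuity is part of the notion, so that the restrictions to lines are continuous and the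
    fundamental theorem of calculus applies on each of them. *)
Definition hasdx F dF := [/\ continuous F, continuous dF &
  forall p, is_derive p ((1, 0) : R * R) F (dF p)].
Definition hasdy F dF := [/\ continuous F, continuous dF &
  forall p, is_derive p ((0, 1) : R * R) F (dF p)].

Lemma continuous_line1 F y : continuous F -> continuous (fun x : R => F (x, y)).
Proof.
move=> cF x; apply: (@cvg_comp _ _ _ (fun x => (x, y)) F _ _ _ _ (cF (x, y))).
exact: (cvg_pair cvg_id (cvg_cst y)).
Qed.

Lemma continuous_comp1 (k : R -> R) : continuous k -> continuous (fun p : R * R => k p.1).
Proof.
by move=> ck p; apply: (@cvg_comp _ _ _ fst k); [exact: cvg_fst|exact: ck].
Qed.

(** A dilated bump without plateau: it tends to its value exp (-2) at the origin instead of 1. This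
    suffices because the value is nonzero and can be divided out. *)
Definition cutoff (n : nat) (x : R) := bump (- 1) 1 0 (n.+1%:R^-1 * x).
Definition dcutoff (n : nat) (x : R) :=
  n.+1%:R^-1 * derive1 (bump (- 1) 1 0) (n.+1%:R^-1 * x).

Lemma cutoff_is_derive n x : is_derive x (1 : R) (cutoff n) (dcutoff n x).
Proof.
have [sb _] := bump_test (- 1) 1 0 : test1 (bump (- 1 : R) 1 0).
have ds : derivable (bump (- 1 : R) 1 0) (n.+1%:R^-1 * x + 0) 1 by exact: smooth1_derivable.
have := derive1_affine ds; rewrite addr0.
congr (is_derive _ _ _ _); apply/funext => y; by rewrite addr0.
Qed.

Lemma cutoff_continuous n : continuous (cutoff n).
Proof.
move=> x; apply: differentiable_continuous; apply/derivable1_diffP.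
by have [] := cutoff_is_derive n x.
Qed.

Lemma mul_continuous (c : R) : continuous (fun x : R => c * x).
Proof. by move=> x; apply: cvgMr; exact: cvg_id. Qed.

Lemma dcutoff_continuous n : continuous (dcutoff n).
Proof.
have [sb _] := bump_test (- 1) 1 0 : test1 (bump (- 1 : R) 1 0).
have cb := smooth1_continuous (smooth1_derive sb).
move=> x; apply: cvgMr.
exact: (@cvg_comp _ _ _ (fun x => n.+1%:R^-1 * x) _ _ _ _ (@mul_continuous _ x) (cb _)).
Qed.

Lemma cutoff_bounded n x : `|cutoff n x| <= 1.
Proof. by rewrite ger0_norm ?bump_ge0 ?bump_le1. Qed.

Lemma dcutoff_bounded : exists2 C : R, 0 <= C & forall n x, `|dcutoff n x| <= C / n.+1%:R.
Proof.
have [C C0 HC] := test1_bounded (test1_derive (bump_test (- 1 : R) 1 0)).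
by exists C => // n x; rewrite normrM mulrC normfV ler_pM// ger0_norm.
Qed.

Lemma cutoff_out n x : n.+1%:R < `|x| -> cutoff n x = 0.
Proof.
move=> nx; apply: bump_out; apply/negP => /andP[h1 h2].
have : `|n.+1%:R^-1 * x| < 1 by rewrite ltr_norml h1 h2.
by rewrite normrM ger0_norm// ltr_pdivrMl// mulr1 ltNge ltW.
Qed.

Lemma dcutoff_out n x : n.+1%:R < `|x| -> dcutoff n x = 0.
Proof.
move=> nx; have [_ <-] := cutoff_is_derive n x.
have h0 : is_derive x (1 : R) (fun=> 0 : R) 0 by exact: is_derive_cst.
have : is_derive x (1 : R) (cutoff n) 0; last by case.
apply: near_is_derive h0.
near=> z; rewrite [RHS]cutoff_out//; near: z.
exact: (@cvgr_norm_gt _ _ _ _ _ id x cvg_id).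
Unshelve. all: by end_near. Qed.

Lemma cutoff_cvg x : cutoff n x @[n --> \oo] --> bump (- 1) 1 0 0.
Proof.
have [sb _] := bump_test (- 1) 1 0 : test1 (bump (- 1 : R) 1 0).
have cb := smooth1_continuous sb.
have h : n.+1%:R^-1 * x @[n --> \oo] --> (0 : R).
  rewrite -[X in _ --> X](mul0r x); apply: cvgMl; exact: cvg_harmonic.
exact: (@cvg_comp _ _ _ (fun n => n.+1%:R^-1 * x) _ _ _ _ h (cb 0)).
Qed.

Lemma bump00_neq0 : bump (- 1) 1 0 0 != 0 :> R.
Proof.
by rewrite /bump !flatE !opprK !mul1r add0r subr0 ltr01 mulf_neq0// gt_eqF// expR_gt0.
Qed.

(* The cutoff is in one variable only: each line integral vanishes by the
   fundamental theorem of calculus, and the cutoff is then removed by dominated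
   convergence. *)
Lemma integral_dx0 W dW : hasdx W dW -> intg leb2 W -> intg leb2 dW ->
  \int[leb2]_(p in setT) dW p = 0.
Proof.
move=> [cW cdW WdW] iW idW.
have [C C0 HC] := dcutoff_bounded.
have mc n : measurable_fun setT (fun p : R2 => cutoff n p.1).
  apply: continuous_measurable2; apply: continuous_comp1; exact: cutoff_continuous.
have mdc n : measurable_fun setT (fun p : R2 => dcutoff n p.1).
  apply: continuous_measurable2; apply: continuous_comp1; exact: dcutoff_continuous.
have i1 n : intg leb2 (fun p => cutoff n p.1 * dW p).
  by apply: (intgMb (M := 1) idW (mc n)) => p; exact: cutoff_bounded.
have i2 n : intg leb2 (fun p => dcutoff n p.1 * W p).
  by apply: (intgMb iW (mdc n)) => p; exact: HC.
have E n : \int[leb2]_(p in setT) (cutoff n p.1 * dW p) =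
    - \int[leb2]_(p in setT) (dcutoff n p.1 * W p).
  apply/eqP; rewrite -subr_eq0 opprK -RID//; apply/eqP.
  rewrite planar_fubini2; last exact: intgD.
  rewrite -[RHS](RI0 leb); apply: RI_eq => y /=.
  apply: (@compact_integral_derive0 (fun x => cutoff n x * W (x, y)) _ n.+1%:R).
  - move=> x; have /is_derive_x h := WdW (x, y).
    apply: (is_derive_eq (is_deriveM (cutoff_is_derive n x) h)).
    by rewrite /GRing.scale/=; ring.
  - move=> x; apply: cvgD; apply: cvgM.
    + exact: cutoff_continuous.
    + exact: continuous_line1.
    + exact: dcutoff_continuous.
    + exact: continuous_line1.
  - by move=> x /cutoff_out ->; rewrite mul0r.
  - by move=> x nx; rewrite (cutoff_out nx) (dcutoff_out nx) !mul0r addr0.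
have l1 : \int[leb2]_(p in setT) (cutoff n p.1 * dW p) @[n --> \oo] -->
    \int[leb2]_(p in setT) (bump (- 1) 1 0 0 * dW p).
  apply: (@RI_dct _ _ _ leb2 (fun n p => cutoff n p.1 * dW p) _ (fun p => `|dW p|)).
  - by move=> n; exact: intg_meas (i1 n).
  - exact: intg_meas (intgZ (bump (- 1) 1 0 0) idW).
  - by move=> p; apply: cvgMl; exact: cutoff_cvg.
  - by move=> n p; rewrite normrM ler_piMl// cutoff_bounded.
  - exact: intg_norm.
have l2 : \int[leb2]_(p in setT) (cutoff n p.1 * dW p) @[n --> \oo] --> (0 : R).
  apply/cvgr0Pnorm_le => e e0.
  pose I := \int[leb2]_(p in setT) `|W p|.
  have I0 : 0 <= I by exact: RI_ge0.
  near=> n; rewrite E normrN.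
  apply: (@le_trans _ _ (C / n.+1%:R * I)).
    rewrite /I -RIZ; last exact: intg_norm.
    apply: RI_norm_le => //; first exact/intgZ/intg_norm.
    by move=> p; rewrite normrM ler_wpM2r.
  have : C * I / e <= n.+1%:R.
    near: n; exists (Num.truncn (C * I / e)) => // n /= hn.
    by rewrite (le_trans (ltW (truncnS_gt _)))// ler_nat.
  by rewrite ler_pdivrMr// => h; rewrite mulrAC ler_pdivrMr// [leRHS]mulrC.
move: l1; rewrite RIZ// => l1.
have /eqP : bump (- 1) 1 0 0 * \int[leb2]_(p in setT) dW p = 0.
  by apply: (@cvg_unique _ (@norm_hausdorff _ _)) l1 l2.
by rewrite mulf_eq0 (negbTE bump00_neq0)/= => /eqP.
Unshelve. all: by end_near. Qed.

Lemma hasdx_mul F dF f g : hasdx F dF -> hasdx f g ->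
  hasdx (fun p => F p * f p) (fun p => F p * g p + dF p * f p).
Proof.
move=> [cF cdF Fd] [cf cg fd]; split.
- by move=> p; apply: cvgM; [exact: cF|exact: cf].
- move=> p; apply: cvgD; apply: cvgM.
  + exact: cF.
  + exact: cg.
  + exact: cdF.
  + exact: cf.
- move=> p; apply: (is_derive_eq (is_deriveM (Fd p) (fd p))).
  by rewrite /GRing.scale/=; ring.
Qed.

Lemma continuous_intg_out f N : continuous f ->
  (forall p, ~ cbox (-N) N (-N) N p -> f p = 0) -> intg leb2 f.
Proof.
move=> cf f0; have [_ /(_ N)] := (L1locP f).1 (continuous_L1loc cf).
apply: eq_integrable => // p _; rewrite indicE.
by case: (boolP (p \in _)) => [_|/negP]; rewrite ?mul1r// inE => /f0 ->; rewrite mulr0.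
Qed.

Lemma parts_x F dF phi dphi N : hasdx F dF -> hasdx phi dphi ->
  (forall p, ~ cbox (-N) N (-N) N p -> phi p = 0) ->
  (forall p, ~ cbox (-N) N (-N) N p -> dphi p = 0) ->
  \int[leb2]_(p in setT) (F p * dphi p) = - \int[leb2]_(p in setT) (dF p * phi p).
Proof.
move=> HF Hphi phi0 dphi0.
have HW := hasdx_mul HF Hphi; have [cW cdW _] := HW.
have [cF cdF _] := HF; have [cphi cdphi _] := Hphi.
have i1 : intg leb2 (fun p => F p * dphi p).
  apply: (@continuous_intg_out _ N); last by move=> p /dphi0 ->; rewrite mulr0.
  by move=> p; apply: cvgM; [exact: cF|exact: cdphi].
have i2 : intg leb2 (fun p => dF p * phi p).
  apply: (@continuous_intg_out _ N); last by move=> p /phi0 ->; rewrite mulr0.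
  by move=> p; apply: cvgM; [exact: cdF|exact: cphi].
apply/eqP; rewrite -subr_eq0 opprK -RID//; apply/eqP.
apply: (integral_dx0 HW); last exact: intgD.
by apply: (@continuous_intg_out _ N) => // p /phi0 ->; rewrite mulr0.
Qed.

Lemma intg_swap f : intg leb2 f -> intg leb2 (fun p => f (p.2, p.1)).
Proof.
move=> fi; have mf := intg_meas fi.
have ms : measurable_fun setT (fun p : R2 => (p.2, p.1) : R2).
  by apply: measurable_fun_pair; [exact: measurable_snd|exact: measurable_fst].
apply/(integrable12ltyP leb leb).
  by apply/measurable_EFinP; exact: (measurableT_comp mf ms).
by have /(integrable21ltyP leb leb) := fi; apply; exact/measurable_EFinP.
Qed.

(** The two orders of integration in Fubini's theorem show that exchanging coordinates preserves
    integrals; vanishing of the integral of a y-derivative is deduced in this way from the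
    x-case. *)
Lemma RI_swap f : intg leb2 f ->
  \int[leb2]_(p in setT) f (p.2, p.1) = \int[leb2]_(p in setT) f p.
Proof.
by move=> fi; rewrite planar_fubini ?planar_fubini2//; exact: intg_swap.
Qed.

Lemma hasdx_swap F dF : hasdy F dF ->
  hasdx (fun p => F (p.2, p.1)) (fun p => dF (p.2, p.1)).
Proof.
move=> [cF cdF HF].
have cs (f : R * R -> R) : continuous f -> continuous (fun p : R * R => f (p.2, p.1)).
  move=> cf p; apply: (@cvg_comp _ _ _ (fun p => (p.2, p.1)) f _ _ _ _ (cf _)).
  exact: (cvg_pair cvg_snd cvg_fst).
split; [exact: cs|exact: cs|].
by move=> [x y]; apply/is_derive_x; have /is_derive_y := HF (y, x).
Qed.

Lemma integral_dy0 W dW : hasdy W dW -> intg leb2 W -> intg leb2 dW ->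
  \int[leb2]_(p in setT) dW p = 0.
Proof.
move=> HW iW idW; rewrite -RI_swap//.
by apply: integral_dx0 (hasdx_swap HW) _ _; exact: intg_swap.
Qed.

Lemma hasdy_mul F dF f g : hasdy F dF -> hasdy f g ->
  hasdy (fun p => F p * f p) (fun p => F p * g p + dF p * f p).
Proof.
move=> [cF cdF Fd] [cf cg fd]; split.
- by move=> p; apply: cvgM; [exact: cF|exact: cf].
- move=> p; apply: cvgD; apply: cvgM.
  + exact: cF.
  + exact: cg.
  + exact: cdF.
  + exact: cf.
- move=> p; apply: (is_derive_eq (is_deriveM (Fd p) (fd p))).
  by rewrite /GRing.scale/=; ring.
Qed.

Lemma parts_y F dF phi dphi N : hasdy F dF -> hasdy phi dphi ->
  (forall p, ~ cbox (-N) N (-N) N p -> phi p = 0) ->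
  (forall p, ~ cbox (-N) N (-N) N p -> dphi p = 0) ->
  \int[leb2]_(p in setT) (F p * dphi p) = - \int[leb2]_(p in setT) (dF p * phi p).
Proof.
move=> HF Hphi phi0 dphi0.
have HW := hasdy_mul HF Hphi; have [cW cdW _] := HW.
have [cF cdF _] := HF; have [cphi cdphi _] := Hphi.
have i1 : intg leb2 (fun p => F p * dphi p).
  apply: (@continuous_intg_out _ N); last by move=> p /dphi0 ->; rewrite mulr0.
  by move=> p; apply: cvgM; [exact: cF|exact: cdphi].
have i2 : intg leb2 (fun p => dF p * phi p).
  apply: (@continuous_intg_out _ N); last by move=> p /phi0 ->; rewrite mulr0.
  by move=> p; apply: cvgM; [exact: cdF|exact: cphi].
apply/eqP; rewrite -subr_eq0 opprK -RID//; apply/eqP.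
apply: (integral_dy0 HW); last exact: intgD.
by apply: (@continuous_intg_out _ N) => // p /phi0 ->; rewrite mulr0.
Qed.

Lemma hasdx_test phi : test_function phi -> hasdx phi (dx phi).
Proof.
move=> [sphi _]; split.
- by move=> p; apply: differentiable_continuous; exact: (sphi (0, 0)%N).
- by move=> p; apply: differentiable_continuous; exact: (sphi (1, 0)%N).
- by move=> p; apply/derivableP/diff_derivable; exact: (sphi (0, 0)%N).
Qed.

Lemma hasdy_test phi : test_function phi -> hasdy phi (dy phi).
Proof.
move=> [sphi _]; split.
- by move=> p; apply: differentiable_continuous; exact: (sphi (0, 0)%N).
- by move=> p; apply: differentiable_continuous; exact: (sphi (0, 1)%N).
- by move=> p; apply/derivableP/diff_derivable; exact: (sphi (0, 0)%N).
Qed.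

Lemma test_out phi : test_function phi -> exists2 N, 0 < N &
  forall p, ~ cbox (-N) N (-N) N p -> [/\ phi p = 0, dx phi p = 0 & dy phi p = 0].
Proof.
move=> [_ cphi]; have [N N0 KN] := compact_sub_cbox cphi.
exists N => // p pN.
have pK : ~ closure [set p | phi p != 0] p by move/KN.
have : \forall z \near p, phi z = 0.
  have : nbhs p (~` closure [set p | phi p != 0]).
    by apply: open_nbhs_nbhs; split => //; rewrite openC; exact: closed_closure.
  apply: filterS => z /= zK; apply/eqP; apply: contrapT => /negP zn0.
  by apply: zK; exact: subset_closure.
move=> H; split; first exact: nbhs_singleton H.
- have h0 : is_derive p ((1, 0) : R * R) (fun=> 0 : R) 0 by exact: is_derive_cst.
  have : is_derive p ((1, 0) : R * R) phi 0; last by case.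
  by apply: (near_eq_is_derive _ h0); apply: filterS H => z ->.
- have h0 : is_derive p ((0, 1) : R * R) (fun=> 0 : R) 0 by exact: is_derive_cst.
  have : is_derive p ((0, 1) : R * R) phi 0; last by case.
  by apply: (near_eq_is_derive _ h0); apply: filterS H => z ->.
Qed.

Lemma RI_mul_ae f F (g : R * R -> R) : measurable_fun setT f ->
  measurable_fun setT F -> measurable_fun setT g ->
  {ae leb2, forall p, f p = F p} ->
  \int[leb2]_(p in setT) (f p * g p) = \int[leb2]_(p in setT) (F p * g p).
Proof.
move=> mf mF mg fF; apply: RI_ae; [exact: measurable_funM..|].
by apply: aeS fF => p ->.
Qed.

(** The way back from classical to weak derivatives: integration by parts against the compactly
    supported test function, in which [f] may be replaced by [F]. *)
Lemma classical_wderiv_x f F dF : measurable_fun setT f -> hasdx F dF ->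
  {ae leb2, forall p, f p = F p} -> is_wderiv (1, 0)%N f dF.
Proof.
move=> mf HF fF; have [cF cdF _] := HF.
have mF := continuous_measurable2 cF.
split; [exact: (L1loc_ae mf fF (continuous_L1loc cF))|exact: continuous_L1loc|].
move=> phi tphi; have [N N0 HN] := test_out tphi.
have Hphi := hasdx_test tphi; have [cphi cdphi _] := Hphi.
rewrite expr1 mulN1r -(parts_x (N := N) HF Hphi); last 2 first.
- by move=> p /HN[].
- by move=> p /HN[].
by apply: RI_mul_ae => //; exact: continuous_measurable2.
Qed.

Lemma classical_wderiv_y f F dF : measurable_fun setT f -> hasdy F dF ->
  {ae leb2, forall p, f p = F p} -> is_wderiv (0, 1)%N f dF.
Proof.
move=> mf HF fF; have [cF cdF _] := HF.
have mF := continuous_measurable2 cF.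
split; [exact: (L1loc_ae mf fF (continuous_L1loc cF))|exact: continuous_L1loc|].
move=> phi tphi; have [N N0 HN] := test_out tphi.
have Hphi := hasdy_test tphi; have [cphi cdphi _] := Hphi.
rewrite expr1 mulN1r -(parts_y (N := N) HF Hphi); last 2 first.
- by move=> p /HN[].
- by move=> p /HN[].
by apply: RI_mul_ae => //; exact: continuous_measurable2.
Qed.
End PlanarParts.

(** * Classical representatives of Sobolev functions *)

Section SquareIntegrable.
Context {R : realType}.
Notation leb := (@lebesgue_measure R).
Notation R2 := (measurableTypeR R * measurableTypeR R)%type.
Implicit Types (f g h : R * R -> R).

Definition L2 f := measurable_fun (setT : set R2) f /\ intg leb2 (fun p => f p ^+ 2).

Lemma L2_measurable f : L2 f -> measurable_fun (setT : set R2) f.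
Proof. by case. Qed.

Lemma L2_intg f : L2 f -> intg leb2 (fun p => f p ^+ 2).
Proof. by case. Qed.

Lemma normM_le_sqr (a b : R) : `|a * b| <= a ^+ 2 + b ^+ 2.
Proof.
rewrite normrM -(real_normK (num_real a)) -(real_normK (num_real b)).
have := sqr_ge0 (`|a| - `|b|); have := sqr_ge0 (`|a|); have := sqr_ge0 (`|b|).
have := normr_ge0 a; have := normr_ge0 b; nra.
Qed.

Lemma L2M f g : L2 f -> L2 g -> intg leb2 (fun p => f p * g p).
Proof.
move=> [mf fi] [mg gi]; apply: (intg_le _ _ (intgD fi gi)).
- exact: measurable_funM.
- by move=> p; exact: normM_le_sqr.
Qed.

Lemma L2D f g : L2 f -> L2 g -> L2 (fun p => f p + g p).
Proof.
move=> Lf Lg; have [mf fi] := Lf; have [mg gi] := Lg.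
have m : measurable_fun (setT : set R2) (fun p => f p + g p) by exact: measurable_funD.
split => //; apply: (intg_le _ _ (intgD (intgZ 2 fi) (intgZ 2 gi))).
- exact: measurable_funX.
- move=> p; rewrite ger0_norm ?sqr_ge0//.
  by have := sqr_ge0 (f p - g p); nra.
Qed.

Lemma L2Mb f g (M : R) : L2 f -> measurable_fun (setT : set R2) g ->
  (forall p, `|g p| <= M) -> L2 (fun p => g p * f p).
Proof.
move=> [mf fi] mg gM; split; first exact: measurable_funM.
apply: (@eq_integrable _ _ _ leb2 _ _ (fun p => (g p ^+ 2 * f p ^+ 2)%:E)) => //.
  by move=> p _; rewrite exprMn.
apply: (intgMb (M := M ^+ 2) fi); first exact: measurable_funX.
move=> p; rewrite normrX lerXn2r ?nnegrE//.
exact: le_trans (normr_ge0 _) (gM p).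
Qed.

Lemma L2Z f (k : R) : L2 f -> L2 (fun p => k * f p).
Proof. by move=> Lf; apply: (L2Mb (M := `|k|) Lf) => //; exact: measurable_cst. Qed.

Lemma L2N f : L2 f -> L2 (fun p => - f p).
Proof. by move=> /(L2Z (-1)); congr L2; apply/funext => p; rewrite mulN1r. Qed.

Lemma L2B f g : L2 f -> L2 g -> L2 (fun p => f p - g p).
Proof. by move=> Lf Lg; apply: L2D => //; exact: L2N. Qed.

Lemma L2_ae f g : measurable_fun (setT : set R2) f ->
  {ae leb2, forall p, f p = g p} -> L2 g -> L2 f.
Proof.
move=> mf fg [mg gi]; split => //; apply: intg_ae gi; first exact: measurable_funX.
by apply: aeS fg => p ->.
Qed.

Lemma L2_L1loc f : L2 f -> L1loc f.
Proof.
move=> [mf fi]; apply/L1locP; split => // N.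
apply: (intg_le _ _ (intgD (intg_cst_cbox N 1) fi)).
- by apply: measurable_funM => //; apply: measurable_indic; exact: measurable_cbox.
- move=> p; apply: le_trans (normM_le_sqr _ _) _; rewrite mul1r lerD2r.
  by rewrite indicE; case: (_ \in _); rewrite ?expr1n ?expr0n.
Qed.

Lemma RI_sqr_ge0 f : 0 <= \int[leb2]_(p in setT) (f p ^+ 2).
Proof. by apply: RI_ge0 => p; exact: sqr_ge0. Qed.

(** The pointwise inequality |f g| <= (M / 2d) f^2 + (d / 2M) g^2 integrates to dM / 2 + dM / 2. *)
Lemma cauchy_schwarz f g (d M : R) : L2 f -> L2 g -> 0 < d -> 0 < M ->
  \int[leb2]_(p in setT) (f p ^+ 2) <= d ^+ 2 ->
  \int[leb2]_(p in setT) (g p ^+ 2) <= M ^+ 2 ->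
  `|\int[leb2]_(p in setT) (f p * g p)| <= d * M.
Proof.
move=> Lf Lg d0 M0 fd gM; have fi := L2_intg Lf; have gi := L2_intg Lg.
pose a := M / (2 * d); pose b := d / (2 * M).
apply: (@le_trans _ _ (\int[leb2]_(p in setT) (a * f p ^+ 2 + b * g p ^+ 2))).
  apply: RI_norm_le; [exact: L2M|by apply: intgD; exact: intgZ|move=> p].
  rewrite normrM -(real_normK (num_real (f p))) -(real_normK (num_real (g p))).
  have : 0 <= (2 * d * M)^-1 * (M * `|f p| - d * `|g p|) ^+ 2.
    by rewrite mulr_ge0// ?sqr_ge0// invr_ge0 !mulr_ge0// ltW.
  move=> h; rewrite -subr_ge0; apply: le_trans h _; rewrite le_eqVlt; apply/orP; left.
  by apply/eqP; rewrite /a /b; field; rewrite !gt_eqF.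
rewrite RID; [|exact: intgZ..]; rewrite !RIZ//.
apply: (@le_trans _ _ (a * d ^+ 2 + b * M ^+ 2)).
  by apply: lerD; rewrite ler_wpM2l// /a /b divr_ge0// ?mulr_ge0// ltW.
rewrite le_eqVlt; apply/orP; left; apply/eqP.
by rewrite /a /b; field; rewrite !gt_eqF.
Qed.

(** If h is positive at a point it is positive on a box around it, and a box of positive measure
    does not fit in a null set. *)
Lemma continuous_ae_le0 h : continuous h -> {ae leb2, forall p, h p <= 0} ->
  forall p, h p <= 0.
Proof.
move=> ch [N [mN N0 hN]] p; rewrite leNgt; apply/negP => hp.
have : \forall z \near p, 0 < h z by apply: (cvgr_gt _ (ch p)).
move=> /nbhs_ballP[e /= e0 be].
have sub : obox (p.1 - e) (p.1 + e) (p.2 - e) (p.2 + e) `<=` N.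
  move=> z [/= z1 z2]; apply: hN => /= hz.
  have : 0 < h z.
    apply: be; split => /=; rewrite /ball/= ltr_norml.
    - by move: z1; rewrite in_itv/=; lra.
    - by move: z2; rewrite in_itv/=; lra.
  by rewrite ltNge hz.
have : (leb2 (obox (p.1 - e) (p.1 + e) (p.2 - e) (p.2 + e)) <= 0)%E.
  rewrite -N0; apply: (le_measure leb2 _ _ sub); apply: mem_set => //.
  exact: measurable_obox.
rewrite leb2E /obox product_measure1E; [|exact: measurable_itv..].
have H (c : R) : lebesgue_measure `]c - e, c + e[%classic = (2 * e)%:E.
  rewrite lebesgue_measure_itv/= lte_fin ltrD2l gtrN// -EFinD; congr EFin; lra.
rewrite [X in (X * _)%E](H p.1) [X in (_ * X)%E](H p.2) -EFinM lee_fin.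
apply/negP; rewrite -ltNge; apply: mulr_gt0; lra.
Qed.

Lemma continuous_ae_eq f g : continuous f -> continuous g ->
  {ae leb2, forall p, f p = g p} -> f = g.
Proof.
move=> cf cg fg; apply/funext => p; apply/eqP; rewrite eq_le; apply/andP; split.
- rewrite -subr_le0; apply: (@continuous_ae_le0 (fun p => f p - g p)).
  + by move=> z; apply: cvgB; [exact: cf|exact: cg].
  + by apply: aeS fg => z ->; rewrite subrr.
- rewrite -subr_le0; apply: (@continuous_ae_le0 (fun p => g p - f p)).
  + by move=> z; apply: cvgB; [exact: cg|exact: cf].
  + by apply: aeS fg => z ->; rewrite subrr.
Qed.

End SquareIntegrable.

(** * The representative given by the parametrix *)

Section Representative.
Context {R : realType}.
Notation leb := (@lebesgue_measure R).
Notation R2 := (measurableTypeR R * measurableTypeR R)%type.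
Implicit Types (f g h : R * R -> R).

Definition WK k f := forall m n, (m + n <= k)%N ->
  is_wderiv (m, n) f (wderiv (m, n) f) /\ L2 (wderiv (m, n) f).

(** Both integrals are, up to sign, the integral of [f] against one and the same derivative of the
    tensor, so that no weak derivative of a weak derivative has to be formed. *)
Lemma wderiv_tensor k f m n i j psi chi : WK k f -> (m + i + (n + j) <= k)%N ->
  test1 psi -> test1 chi ->
  \int[leb2]_(p in setT)
    (wderiv (m, n) f p * tensor (derive1n i psi) (derive1n j chi) p) =
  (-1) ^+ (i + j) * \int[leb2]_(p in setT)
    (wderiv ((m + i)%N, (n + j)%N) f p * tensor psi chi p).
Proof.
move=> Wf mnk tpsi tchi.
have mnk' : (m + n <= k)%N by apply: leq_trans mnk; apply: leq_add; exact: leq_addr.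
have [[_ _ H1] _] := Wf _ _ mnk'; have [[_ _ H2] _] := Wf _ _ mnk.
have t1 := test_function_tensor (test1_derive1n i tpsi) (test1_derive1n j tchi).
have t2 := test_function_tensor tpsi tchi.
have := H1 _ t1; have := H2 _ t2.
rewrite pderiv_tensor; [|by case: tpsi|by case: tchi].
rewrite pderiv_tensor; [|by case: (test1_derive1n i tpsi)|by case: (test1_derive1n j tchi)].
have D a b (h : R -> R) : derive1n a (derive1n b h) = derive1n (a + b) h.
  by rewrite /derive1n -iterD.
rewrite !D => -> /= /esym.
have sgn a : (-1) ^+ a * (-1) ^+ a = 1 :> R.
  by rewrite -expr2 sqrr_sign.
move=> /(congr1 (fun x => (-1) ^+ (m + n) * x)).
rewrite !mulrA sgn mul1r => ->.
congr (_ * _); rewrite -exprD.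
have -> : (m + n + (m + i + (n + j)) = (m + n) * 2 + (i + j))%N by ring.
by rewrite exprD exprM sqrr_sign mul1r.
Qed.

(* Each test function psi(x) chi(y) is expanded by the parametrix in both
   variables; the third derivatives are then moved onto f. *)
Definition rep f m n z := K kP kP (wderiv ((m + 3)%N, (n + 3)%N) f) z
  - K kP kQ (wderiv ((m + 3)%N, n) f) z
  - K kQ kP (wderiv (m, (n + 3)%N) f) z + K kQ kQ (wderiv (m, n) f) z.

Lemma flat_kP : flat_ends (kP : {poly R}). Proof. by split; rewrite ?kP0 ?kP1. Qed.
Lemma flat_kQ : flat_ends (kQ : {poly R}). Proof. by split; rewrite ?kQ0 ?kQ1. Qed.
Lemma flat_dkP : flat_ends ((kP : {poly R})^`()).
Proof. by split; rewrite ?dkP0 ?dkP1. Qed.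
Lemma flat_dkQ : flat_ends ((kQ : {poly R})^`()).
Proof. by split; rewrite ?dkQ0 ?dkQ1. Qed.

Hint Resolve flat_kP flat_kQ flat_dkP flat_dkQ : core.

Lemma WK_L1loc k f m n : WK k f -> (m + n <= k)%N -> L1loc (wderiv (m, n) f).
Proof. by move=> Wf mn; have [_ /L2_L1loc] := Wf _ _ mn. Qed.

Lemma WK_rep k f m n : WK k f -> (m + n + 6 <= k)%N ->
  [/\ L1loc (wderiv ((m + 3)%N, (n + 3)%N) f), L1loc (wderiv ((m + 3)%N, n) f),
      L1loc (wderiv (m, (n + 3)%N) f) & L1loc (wderiv (m, n) f)].
Proof.
by move=> Wf mn; split; apply: (WK_L1loc Wf); apply: leq_trans mn; lia.
Qed.

Lemma rep_continuous k f m n : WK k f -> (m + n + 6 <= k)%N -> continuous (rep f m n).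
Proof.
move=> Wf mn; have [? ? ? ?] := WK_rep Wf mn.
by move=> z; apply: cvgD; [apply: cvgB; [apply: cvgB|]|]; apply: K_continuous.
Qed.

(** Writing each factor of the test function as (k * psi)''' + l * psi gives four terms. Moving one
    third derivative onto [f] costs the sign (-1)^3, moving two costs none; these are the signs in
    [rep]. Transposition by [K_pairing] then frees psi and chi. *)
Lemma rep_pairing k f m n psi chi : WK k f -> (m + n + 6 <= k)%N ->
  test1 psi -> test1 chi ->
  \int[leb2]_(z in setT) (rep f m n z * tensor psi chi z) =
  \int[leb2]_(z in setT) (wderiv (m, n) f z * tensor psi chi z).
Proof.
move=> Wf mn tpsi tchi; have [l33 l30 l03 l00] := WK_rep Wf mn.
have cP (g : R -> R) p : test1 g -> test1 (conv p g) by exact: conv_test.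
pose P (g : R -> R) : R -> R := derive1n 3 (conv kP g).
have tP (g : R -> R) : test1 g -> test1 (P g) by move=> tg; apply: test1_derive1n; exact: cP.
have cK p q h : flat_ends p -> flat_ends q -> L1loc h ->
    intg leb2 (fun z => K p q h z * tensor psi chi z).
  by move=> fp fq lh; apply: L1loc_mul_tensor => //; apply: continuous_L1loc; exact: K_continuous.
transitivity (\int[leb2]_(z in setT) (wderiv (m, n) f z * tensor (P psi) (P chi) z
  + wderiv (m, n) f z * tensor (P psi) (conv kQ chi) z
  + wderiv (m, n) f z * tensor (conv kQ psi) (P chi) z
  + wderiv (m, n) f z * tensor (conv kQ psi) (conv kQ chi) z)); last first.
  have distr4 (w x1 x2 y1 y2 : R) : w * (x1 * y1) + w * (x1 * y2) + w * (x2 * y1) +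
    w * (x2 * y2) = w * ((x1 + x2) * (y1 + y2)) by ring.
  apply: RI_eq => z; rewrite /tensor (conv_parametrix z.1 tpsi) (conv_parametrix z.2 tchi).
  exact: distr4.
have lt a b : test1 a -> test1 b -> intg leb2 (fun z => wderiv (m, n) f z * tensor a b z).
  by move=> ta tb; exact: L1loc_mul_tensor.
rewrite !RID; do ?[apply: intgD]; do ?[by apply: lt; do ?[exact: tP|exact: cP]].
transitivity (\int[leb2]_(z in setT) (K kP kP (wderiv ((m + 3)%N, (n + 3)%N) f) z * tensor psi chi z
  - K kP kQ (wderiv ((m + 3)%N, n) f) z * tensor psi chi z
  - K kQ kP (wderiv (m, (n + 3)%N) f) z * tensor psi chi z
  + K kQ kQ (wderiv (m, n) f) z * tensor psi chi z)).
  by apply: RI_eq => z; rewrite /rep mulrDl !mulrBl.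
rewrite RID; [|by apply: intgB; [apply: intgB|]; apply: cK|exact: cK].
rewrite RIB; [|by apply: intgB; apply: cK|exact: cK].
rewrite RIB; [|exact: cK..].
rewrite -!K_pairing//.
congr (_ + _ + _ + _).
- rewrite (wderiv_tensor Wf)//; [|lia|exact: cP..].
  by rewrite -signr_odd/= expr0 mul1r.
- rewrite (@wderiv_tensor k f m n 3 0 (conv kP psi) (conv kQ chi))//; [|lia|exact: cP..].
  by rewrite !addn0 -signr_odd/= expr1 mulN1r.
- rewrite (@wderiv_tensor k f m n 0 3 (conv kQ psi) (conv kP chi))//; [|lia|exact: cP..].
  by rewrite !addn0 -signr_odd/= expr1 mulN1r.
Qed.

Lemma test_ae_eq f g : L1loc f -> L1loc g ->
  (forall psi chi, test1 psi -> test1 chi ->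
    \int[leb2]_(z in setT) (f z * tensor psi chi z) =
    \int[leb2]_(z in setT) (g z * tensor psi chi z)) ->
  {ae leb2, forall p, f p = g p}.
Proof.
move=> lf lg fg.
have mf := L1loc_measurable lf; have mg := L1loc_measurable lg.
have : {ae leb2, forall p, f p - g p = 0}.
  apply: fundamental_lemma.
    apply/L1locP; split; first exact: measurable_funB.
    move=> N; have /L1locP[_ /(_ N) fi] := lf; have /L1locP[_ /(_ N) gi] := lg.
    by apply: eq_integrable (intgB fi gi) => // p _; rewrite mulrBr.
  move=> psi chi tpsi tchi.
  transitivity (\int[leb2]_(z in setT) (f z * tensor psi chi z - g z * tensor psi chi z)).
    by apply: RI_eq => z; rewrite mulrBl.
  by rewrite RIB ?fg ?subrr//; exact: L1loc_mul_tensor.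
by apply: aeS => p /subr0_eq.
Qed.

Lemma rep_ae k f m n : WK k f -> (m + n + 6 <= k)%N ->
  {ae leb2, forall p, wderiv (m, n) f p = rep f m n p}.
Proof.
move=> Wf mn; apply: test_ae_eq.
- by have [] := WK_rep Wf mn.
- by apply: continuous_L1loc; exact: rep_continuous Wf mn.
- by move=> psi chi tpsi tchi; rewrite (rep_pairing Wf mn).
Qed.

(** Differentiating the kernels yields a classical derivative [d]. Integration by parts shows that
    [d] and [rep f m.+1 n] have the same pairings with products of test functions; both are
    continuous, hence equal everywhere. *)
Lemma rep_hasdx k f m n : WK k f -> (m + n + 7 <= k)%N ->
  hasdx (rep f m n) (rep f m.+1 n).
Proof.
move=> Wf mn; have mn6 : (m + n + 6 <= k)%N by lia.
have mn6' : (m.+1 + n + 6 <= k)%N by lia.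
have [l33 l30 l03 l00] := WK_rep Wf mn6.
have crep := rep_continuous Wf mn6; have crep' := rep_continuous Wf mn6'.
pose d z := (- K kP^`() kP (wderiv ((m + 3)%N, (n + 3)%N) f) z)
  - (- K kP^`() kQ (wderiv ((m + 3)%N, n) f) z)
  - (- K kQ^`() kP (wderiv (m, (n + 3)%N) f) z) + (- K kQ^`() kQ (wderiv (m, n) f) z).
have Hd p : is_derive p ((1, 0) : R * R) (rep f m n) (d p).
  apply: is_deriveD; [apply: is_deriveB; [apply: is_deriveB|]|]; exact: K_is_derive_x.
have cd : continuous d.
  by move=> z; apply: cvgD; [apply: cvgB; [apply: cvgB|]|]; apply: cvgN; apply: K_continuous.
suff <- : d = rep f m.+1 n by split.
apply: continuous_ae_eq => //; apply: test_ae_eq; [exact: continuous_L1loc..|].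
move=> psi chi tpsi tchi; rewrite (rep_pairing Wf mn6')//.
have [N N0 HN] := test_out (test_function_tensor tpsi tchi).
have := @parts_x R (rep f m n) d (tensor psi chi) (dx (tensor psi chi)) N.
move=> /(_ _ _ _ _)/esym.
move=> E; rewrite -[LHS]opprK E; first last.
- by move=> p /HN[].
- by move=> p /HN[].
- exact: hasdx_test (test_function_tensor tpsi tchi).
- by [].
rewrite dx_tensor; last by move=> x; apply: smooth1_derivable; case: tpsi.
rewrite (rep_pairing Wf mn6)//; last exact: test1_derive.
rewrite (@wderiv_tensor k f m n 1 0 psi chi)//; last by lia.
by rewrite !addn0 !addn1 expr1 mulN1r opprK.
Qed.

Lemma rep_hasdy k f m n : WK k f -> (m + n + 7 <= k)%N ->
  hasdy (rep f m n) (rep f m n.+1).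
Proof.
move=> Wf mn; have mn6 : (m + n + 6 <= k)%N by lia.
have mn6' : (m + n.+1 + 6 <= k)%N by lia.
have [l33 l30 l03 l00] := WK_rep Wf mn6.
have crep := rep_continuous Wf mn6; have crep' := rep_continuous Wf mn6'.
pose d z := (- K kP kP^`() (wderiv ((m + 3)%N, (n + 3)%N) f) z)
  - (- K kP kQ^`() (wderiv ((m + 3)%N, n) f) z)
  - (- K kQ kP^`() (wderiv (m, (n + 3)%N) f) z) + (- K kQ kQ^`() (wderiv (m, n) f) z).
have Hd p : is_derive p ((0, 1) : R * R) (rep f m n) (d p).
  apply: is_deriveD; [apply: is_deriveB; [apply: is_deriveB|]|]; exact: K_is_derive_y.
have cd : continuous d.
  by move=> z; apply: cvgD; [apply: cvgB; [apply: cvgB|]|]; apply: cvgN; apply: K_continuous.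
suff <- : d = rep f m n.+1 by split.
apply: continuous_ae_eq => //; apply: test_ae_eq; [exact: continuous_L1loc..|].
move=> psi chi tpsi tchi; rewrite (rep_pairing Wf mn6')//.
have [N N0 HN] := test_out (test_function_tensor tpsi tchi).
have := @parts_y R (rep f m n) d (tensor psi chi) (dy (tensor psi chi)) N.
move=> /(_ _ _ _ _)/esym.
move=> E; rewrite -[LHS]opprK E; first last.
- by move=> p /HN[].
- by move=> p /HN[].
- exact: hasdy_test (test_function_tensor tpsi tchi).
- by [].
rewrite dy_tensor; last by move=> x; apply: smooth1_derivable; case: tchi.
rewrite (rep_pairing Wf mn6)//; last exact: test1_derive.
rewrite (@wderiv_tensor k f m n 0 1 psi chi)//; last by lia.
by rewrite !addn0 !addn1 expr1 mulN1r opprK.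
Qed.

(** The constant is chosen before the function: this uniformity allows the bound to be applied to
    difference quotients in time. *)
Lemma rep_bounded : exists2 C : R, 0 <= C & forall k f m n (d : R),
  WK k f -> (m + n + 6 <= k)%N -> 0 < d ->
  (forall i j, (i + j <= k)%N ->
     \int[leb2]_(p in setT) (wderiv (i, j) f p ^+ 2) <= d ^+ 2) ->
  forall z, `|rep f m n z| <= C * d.
Proof.
have [M1 M10 H1] := K_sup_bound flat_kP flat_kP.
have [M2 M20 H2] := K_sup_bound flat_kP flat_kQ.
have [M3 M30 H3] := K_sup_bound flat_kQ flat_kP.
have [M4 M40 H4] := K_sup_bound flat_kQ flat_kQ.
exists (M1 + M2 + M3 + M4); first by rewrite !addr_ge0.
move=> k f m n d Wf mn d0 Hd z; rewrite !mulrDl.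
have [l33 l30 l03 l00] := WK_rep Wf mn.
have L i j : (i + j <= k)%N -> measurable_fun setT (wderiv (i, j) f) /\
  intg leb2 (fun w => wderiv (i, j) f w ^+ 2).
  by move=> ij; have [_ []] := Wf _ _ ij.
apply: le_trans (ler_normD _ _) _; apply: lerD; last first.
  by apply: H4 => //; [apply L..|apply: Hd]; lia.
apply: le_trans (ler_normB _ _) _; apply: lerD; last first.
  by apply: H3 => //; [apply L..|apply: Hd]; lia.
apply: le_trans (ler_normB _ _) _; apply: lerD.
  by apply: H1 => //; [apply L..|apply: Hd]; lia.
by apply: H2 => //; [apply L..|apply: Hd]; lia.
Qed.

End Representative.

(** * Classes of functions with controlled iterated derivatives *)

Section Towers.
Context {R : realType}.
Notation R2 := (measurableTypeR R * measurableTypeR R)%type.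
Implicit Types (f g h F G : R * R -> R) (P : (R * R -> R) -> Prop).

(** The recursion follows both [dx] and [dy], so it controls the mixed derivatives in every order of
    derivation. *)
Fixpoint tower P k F : Prop := [/\ continuous F, P F &
  if k is k'.+1 then
    [/\ forall p, is_derive p ((1, 0) : R * R) F (dx F p),
        forall p, is_derive p ((0, 1) : R * R) F (dy F p),
        tower P k' (dx F) & tower P k' (dy F)]
  else True].

Definition bounded_fct F := exists M : R, forall p, `|F p| <= M.
(** [TB] is meant for coefficients such as [D], [TL] for the unknowns. A product of the two kinds is
    again [TL], and so is a product of two [TL] functions, one of them being used through its
    bound. *)
Definition TB := tower bounded_fct.
Definition TL := tower (fun F => bounded_fct F /\ L2 F).

Lemma tower_continuous P k F : tower P k F -> continuous F.
Proof. by case: k => [|k] []. Qed.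

Lemma tower_prop P k F : tower P k F -> P F.
Proof. by case: k => [|k] []. Qed.

Lemma tower_dx P k F : tower P k.+1 F -> tower P k (dx F).
Proof. by move=> [_ _ []]. Qed.

Lemma tower_dy P k F : tower P k.+1 F -> tower P k (dy F).
Proof. by move=> [_ _ []]. Qed.

Lemma tower_hasdx P k F : tower P k.+1 F -> hasdx F (dx F).
Proof. by move=> [cF _ [? _ /tower_continuous ? _]]. Qed.

Lemma tower_hasdy P k F : tower P k.+1 F -> hasdy F (dy F).
Proof. by move=> [cF _ [_ ? _ /tower_continuous ?]]. Qed.

Lemma towerW P k F : tower P k.+1 F -> tower P k F.
Proof.
elim: k F => [|k IH] F [cF PF [Fx Fy tx ty]].
  by split; [exact: cF|exact: PF|exact: Logic.I].
split; [exact: cF|exact: PF|].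
exact: And4 Fx Fy (IH _ tx) (IH _ ty).
Qed.

Lemma hasdx_dx F dF : hasdx F dF -> dx F = dF.
Proof. by move=> [_ _ H]; apply/funext => p; have [] := H p. Qed.

Lemma hasdy_dy F dF : hasdy F dF -> dy F = dF.
Proof. by move=> [_ _ H]; apply/funext => p; have [] := H p. Qed.

Lemma towerS P k F dFx dFy : P F -> hasdx F dFx -> hasdy F dFy ->
  tower P k dFx -> tower P k dFy -> tower P k.+1 F.
Proof.
move=> PF Hx Hy tx ty; have [cF _ Fx] := Hx; have [_ _ Fy] := Hy.
by split=> //; rewrite (hasdx_dx Hx) (hasdy_dy Hy).
Qed.

Lemma hasdxD F dF G dG : hasdx F dF -> hasdx G dG ->
  hasdx (fun p => F p + G p) (fun p => dF p + dG p).
Proof.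
move=> [cF cdF HF] [cG cdG HG]; split.
- by move=> p; apply: cvgD; [exact: cF|exact: cG].
- by move=> p; apply: cvgD; [exact: cdF|exact: cdG].
- by move=> p; apply: is_deriveD.
Qed.

Lemma hasdyD F dF G dG : hasdy F dF -> hasdy G dG ->
  hasdy (fun p => F p + G p) (fun p => dF p + dG p).
Proof.
move=> [cF cdF HF] [cG cdG HG]; split.
- by move=> p; apply: cvgD; [exact: cF|exact: cG].
- by move=> p; apply: cvgD; [exact: cdF|exact: cdG].
- by move=> p; apply: is_deriveD.
Qed.

Lemma hasdxZ F dF (c : R) : hasdx F dF -> hasdx (fun p => c * F p) (fun p => c * dF p).
Proof.
move=> [cF cdF HF]; split.
- by move=> p; apply: cvgMr; exact: cF.
- by move=> p; apply: cvgMr; exact: cdF.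
- by move=> p; exact: is_deriveZ.
Qed.

Lemma hasdyZ F dF (c : R) : hasdy F dF -> hasdy (fun p => c * F p) (fun p => c * dF p).
Proof.
move=> [cF cdF HF]; split.
- by move=> p; apply: cvgMr; exact: cF.
- by move=> p; apply: cvgMr; exact: cdF.
- by move=> p; exact: is_deriveZ.
Qed.

Lemma towerD P k F G : (forall F G, P F -> P G -> P (fun p => F p + G p)) ->
  tower P k F -> tower P k G -> tower P k (fun p => F p + G p).
Proof.
move=> PD; elim: k F G => [|k IH] F G tF tG.
  move: tF tG => [cF PF _] [cG PG _]; split=> //; last exact: PD.
  by move=> p; apply: cvgD; [exact: cF|exact: cG].
apply: (towerS _ (hasdxD (tower_hasdx tF) (tower_hasdx tG))
  (hasdyD (tower_hasdy tF) (tower_hasdy tG))).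
- exact: PD (tower_prop tF) (tower_prop tG).
- by apply: IH; exact: tower_dx.
- by apply: IH; exact: tower_dy.
Qed.

Lemma towerZ P k F (c : R) : (forall F, P F -> P (fun p => c * F p)) ->
  tower P k F -> tower P k (fun p => c * F p).
Proof.
move=> PZ; elim: k F => [|k IH] F tF.
  move: tF => [cF PF _]; split=> //; last exact: PZ.
  by move=> p; apply: cvgMr; exact: cF.
apply: (towerS _ (hasdxZ c (tower_hasdx tF)) (hasdyZ c (tower_hasdy tF))).
- exact: PZ (tower_prop tF).
- by apply: IH; exact: tower_dx.
- by apply: IH; exact: tower_dy.
Qed.

(** Three separate properties let a single induction along the Leibniz rule cover both bounded times
    bounded and bounded times square integrable. *)
Lemma towerM P1 P2 P3 k F G :
  (forall F G, P3 F -> P3 G -> P3 (fun p => F p + G p)) ->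
  (forall F G, continuous F -> P1 F -> P2 G -> P3 (fun p => F p * G p)) ->
  tower P1 k F -> tower P2 k G -> tower P3 k (fun p => F p * G p).
Proof.
move=> PD PM; elim: k F G => [|k IH] F G tF tG.
  move: tF tG => [cF PF _] [cG PG _]; split=> //; last exact: PM.
  by move=> p; apply: cvgM; [exact: cF|exact: cG].
apply: (towerS _ (hasdx_mul (tower_hasdx tF) (tower_hasdx tG))
  (hasdy_mul (tower_hasdy tF) (tower_hasdy tG))).
- exact: PM (tower_continuous tF) (tower_prop tF) (tower_prop tG).
- by apply: towerD => //; apply: IH => //; do ?[exact: tower_dx|exact: towerW].
- by apply: towerD => //; apply: IH => //; do ?[exact: tower_dy|exact: towerW].
Qed.

Lemma bounded_fctD F G : bounded_fct F -> bounded_fct G ->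
  bounded_fct (fun p => F p + G p).
Proof.
by move=> [M HM] [N HN]; exists (M + N) => p; rewrite (le_trans (ler_normD _ _))// lerD.
Qed.

Lemma bounded_fctM F G : bounded_fct F -> bounded_fct G ->
  bounded_fct (fun p => F p * G p).
Proof.
by move=> [M HM] [N HN]; exists (M * N) => p; rewrite normrM ler_pM.
Qed.

Lemma bounded_fctZ F (c : R) : bounded_fct F -> bounded_fct (fun p => c * F p).
Proof. by move=> [M HM]; exists (`|c| * M) => p; rewrite normrM ler_pM. Qed.

Lemma TBM k F G : TB k F -> TB k G -> TB k (fun p => F p * G p).
Proof.
apply: towerM; first exact: bounded_fctD.
by move=> ? ? _; exact: bounded_fctM.
Qed.

Lemma TLD k F G : TL k F -> TL k G -> TL k (fun p => F p + G p).
Proof.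
apply: towerD => {}F {}G [bF LF] [bG LG]; split; [exact: bounded_fctD|exact: L2D].
Qed.

Lemma TLZ k F (c : R) : TL k F -> TL k (fun p => c * F p).
Proof.
apply: towerZ => {}F [bF LF]; split; [exact: bounded_fctZ|exact: L2Z].
Qed.

Lemma TBL k F G : TB k F -> TL k G -> TL k (fun p => F p * G p).
Proof.
apply: towerM => {}F {}G.
  by move=> [bF LF] [bG LG]; split; [exact: bounded_fctD|exact: L2D].
move=> cF bF [bG LG]; split; first exact: bounded_fctM.
by have [M HM] := bF; apply: L2Mb HM => //; exact: continuous_measurable2.
Qed.

Lemma TL_TB k F : TL k F -> TB k F.
Proof.
elim: k F => [|k IH] F [cF [bF _] tF]; split; [exact: cF|exact: bF|by []|exact: cF|exact: bF|].
move: tF => [Fx Fy tx ty].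
exact: And4 Fx Fy (IH _ tx) (IH _ ty).
Qed.

Lemma TLM k F G : TL k F -> TL k G -> TL k (fun p => F p * G p).
Proof. by move=> /TL_TB; exact: TBL. Qed.

Lemma TB_cst k (c : R) : TB k (fun=> c).
Proof.
have H (d : R) : hasdx (fun=> d) (fun=> 0) /\ hasdy (fun=> d) (fun=> 0).
  by split; split; do ?[by move=> p; exact: cvg_cst|by move=> p; exact: is_derive_cst].
have b (d : R) : bounded_fct (fun=> d) by exists `|d|.
elim: k c => [|k IH] c; first by split=> //; move=> p; exact: cvg_cst.
by have [Hx Hy] := H c; apply: (towerS _ Hx Hy); [exact: b|exact: IH|exact: IH].
Qed.

Lemma K_bounded p q h : flat_ends p -> flat_ends q -> L2 h -> bounded_fct (K p q h).
Proof.
move=> fp fq Lh; have [M M0 HM] := K_sup_bound fp fq; have [mh ih] := Lh.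
pose I := \int[leb2]_(w in setT) (h w ^+ 2).
have I0 : 0 <= I := RI_sqr_ge0 h.
(* A positive d with I <= d^2 is wanted; d = 1 + I works for every I >= 0. *)
exists (M * (1 + I)) => z; apply: HM => //; last exact: L2_L1loc.
- by rewrite ltr_pwDl.
- rewrite -/I; nra.
Qed.

Lemma rep_TL k f m n l : WK k f -> (m + n + 6 + l <= k)%N -> TL l (rep f m n).
Proof.
move=> Wf; elim: l m n => [|l IH] m n mnl.
- have mn : (m + n + 6 <= k)%N by lia.
  have L i j : (i + j <= k)%N -> L2 (wderiv (i, j) f) by move=> ij; have [] := Wf _ _ ij.
  have cr := rep_continuous Wf mn.
  split => //; split; last first.
    apply: (@L2_ae _ _ (wderiv (m, n) f)); first exact: continuous_measurable2.
    - by apply: aeS (rep_ae Wf mn).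
    - by apply: L; lia.
  have [P Q dP dQ] := And4 (@flat_kP R) (@flat_kQ R) (@flat_dkP R) (@flat_dkQ R).
  have bN g : bounded_fct g -> bounded_fct (fun p => - g p).
    by move=> [M HM]; exists M => p; rewrite normrN.
  by apply: bounded_fctD; [apply: bounded_fctD; [apply: bounded_fctD; [|apply: bN]|apply: bN]|];
    apply: K_bounded => //; apply: L; lia.
- apply: towerS; [|apply: (rep_hasdx Wf); lia|apply: (rep_hasdy Wf); lia|apply: IH; lia|apply: IH; lia].
  have := IH m n _; case/(_ _)/tower_prop; first by lia.
  by [].
Qed.

Lemma TL_dx k F : TL k.+1 F -> TL k (dx F). Proof. exact: tower_dx. Qed.
Lemma TL_dy k F : TL k.+1 F -> TL k (dy F). Proof. exact: tower_dy. Qed.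
Lemma TL_hasdx k F : TL k.+1 F -> hasdx F (dx F). Proof. exact: tower_hasdx. Qed.
Lemma TL_hasdy k F : TL k.+1 F -> hasdy F (dy F). Proof. exact: tower_hasdy. Qed.
Lemma TLW k F : TL k.+1 F -> TL k F. Proof. exact: towerW. Qed.
Lemma TBW k F : TB k.+1 F -> TB k F. Proof. exact: towerW. Qed.
Lemma TL_continuous k F : TL k F -> continuous F. Proof. exact: tower_continuous. Qed.
Lemma TL_L2 k F : TL k F -> L2 F. Proof. by move=> /tower_prop[]. Qed.
Lemma TL_bounded k F : TL k F -> bounded_fct F. Proof. by move=> /tower_prop[]. Qed.
Lemma TB_bounded k F : TB k F -> bounded_fct F. Proof. by move=> /tower_prop. Qed.
Lemma TB_continuous k F : TB k F -> continuous F. Proof. exact: tower_continuous. Qed.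

End Towers.

(** * Consequences of membership in H^s and of a small norm *)

Section SobolevNorm.
Context {R : realType}.
Notation R2 := (measurableTypeR R * measurableTypeR R)%type.
Implicit Types (f g h F G : R * R -> R) (s : R).

Lemma gagliardo_ge0 (th : R) g : (0 <= gagliardo th g)%E.
Proof.
apply: integral_ge0 => p _; apply: integral_ge0 => q _; rewrite lee_fin.
by rewrite divr_ge0 ?sqr_ge0 ?powR_ge0.
Qed.

Lemma esqr_integral_ge0 g : (0 <= \int[leb2]_(p in setT) ((g p) ^+ 2)%:E :> \bar R)%E.
Proof. by apply: integral_ge0 => p _; rewrite lee_fin sqr_ge0. Qed.

Lemma Hs_sqnorm_term s f m n : (m + n <= Num.truncn s)%N ->
  (\int[leb2]_(p in setT) ((wderiv (m, n) f p) ^+ 2)%:E <= Hs_sqnorm s f)%E.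
Proof.
move=> mnk; rewrite /Hs_sqnorm; set k := Num.truncn s.
have mk : (m < k.+1)%N by rewrite ltnS (leq_trans (leq_addr n m)).
have nk : (n < k.+1)%N by rewrite ltnS (leq_trans (leq_addl m n)).
apply: (@le_trans _ _ (\sum_(m < k.+1) \sum_(n < k.+1 | (m + n <= k)%N)
      \int[leb2]_(p in setT) ((wderiv (m : nat, n : nat) f p) ^+ 2)%:E)%E); last first.
  apply: leeDl; case: ifP => // _; apply: sume_ge0 => i _; exact: gagliardo_ge0.
rewrite (bigD1 (Ordinal mk))//= (bigD1 (Ordinal nk))//= -addeA; apply: leeDl.
apply: adde_ge0; apply: sume_ge0 => i _; first exact: esqr_integral_ge0.
by apply: sume_ge0 => j _; exact: esqr_integral_ge0.
Qed.

Lemma Hs_sqnorm_ge0 s f : (0 <= Hs_sqnorm s f)%E.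
Proof.
by apply: le_trans (Hs_sqnorm_term f (leq0n _ : (0 + 0 <= _)%N)); exact: esqr_integral_ge0.
Qed.

Lemma L2_finite g : measurable_fun (setT : set R2) g ->
  (\int[leb2]_(p in setT) ((g p) ^+ 2)%:E < +oo)%E -> L2 g.
Proof.
move=> mg gi; split => //; apply/integrableP; split.
  by apply/measurable_EFinP; exact: measurable_funX.
by under eq_integral do rewrite abse_EFin ger0_norm ?sqr_ge0//.
Qed.

Lemma Hs_WK s f : Hs s f -> WK (Num.truncn s) f.
Proof.
move=> [wf fin] m n mnk; have [g /wderiv_is_wderiv wd] := wf (m, n) mnk.
split => //; apply: L2_finite.
  by apply: L1loc_measurable; case: wd.
apply: le_lt_trans (Hs_sqnorm_term f mnk) _.
by apply: lty_poweRy fin; rewrite invr_eq0 pnatr_eq0.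
Qed.

(** The existence of weak derivatives is supplied separately: for a function without them [wderiv]
    is a default value, and a small [Hs_norm] carries no information. *)
Lemma Hs_norm_small s f (e : R) : 0 < e -> (Hs_norm s f <= e%:E)%E ->
  (forall m n, (m + n <= Num.truncn s)%N -> exists g, is_wderiv (m, n) f g) ->
  WK (Num.truncn s) f /\ forall m n, (m + n <= Num.truncn s)%N ->
    \int[leb2]_(p in setT) (wderiv (m, n) f p ^+ 2) <= e ^+ 2.
Proof.
move=> e0 Ne ex.
have Hf : Hs s f.
  split; first by move=> [m n]; exact: ex.
  exact: le_lt_trans Ne (ltry _).
have Wf := Hs_WK Hf; split => // m n mnk.
have [_ [_ wi]] := Wf _ _ mnk.
have : (Hs_sqnorm s f <= (e ^+ 2)%:E)%E.
  have -> : Hs_sqnorm s f = (Hs_norm s f `^ 2)%E.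
    by rewrite /Hs_norm -poweRrM mulVf ?pnatr_eq0// poweRe1// Hs_sqnorm_ge0.
  apply: (@le_trans _ _ (e%:E `^ 2)%E); last by rewrite poweR_EFin powR_mulrn// ltW.
  apply: (@gt0_ler_poweR R 2 (ler0n _ _) (Hs_norm s f) e%:E) => //.
  - by rewrite in_itv/= poweR_ge0 leey.
  - by rewrite in_itv/= lee_fin ltW//= leey.
move/(le_trans (Hs_sqnorm_term f mnk)).
rewrite /Rintegral -lee_fin fineK//; exact: integrable_fin_num.
Qed.

Lemma is_wderivD al f g h k (c : R) : is_wderiv al f g -> is_wderiv al h k ->
  is_wderiv al (fun p => c * f p + h p) (fun p => c * g p + k p).
Proof.
have LD u v : L1loc u -> L1loc v -> L1loc (fun p => c * u p + v p).
  move=> /L1locP[mu bu] /L1locP[mv bv]; apply/L1locP; split.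
    by apply: measurable_funD => //; apply: measurable_funM => //; exact: measurable_cst.
  move=> N; apply: eq_integrable (intgD (intgZ c (bu N)) (bv N)) => // p _.
  by rewrite mulrDr mulrCA.
move=> [lf lg fg] [lh lk hk]; split; [exact: LD|exact: LD|move=> phi tphi].
have [sphi cphi] := tphi.
have [N N0 KN] := compact_sub_cbox cphi.
(* Vanishing is asserted on a neighbourhood of each point off the support, the form in which it
   survives derivation and so the induction on the order. *)
have U0 p : ~ closure [set p | phi p != 0] p -> forall be, \forall z \near p, pderiv be phi z = 0.
  move=> pK [m n].
  have H0 : \forall z \near p, phi z = 0.
    have : nbhs p (~` closure [set p | phi p != 0]).
      by apply: open_nbhs_nbhs; split => //; rewrite openC; exact: closed_closure.
    apply: filterS => z /= zK; apply/eqP; apply: contrapT => /negP zn0.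
    by apply: zK; exact: subset_closure.
  have dv (v : R * R) (u : R * R -> R) : (\forall z \near p, u z = 0) -> \forall z \near p, 'D_v u z = 0.
    move=> /near_join; apply: filterS => z u0.
    have h0 : is_derive z v (fun=> 0 : R) 0 by exact: is_derive_cst.
    have : is_derive z v u 0; last by case.
    by apply: (near_eq_is_derive _ h0); apply: filterS u0 => y ->.
  rewrite /pderiv/=; elim: m => [|m IH] /=; last exact: dv.
  by elim: n => [|n IH] /=; [exact: H0|exact: dv].
have tint u be : L1loc u -> intg leb2 (fun p => u p * pderiv be phi p).
  move=> lu; have cp : continuous (pderiv be phi).
    by move=> p; apply: differentiable_continuous; exact: sphi.
  have [M M0 HM] := compact_bounded_fun (@compact_cbox _ (-N) N (-N) N) cp.
  have p0 p : ~ cbox (-N) N (-N) N p -> pderiv be phi p = 0.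
    move=> pN; have pK : ~ closure [set p | phi p != 0] p by move/KN.
    exact: nbhs_singleton (U0 p pK be).
  apply: (@L1loc_mul _ u _ N M) => //; first exact: continuous_measurable2.
  move=> p; case: (pselect (cbox (-N) N (-N) N p)) => [|/p0 ->]; first exact: HM.
  by rewrite normr0.
have E (u v w : R * R -> R) : L1loc u -> L1loc v -> forall be,
    w = pderiv be phi ->
    \int[leb2]_(p in setT) ((c * u p + v p) * w p) =
    c * \int[leb2]_(p in setT) (u p * w p) + \int[leb2]_(p in setT) (v p * w p).
  move=> lu lv be ->; rewrite -RIZ; last exact: tint.
  rewrite -RID; [|by apply: intgZ; exact: tint|exact: tint].
  by apply: RI_eq => p; rewrite mulrDl mulrA.
rewrite (E _ _ _ lf lh al)// (E _ _ phi lg lk (0, 0)%N)// fg// hk//.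
by rewrite mulrDr mulrCA.
Qed.

End SobolevNorm.

(** * Almost everywhere equality and differentiable curves in H^s *)

Section Curves.
Context {R : realType}.
Notation R2 := (measurableTypeR R * measurableTypeR R)%type.
Implicit Types (f g h F G : R * R -> R) (s : R).

(** Measurability of [f] is included since it does not follow from almost everywhere equality; the
    other side is continuous in all uses. *)
Definition aeq f F := measurable_fun (setT : set R2) f /\ {ae leb2, forall p, f p = F p}.

Lemma aeq_refl F : continuous F -> aeq F F.
Proof. by move=> cF; split; [exact: continuous_measurable2|apply: aeW]. Qed.

Lemma aeqD f g F G : aeq f F -> aeq g G -> aeq (fun p => f p + g p) (fun p => F p + G p).
Proof.
move=> [mf fF] [mg gG]; split; first exact: measurable_funD.
by apply: aeS2 fF gG => p -> ->.
Qed.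

Lemma aeqM f g F G : aeq f F -> aeq g G -> aeq (fun p => f p * g p) (fun p => F p * G p).
Proof.
move=> [mf fF] [mg gG]; split; first exact: measurable_funM.
by apply: aeS2 fF gG => p -> ->.
Qed.

Lemma aeqZ f F (c : R) : aeq f F -> aeq (fun p => c * f p) (fun p => c * F p).
Proof. by apply: aeqM; apply: aeq_refl => p; exact: cvg_cst. Qed.

Lemma aeqB f g F G : aeq f F -> aeq g G -> aeq (fun p => f p - g p) (fun p => F p - G p).
Proof.
move=> [mf fF] [mg gG]; split; first exact: measurable_funB.
by apply: aeS2 fF gG => p -> ->.
Qed.

(** With the algebraic rules above, this matches an expression in weak derivatives with its
    classical counterpart by following its syntax. *)
Lemma aeq_wderiv_x f F dF : aeq f F -> hasdx F dF -> aeq (wderiv (1, 0)%N f) dF.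
Proof.
move=> [mf fF] HF; have H := classical_wderiv_x mf HF fF; split.
- exact: L1loc_measurable (wderiv_L1loc H).
- exact: wderiv_ae H.
Qed.

Lemma aeq_wderiv_y f F dF : aeq f F -> hasdy F dF -> aeq (wderiv (0, 1)%N f) dF.
Proof.
move=> [mf fF] HF; have H := classical_wderiv_y mf HF fF; split.
- exact: L1loc_measurable (wderiv_L1loc H).
- exact: wderiv_ae H.
Qed.

Lemma truncn9 s : 9 <= s -> (9 <= Num.truncn s)%N.
Proof. by move=> s9; rewrite truncn_ge_nat// (le_trans _ s9)// ler0n. Qed.

Lemma WK_aeq k f m n : WK k f -> (m + n + 6 <= k)%N -> aeq (wderiv (m, n) f) (rep f m n).
Proof.
move=> Wf mn; split; last exact: rep_ae Wf mn.
by apply: L1loc_measurable; apply: (WK_L1loc Wf); lia.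
Qed.

Lemma wderiv00 f : L1loc f -> is_wderiv (0, 0)%N f f.
Proof. by move=> lf; split => // phi _; rewrite expr0 mul1r. Qed.

Lemma WK_aeq0 k f : WK k f -> (6 <= k)%N -> aeq f (rep f 0 0).
Proof.
move=> Wf k6; have [m00 e00] : aeq (wderiv (0, 0)%N f) (rep f 0 0) by apply: WK_aeq Wf _.
have [lf _ _] : is_wderiv (0, 0)%N f (wderiv (0, 0)%N f) by have [] := Wf 0%N 0%N isT.
split; first exact: L1loc_measurable.
by apply: aeS2 (wderiv_ae (wderiv00 lf)) e00 => p <-.
Qed.

Lemma Hs_rep s f : 9 <= s -> Hs s f -> TL 3 (rep f 0 0) /\ aeq f (rep f 0 0).
Proof.
move=> /truncn9 s9 /Hs_WK Wf; split; first by apply: rep_TL Wf _.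
by apply: WK_aeq0 Wf _; lia.
Qed.

Lemma cvge0_le (X : Type) (FF : set_system X) (N : X -> \bar R) (e : R) : Filter FF ->
  N x @[x --> FF] --> 0%E -> 0 < e -> \forall x \near FF, (N x <= e%:E)%E.
Proof.
move=> fF N0 e0; have : nbhs (0%E : \bar R) [set y | (y < e%:E)%E].
  by apply: open_nbhs_nbhs; split; [exact: open_ereal_lt_ereal|rewrite /= lte_fin].
by move=> /N0 H; apply: (@filterS _ FF fF _ _ _ H) => x; exact: ltW.
Qed.

(** The error q of the difference quotient has small norm in H^s, so its representative and first
    derivatives are small; that representative is in turn the error of the difference quotient of
    the representatives. *)
Lemma C1_Hs_rep T s (F F' : R -> R * R -> R) t (e : R) : 9 <= s ->
  C1_Hs T s F F' -> t \in `[0, T] -> 0 < e ->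
  \forall r \near within `[0, T] t^',
  [/\ forall p, `|(r - t)^-1 * (rep (F r) 0 0 p - rep (F t) 0 0 p)
                  - rep (F' t) 0 0 p| <= e,
      \int[leb2]_(p in setT) (((r - t)^-1 * (rep (F r) 0 0 p - rep (F t) 0 0 p)
         - rep (F' t) 0 0 p) ^+ 2) <= e ^+ 2,
      \int[leb2]_(p in setT) (((r - t)^-1 * (dx (rep (F r) 0 0) p - dx (rep (F t) 0 0) p)
         - dx (rep (F' t) 0 0) p) ^+ 2) <= e ^+ 2 &
      \int[leb2]_(p in setT) (((r - t)^-1 * (dy (rep (F r) 0 0) p - dy (rep (F t) 0 0) p)
         - dy (rep (F' t) 0 0) p) ^+ 2) <= e ^+ 2].
Proof.
move=> s9 C1 tT e0; have [C C0 HC] := @rep_bounded R.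
have [Ht Ht' Hcv _] := C1 _ tT.
have k9 := truncn9 s9; set k := Num.truncn s in k9.
(* This d satisfies both C d <= e, for the sup bound, and d <= e, for the L^2 bounds. *)
pose d := e / (C + 1).
have C10 : 0 < C + 1 by rewrite ltr_wpDl.
have d0 : 0 < d by rewrite divr_gt0.
have dC : C * d <= e.
  by rewrite /d mulrA ler_pdivrMr// mulrC ler_pM2l// lerDl.
have de : d <= e by rewrite /d ler_pdivrMr// ler_peMr ?lerDr// ltW.
have Hn := cvge0_le _ Hcv d0.
have inT : \forall r \near within `[0, T] t^', `[0, T]%classic r by exact: withinT.
apply: filterS2 inT (Hn _) => r rT Nr.
have [Hr _ _ _] := C1 r rT.
pose q p := (r - t)^-1 * (F r p - F t p) - F' t p.
have exq m n : (m + n <= k)%N -> exists g, is_wderiv (m, n) q g.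
  move=> mn; have [[gr Gr] [gt Gt] [g' G']] : [/\ exists g, is_wderiv (m, n) (F r) g,
      exists g, is_wderiv (m, n) (F t) g & exists g, is_wderiv (m, n) (F' t) g].
    by split; [case: Hr|case: Ht|case: Ht'] => /(_ (m, n) mn).
  (* is_wderivD scales only its first argument, hence -F' = -2 F' + F'. *)
  exists (fun p => (- 2) * g' p + ((r - t)^-1 * ((- 1) * gt p + gr p) + g' p)).
  have := is_wderivD (- 2) G' (is_wderivD (r - t)^-1 (is_wderivD (- 1) Gt Gr) G').
  by congr is_wderiv; apply/funext => p; rewrite /q; ring.
have [Wq Bq] : WK k q /\ forall m n, (m + n <= k)%N ->
    \int[leb2]_(p in setT) (wderiv (m, n) q p ^+ 2) <= d ^+ 2 := Hs_norm_small d0 Nr exq.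
have aq := WK_aeq0 Wq (leq_trans _ k9).
have [tr ar] := Hs_rep s9 Hr; have [tt att] := Hs_rep s9 Ht.
have [tt' at'] := Hs_rep s9 Ht'.
have lin (c : R) f g h df dg dh : hasdx f df -> hasdx g dg -> hasdx h dh ->
  hasdx (fun p => c * (f p - g p) - h p) (fun p => c * (df p - dg p) - dh p).
  move=> Hf Hg Hh.
  have := hasdxD (hasdxZ c (hasdxD Hf (hasdxZ (- 1) Hg))) (hasdxZ (- 1) Hh).
  by congr hasdx; apply/funext => p; rewrite !mulN1r.
have liny (c : R) f g h df dg dh : hasdy f df -> hasdy g dg -> hasdy h dh ->
  hasdy (fun p => c * (f p - g p) - h p) (fun p => c * (df p - dg p) - dh p).
  move=> Hf Hg Hh.
  have := hasdyD (hasdyZ c (hasdyD Hf (hasdyZ (- 1) Hg))) (hasdyZ (- 1) Hh).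
  by congr hasdy; apply/funext => p; rewrite !mulN1r.
have Hx := lin (r - t)^-1 _ _ _ _ _ _ (TL_hasdx tr) (TL_hasdx tt) (TL_hasdx tt').
have Hy := liny (r - t)^-1 _ _ _ _ _ _ (TL_hasdy tr) (TL_hasdy tt) (TL_hasdy tt').
(* Since [wderiv] is a choice, [rep] is not linear by definition; linearity comes from the
   uniqueness of the continuous representative. *)
have qE : rep q 0 0 = fun p => (r - t)^-1 * (rep (F r) 0 0 p - rep (F t) 0 0 p)
    - rep (F' t) 0 0 p.
  apply: continuous_ae_eq.
  - by apply: rep_continuous Wq _; lia.
  - by case: Hx.
  - have [_ a1] := aq isT.
    have [_ a2] := aeqB (aeqZ (r - t)^-1 (aeqB ar att)) at'.
    by apply: aeS2 a1 a2 => p <-.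
have B m n : (m + n <= 1)%N -> \int[leb2]_(p in setT) (rep q m n p ^+ 2) <= e ^+ 2.
  move=> mn; have mn9 : (m + n + 6 <= k)%N by lia.
  have [m1 a1] := WK_aeq Wq mn9.
  apply: (@le_trans _ _ (d ^+ 2)); last by rewrite lerXn2r// nnegrE ltW.
  have -> : \int[leb2]_(p in setT) (rep q m n p ^+ 2) =
      \int[leb2]_(p in setT) (wderiv (m, n) q p ^+ 2).
    apply: RI_ae; do ?[exact: measurable_funX].
    - apply: measurable_funX; apply: continuous_measurable2; exact: rep_continuous Wq _.
    - by apply: aeS a1 => p ->.
  by apply: Bq; lia.
have rx := rep_hasdx (m := 0) (n := 0) Wq (leq_trans _ k9).
have ry := rep_hasdy (m := 0) (n := 0) Wq (leq_trans _ k9).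
have ex := hasdx_dx (rx isT); rewrite qE (hasdx_dx Hx) in ex.
have ey := hasdy_dy (ry isT); rewrite qE (hasdy_dy Hy) in ey.
split.
- move=> p; have := HC k q 0%N 0%N d Wq (leq_trans _ k9) d0 Bq p.
  by rewrite qE => h; apply: le_trans (h isT) dC.
- by have := B 0%N 0%N isT; rewrite qE.
- by have := B 1%N 0%N isT; rewrite -ex.
- by have := B 0%N 1%N isT; rewrite -ey.
Qed.

End Curves.

(** * Symmetry of second derivatives *)

Section MixedDerivatives.
Context {R : realType}.
Implicit Types (f : R * R -> R).

Lemma mean_value (g dg : R -> R) (x h : R) : (forall z, is_derive z (1 : R) g (dg z)) ->
  exists2 z, `|z - x| <= `|h| & g (x + h) - g x = dg z * h.
Proof.
move=> gdg; have cg : continuous g.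
  by move=> z; apply: differentiable_continuous; apply/derivable1_diffP; have [] := gdg z.
have [h0|h0] := leP 0 h.
- have le : x <= x + h by rewrite lerDl.
  have [z zI E] := MVT_segment le (fun z _ => gdg z) (continuous_subspaceT cg).
  exists z; last by rewrite E addrAC subrr add0r.
  by move: zI; rewrite in_itv/= => /andP[z1 z2]; rewrite !ger0_norm; lra.
- have le : x + h <= x by rewrite gerDl ltW.
  have [z zI E] := MVT_segment le (fun z _ => gdg z) (continuous_subspaceT cg).
  exists z; last first.
    by apply/eqP; rewrite -eqr_opp opprB E; apply/eqP; ring.
  by move: zI; rewrite in_itv/= => /andP[z1 z2]; rewrite !ler0_norm; lra.
Qed.

Lemma is_derive_le (g : R -> R) (x d M : R) : is_derive x (1 : R) g d ->
  (\forall h \near (0 : R), `|g (h + x) - g x| <= M * `|h|) -> `|d| <= M.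
Proof.
move=> [gd gv] gM.
have L : `|h^-1 *: (g (h *: (1 : R) + x) - g x)| @[h --> (0 : R)^'] --> `|d|.
  apply: cvg_norm; rewrite -gv; exact: gd.
apply: (ler_cvg_to L (cvg_cst M)); near=> h.
have h0 : h != 0 by near: h; exact: nbhs_dnbhs_neq.
rewrite normrM normfV ler_pdivrMl ?normr_gt0// [leRHS]mulrC [h *: _]mulr1.
near: h; exact: cvg_within.
Unshelve. all: by end_near. Qed.

Lemma le_is_derive (g : R -> R) (x d : R) :
  (forall e, 0 < e -> \forall h \near (0 : R), `|g (h + x) - g x - h * d| <= e * `|h|) ->
  is_derive x (1 : R) g d.
Proof.
move=> H.
have L : h^-1 *: (g (h *: (1 : R) + x) - g x) @[h --> 0^'] --> d.
  apply/cvgrPdist_le => e e0; near=> h.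
  have h0 : h != 0 by near: h; exact: nbhs_dnbhs_neq.
  have -> : d - h^-1 *: (g (h *: (1 : R) + x) - g x) = - (h^-1 * (g (h + x) - g x - h * d)).
    by rewrite mulrBr mulrA mulVf// mul1r opprB [h *: _]mulr1.
  rewrite normrN normrM normfV ler_pdivrMl ?normr_gt0// [leRHS]mulrC.
  by near: h; apply: cvg_within; exact: H.
apply: DeriveDef; first by apply/cvg_ex; exists d.
exact/cvg_lim.
Unshelve. all: by end_near. Qed.

(* pderiv gives the mixed derivatives in one order only; a double mean value
   argument yields the other order. *)
Lemma schwarz f fx fy fxy : (forall p, is_derive p ((1, 0) : R * R) f (fx p)) ->
  (forall p, is_derive p ((0, 1) : R * R) f (fy p)) -> hasdx fy fxy ->
  forall p, is_derive p ((0, 1) : R * R) fx (fxy p).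
Proof.
move=> Hx Hy [_ cfxy Hxy] [x y]; apply/is_derive_y; apply: le_is_derive => e e0.
have /nbhs_ballP[d /= d0 Hd] : \forall z \near (x, y), `|fxy (x, y) - fxy z| <= e.
  by have /cvgrPdist_le := cfxy (x, y); apply.
have small : \forall k \near (0 : R), `|k| < d.
  exact: nbhs0_lt.
apply: (filterS _ small) => k kd.
have H0 : is_derive x (1 : R) (fun s => f (s, k + y) - f (s, y) - (s - x) * (k * fxy (x, y)))
    (fx (x, k + y) - fx (x, y) - k * fxy (x, y)).
  have h1 : is_derive x (1 : R) (fun s => f (s, k + y)) (fx (x, k + y)) by exact/is_derive_x.
  have h2 : is_derive x (1 : R) (fun s => f (s, y)) (fx (x, y)) by exact/is_derive_x.
  have h3 : is_derive x (1 : R) (fun s => (s - x) * (k * fxy (x, y))) (k * fxy (x, y)).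
    have i1 : is_derive x (1 : R) (fun s => s - x) (1 - 0) by exact: is_deriveB.
    have i2 : is_derive x (1 : R) (fun=> k * fxy (x, y)) 0 by exact: is_derive_cst.
    apply: (is_derive_eq (is_deriveM i1 i2)).
    by rewrite /GRing.scale/=; ring.
  exact: (is_deriveB (is_deriveB h1 h2) h3).
apply: (is_derive_le H0); apply: (filterS _ small) => h hd.
have [t tk Et] := @mean_value (fun t => f (h + x, t) - f (x, t))
  (fun t => fy (h + x, t) - fy (x, t)) y k (fun z => is_deriveB
    (iffLR (is_derive_y _ _ _ _) (Hy _)) (iffLR (is_derive_y _ _ _ _) (Hy _))).
have [s sh Es] := @mean_value (fun s => fy (s, t)) (fun s => fxy (s, t)) x h
  (fun z => iffLR (is_derive_x _ _ _ _) (Hxy _)).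
have -> : f (h + x, k + y) - f (h + x, y) - (h + x - x) * (k * fxy (x, y)) -
    (f (x, k + y) - f (x, y) - (x - x) * (k * fxy (x, y))) =
    (fxy (s, t) - fxy (x, y)) * h * k.
  rewrite (addrC k y); move: Et; rewrite (addrC h x) Es => Et.
  have -> : f (x + h, y + k) = fxy (s, t) * h * k + (f (x + h, y) - f (x, y))
      + f (x, y + k) by rewrite -Et; ring.
  ring.
rewrite !normrM mulrAC ler_wpM2r// ler_wpM2r// distrC; apply: Hd.
by split; rewrite /= -ball_normE /= distrC; [exact: le_lt_trans sh hd|exact: le_lt_trans tk kd].
Qed.

(** Among the derivatives of order at most 2 only [dy (dx f)] is not literally a [pderiv]; Schwarz's
    theorem identifies it with [pderiv (1, 1) f]. *)
Lemma smooth_bounded_TB2 f : smooth_bounded f -> TB 2 f.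
Proof.
move=> [sf bf].
have cont al : continuous (pderiv al f).
  by move=> p; apply: differentiable_continuous; exact: sf.
have Dx m n p : is_derive p ((1, 0) : R * R) (pderiv (m, n) f) (pderiv (m.+1, n) f p).
  by apply/derivableP/diff_derivable; exact: sf.
have Dy n p : is_derive p ((0, 1) : R * R) (pderiv (0, n)%N f) (pderiv (0, n.+1)%N f p).
  by apply/derivableP/diff_derivable; exact: (sf (0, n)%N).
have hx m n : hasdx (pderiv (m, n) f) (pderiv (m.+1, n) f) by split; [exact: cont|exact: cont|exact: Dx].
have hy n : hasdy (pderiv (0, n)%N f) (pderiv (0, n.+1)%N f)
  by split; [exact: cont|exact: cont|exact: Dy].
have hxy : hasdy (pderiv (1, 0)%N f) (pderiv (1, 1)%N f).
  split; [exact: cont|exact: cont|].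
  exact: (@schwarz (pderiv (0, 0)%N f) (pderiv (1, 0)%N f) (pderiv (0, 1)%N f)
    (pderiv (1, 1)%N f) (Dx 0 0)%N (Dy 0)%N (hx 0 1)%N).
have t0 al : TB 0 (pderiv al f) by split; [exact: cont|exact: bf|].
apply: (towerS _ (hx 0 0)%N (hy 0)%N); first exact: bf (0, 0)%N.
- by apply: (towerS _ (hx 1 0)%N hxy); [exact: bf|exact: t0|exact: t0].
- by apply: (towerS _ (hx 0 1)%N (hy 1)%N); [exact: bf|exact: t0|exact: t0].
Qed.

End MixedDerivatives.

Opaque TB TL.
(** * The energy identity at a fixed time *)

Section SpatialIdentity.
Context {R : realType}.
Notation R2 := (measurableTypeR R * measurableTypeR R)%type.
Implicit Types (f g h F G : R * R -> R).

(** Integrability is bundled with the vanishing because a real integral may be 0 by default. *)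
Definition null_integral f := intg leb2 f /\ \int[leb2]_(p in setT) f p = 0.

Lemma null_integralD f g : null_integral f -> null_integral g ->
  null_integral (fun p => f p + g p).
Proof. by move=> [fi f0] [gi g0]; split; [exact: intgD|rewrite RID// f0 g0 addr0]. Qed.

Lemma null_integralZ f (k : R) : null_integral f -> null_integral (fun p => k * f p).
Proof. by move=> [fi f0]; split; [exact: intgZ|rewrite RIZ// f0 mulr0]. Qed.

Lemma null_dx F dF G dG : hasdx F dF -> hasdx G dG -> L2 F -> L2 dF -> L2 G -> L2 dG ->
  null_integral (fun p => F p * dG p + dF p * G p).
Proof.
move=> HF HG LF LdF LG LdG.
have i : intg leb2 (fun p => F p * dG p + dF p * G p) by apply: intgD; exact: L2M.
by split => //; apply: (integral_dx0 (hasdx_mul HF HG)) => //; exact: L2M.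
Qed.

Lemma null_dy F dF G dG : hasdy F dF -> hasdy G dG -> L2 F -> L2 dF -> L2 G -> L2 dG ->
  null_integral (fun p => F p * dG p + dF p * G p).
Proof.
move=> HF HG LF LdF LG LdG.
have i : intg leb2 (fun p => F p * dG p + dF p * G p) by apply: intgD; exact: L2M.
by split => //; apply: (integral_dy0 (hasdy_mul HF HG)) => //; exact: L2M.
Qed.

Lemma TL_null_dx F G : TL 1 F -> TL 1 G ->
  null_integral (fun p => F p * dx G p + dx F p * G p).
Proof.
move=> tF tG; exact: null_dx (TL_hasdx tF) (TL_hasdx tG) (TL_L2 tF)
  (TL_L2 (TL_dx tF)) (TL_L2 tG) (TL_L2 (TL_dx tG)).
Qed.

Lemma TL_null_dy F G : TL 1 F -> TL 1 G ->
  null_integral (fun p => F p * dy G p + dy F p * G p).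
Proof.
move=> tF tG; exact: null_dy (TL_hasdy tF) (TL_hasdy tG) (TL_L2 tF)
  (TL_L2 (TL_dy tF)) (TL_L2 tG) (TL_L2 (TL_dy tG)).
Qed.

Lemma TBD k F G : TB k F -> TB k G -> TB k (fun p => F p + G p).
Proof. by apply: towerD; exact: bounded_fctD. Qed.

Lemma TLB k F G : TL k F -> TL k G -> TL k (fun p => F p - G p).
Proof.
move=> tF tG; have := TLD tF (TLZ (- 1) tG).
by congr TL; apply/funext => p; rewrite mulN1r.
Qed.

(* x1, y1 (x2, y2) are the x- (y-) derivatives of the two parts of the flux, S1 + S2
   and T1 + T2 are div (D^2 grad eta) and div (D^2 u_t); every summand on the right
   has the form F dG + dF G. *)
Lemma energy_algebra (eps s2 a c d N N' A A' B B' D D2 D3 Nx Ny N'x N'y Ax' By' V Gx Gy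
    x1 x2 y1 y2 S1 S2 T1 T2 : R) :
  N' + (x1 + x2) + s2 * (y1 + y2) = 0 ->
  N * N' + (D + eps * N) * (A * A' + B * B') + eps / 2 * N' * (A ^+ 2 + B ^+ 2)
   - s2 * (c * D2 * (Nx * N'x + Ny * N'y) + a * D3 * V * (Ax' + By')) =
  (- 1) * (((N + eps / 2 * (A ^+ 2 + B ^+ 2) + s2 * (c * (S1 + S2) - d * (T1 + T2)))
              * (x1 + s2 * y1)
            + - A' * ((D + eps * N) * A + s2 * (a * Gx - d * D2 * N'x)))
         + ((N + eps / 2 * (A ^+ 2 + B ^+ 2) + s2 * (c * (S1 + S2) - d * (T1 + T2)))
              * (x2 + s2 * y2)
            + - B' * ((D + eps * N) * B + s2 * (a * Gy - d * D2 * N'y))))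
  + (- s2) * (c * ((N' * S1 + N'x * (D2 * Nx)) + (N' * S2 + N'y * (D2 * Ny)))
    + (a * ((A' * Gx + Ax' * (D3 * V)) + (B' * Gy + By' * (D3 * V)))
    + (- d) * ((N' * T1 + N'x * (D2 * A')) + (N' * T2 + N'y * (D2 * B'))))).
Proof.
move=> E; have -> : x1 = - N' - x2 - s2 * (y1 + y2) by lra.
by field.
Qed.

Section Identity.
Variables (eps sigma a c d : R) (D N A B N' A' B' : R * R -> R).
Hypotheses (tD : TB 2 D) (tN : TL 3 N) (tA : TL 3 A) (tB : TL 3 B).
Hypotheses (tN' : TL 3 N') (tA' : TL 3 A') (tB' : TL 3 B').

(** In terms of these functions the flux is (X1 + sigma^2 Y1, X2 + sigma^2 Y2) and the potential is
    N + (eps / 2) M + sigma^2 Z; [G] is D^3 div u. *)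
Let V p := dx A p + dy B p.
Let X1 p := (D p + eps * N p) * A p.
Let X2 p := (D p + eps * N p) * B p.
Let G p := D p ^+ 3 * V p.
Let Y1 p := a * dx G p - d * D p ^+ 2 * dx N' p.
Let Y2 p := a * dy G p - d * D p ^+ 2 * dy N' p.
Let M p := A p ^+ 2 + B p ^+ 2.
Let S p := dx (fun q => D q ^+ 2 * dx N q) p + dy (fun q => D q ^+ 2 * dy N q) p.
Let T p := dx (fun q => D q ^+ 2 * A' q) p + dy (fun q => D q ^+ 2 * B' q) p.
Let Z p := c * S p - d * T p.

Hypothesis mass : forall p, N' p + (dx X1 p + dy X2 p) + sigma ^+ 2 * (dx Y1 p + dy Y2 p) = 0.
Hypothesis mom1 : forall p, A' p + dx N p + eps / 2 * dx M p + sigma ^+ 2 * dx Z p = 0.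
Hypothesis mom2 : forall p, B' p + dy N p + eps / 2 * dy M p + sigma ^+ 2 * dy Z p = 0.

(** A count of orders: three derivatives of the unknowns and two of [D] leave [Y1], [Y2] and [Z] one
    derivative, as the equations require. *)
Lemma identity_towers : [/\ TL 2 X1, TL 2 X2, TL 2 V & TL 2 G] /\
  [/\ TL 1 Y1, TL 1 Y2, TL 3 M & TL 1 Z].
Proof.
have tD2 : TB 2 (fun p => D p ^+ 2) by apply: TBM.
have tD3 : TB 2 (fun p => D p ^+ 3).
  by have := TBM tD tD2; congr TB; apply/funext => p; rewrite -exprS.
have tDN : TB 2 (fun p => D p + eps * N p) := TBD tD (TL_TB (TLZ eps (TLW tN))).
have tX1 : TL 2 X1 := TBL tDN (TLW tA).
have tX2 : TL 2 X2 := TBL tDN (TLW tB).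
have tV : TL 2 V := TLD (TL_dx tA) (TL_dy tB).
have tG : TL 2 G := TBL tD3 tV.
have tD1 := TBW tD2.
have tdD : TB 1 (fun p => d * D p ^+ 2) := TBM (TB_cst 1 d) tD1.
split; split; [exact: tX1|exact: tX2|exact: tV|exact: tG|..].
- exact: TLB (TLZ a (TL_dx tG)) (TBL tdD (TLW (TL_dx tN'))).
- exact: TLB (TLZ a (TL_dy tG)) (TBL tdD (TLW (TL_dy tN'))).
- exact: TLD (TLM tA tA) (TLM tB tB).
- exact: (TLB
    (TLZ c (TLD (TL_dx (TBL tD2 (TL_dx tN))) (TL_dy (TBL tD2 (TL_dy tN)))))
    (TLZ d (TLD (TL_dx (TBL tD2 (TLW tA'))) (TL_dy (TBL tD2 (TLW tB')))))).
Qed.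

Lemma spatial_identity : null_integral (fun p => N p * N' p
  + (D p + eps * N p) * (A p * A' p + B p * B' p)
  + eps / 2 * N' p * (A p ^+ 2 + B p ^+ 2)
  - sigma ^+ 2 * (c * D p ^+ 2 * (dx N p * dx N' p + dy N p * dy N' p)
                  + a * D p ^+ 3 * V p * (dx A' p + dy B' p))).
Proof.
have [[tX1 tX2 tV tG] [tY1 tY2 tM tZ]] := identity_towers.
have tD2 : TB 2 (fun p => D p ^+ 2) by apply: TBM.
have tDNx : TL 2 (fun p => D p ^+ 2 * dx N p) := TBL tD2 (TL_dx tN).
have tDNy : TL 2 (fun p => D p ^+ 2 * dy N p) := TBL tD2 (TL_dy tN).
have tDA' : TL 2 (fun p => D p ^+ 2 * A' p) := TBL tD2 (TLW tA').
have tDB' : TL 2 (fun p => D p ^+ 2 * B' p) := TBL tD2 (TLW tB').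
pose P p := N p + eps / 2 * M p + sigma ^+ 2 * Z p.
(* The momentum equation identifies the gradient of the potential with - u_t, which also provides
   its square integrability. *)
have Px : hasdx P (fun p => - A' p).
  have := hasdxD (hasdxD (TL_hasdx tN) (hasdxZ (eps / 2) (TL_hasdx tM)))
    (hasdxZ (sigma ^+ 2) (TL_hasdx tZ)).
  by congr hasdx; apply/funext => p; have := mom1 p; lra.
have Py : hasdy P (fun p => - B' p).
  have := hasdyD (hasdyD (TL_hasdy tN) (hasdyZ (eps / 2) (TL_hasdy tM)))
    (hasdyZ (sigma ^+ 2) (TL_hasdy tZ)).
  by congr hasdy; apply/funext => p; have := mom2 p; lra.
have LP : L2 P.
  exact: L2D (L2D (TL_L2 tN) (L2Z _ (TL_L2 tM))) (L2Z _ (TL_L2 tZ)).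
have Q1x := hasdxD (TL_hasdx tX1) (hasdxZ (sigma ^+ 2) (TL_hasdx tY1)).
have Q2y := hasdyD (TL_hasdy tX2) (hasdyZ (sigma ^+ 2) (TL_hasdy tY2)).
have J1 := null_dx Px Q1x LP (L2N (TL_L2 tA'))
  (L2D (TL_L2 tX1) (L2Z _ (TL_L2 tY1)))
  (L2D (TL_L2 (TL_dx tX1)) (L2Z _ (TL_L2 (TL_dx tY1)))).
have J2 := null_dy Py Q2y LP (L2N (TL_L2 tB'))
  (L2D (TL_L2 tX2) (L2Z _ (TL_L2 tY2)))
  (L2D (TL_L2 (TL_dy tX2)) (L2Z _ (TL_L2 (TL_dy tY2)))).
have tN1 := TLW (TLW tN'); have tA1 := TLW (TLW tA'); have tB1 := TLW (TLW tB').
have K := null_integralD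
  (null_integralZ (- 1) (null_integralD J1 J2))
  (null_integralZ (- (sigma ^+ 2)) (null_integralD
    (null_integralZ c (null_integralD (TL_null_dx tN1 (TLW tDNx)) (TL_null_dy tN1 (TLW tDNy))))
    (null_integralD
    (null_integralZ a (null_integralD (TL_null_dx tA1 (TLW tG)) (TL_null_dy tB1 (TLW tG))))
    (null_integralZ (- d) (null_integralD (TL_null_dx tN1 (TLW tDA')) (TL_null_dy tN1 (TLW tDB'))))))).
move: K; congr null_integral; apply/funext => p; symmetry.
exact: energy_algebra (mass p).
Qed.

End Identity.

End SpatialIdentity.
(** * Differentiation in time *)

Section TimeDerivative.
Context {R : realType}.
Notation R2 := (measurableTypeR R * measurableTypeR R)%type.
Variables (T t : R).
Hypothesis tT : t \in `[0, T].
Implicit Types (f g : R -> R * R -> R) (df dg m : R * R -> R).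

Definition quotient_error f df (r : R) (p : R * R) : R :=
  (r - t)^-1 * (f r p - f t p) - df p.

(** Differentiability at the fixed time t as a curve in L^2. The filter within [0, T] makes the
    derivative one-sided at the ends. *)
Definition L2_derivative f df := [/\ forall r, r \in `[0, T] -> L2 (f r), L2 df &
  forall e, 0 < e -> \forall r \near within `[0, T] t^',
    \int[leb2]_(p in setT) (quotient_error f df r p ^+ 2) <= e ^+ 2].

Definition sup_derivative f df := forall e, 0 < e -> \forall r \near within `[0, T] t^',
  forall p, `|quotient_error f df r p| <= e.

Lemma near_domain (d : R) : 0 < d -> \forall r \near within `[0, T] t^',
  [/\ r \in `[0, T], r != t & `|r - t| <= d].
Proof.
move=> d0; near=> r; split.
- by near: r; exact: withinT.
- by near: r; rewrite near_withinE; near=> r => _; near: r; exact: nbhs_dnbhs_neq.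
- near: r; apply: (@cvg_within _ (dnbhs t)); apply: (@cvg_within _ (nbhs t)).
  have /cvgrPdist_le/(_ _ d0) := @cvg_id _ (nbhs t).
  by apply: filterS => r; rewrite distrC.
Unshelve. all: by end_near. Qed.

Lemma quotient_error_L2 f df r : (forall r, r \in `[0, T] -> L2 (f r)) -> L2 df ->
  r \in `[0, T] -> L2 (quotient_error f df r).
Proof. by move=> Lf Ldf rT; apply: L2B => //; apply: L2Z; apply: L2B; exact: Lf. Qed.

(** With h = r - t and errors u, v one has f r = f t + h (df + u) and g r = g t + h (dg + v). In the
    expanded product every term beyond the limit contains u, v or a factor h, and Cauchy-Schwarz
    bounds it. *)
Lemma L2_derivative_pairing f df g dg : L2_derivative f df -> L2_derivative g dg ->
  (r - t)^-1 * (\int[leb2]_(p in setT) (f r p * g r p) -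
     \int[leb2]_(p in setT) (f t p * g t p)) @[r --> within `[0, T] t^'] -->
  \int[leb2]_(p in setT) (df p * g t p + f t p * dg p).
Proof.
move=> [Lf Ldf Hf] [Lg Ldg Hg]; have Lft := Lf t tT; have Lgt := Lg t tT.
pose sq (h : R * R -> R) := \int[leb2]_(p in setT) (h p ^+ 2).
(* Adding 1 gives M <= M^2, so each integral of squares is at most M^2, the form that
   [cauchy_schwarz] takes. *)
pose M := 1 + sq (f t) + sq df + sq (g t) + sq dg.
have [s1 s2 s3 s4] := And4 (RI_sqr_ge0 (f t)) (RI_sqr_ge0 df) (RI_sqr_ge0 (g t)) (RI_sqr_ge0 dg).
have M1 : 1 <= M by rewrite /M /sq; lra.
have M0 : 0 < M by lra.
have HM : [/\ sq (f t) <= M ^+ 2, sq df <= M ^+ 2, sq (g t) <= M ^+ 2 & sq dg <= M ^+ 2].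
  have MM : M <= M ^+ 2 by rewrite expr2; nra.
  by split; apply: le_trans MM; rewrite /M /sq; lra.
have [B1 B2 B3 B4] := HM.
apply/cvgrPdist_le => e e0.
pose K := 1 + 4 * M + M ^+ 2.
have K0 : 0 < K by rewrite /K; have := sqr_ge0 M; lra.
pose d := Num.min 1 (e / K).
have d0 : 0 < d by rewrite lt_min ltr01/= divr_gt0.
have d1 : d <= 1 by rewrite ge_min lexx.
have dK : d * K <= e by rewrite -ler_pdivlMr// ge_min lexx orbT.
near=> r.
have [rT rt hd] : [/\ r \in `[0, T], r != t & `|r - t| <= d].
  by near: r; exact: near_domain.
have uf : sq (quotient_error f df r) <= d ^+ 2 by near: r; exact: Hf.
have vg : sq (quotient_error g dg r) <= d ^+ 2 by near: r; exact: Hg.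
set u := quotient_error f df r in uf; set v := quotient_error g dg r in vg.
have Lu : L2 u by exact: quotient_error_L2.
have Lv : L2 v by exact: quotient_error_L2.
set h := r - t in hd; have h0 : h != 0 by rewrite subr_eq0.
have -> : h^-1 * (\int[leb2]_(p in setT) (f r p * g r p) -
     \int[leb2]_(p in setT) (f t p * g t p)) =
  \int[leb2]_(p in setT) (df p * g t p + f t p * dg p) +
  (\int[leb2]_(p in setT) (u p * g t p) + \int[leb2]_(p in setT) (f t p * v p) +
   h * (\int[leb2]_(p in setT) (u p * v p) + \int[leb2]_(p in setT) (df p * v p) +
        \int[leb2]_(p in setT) (u p * dg p) + \int[leb2]_(p in setT) (df p * dg p))).
  have [Lfr Lgr] := conj (Lf r rT) (Lg r rT).
  rewrite -RIB; [|exact: L2M..]; rewrite -RIZ; last by apply: intgB; exact: L2M.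
  have i1 : intg leb2 (fun p => df p * g t p + f t p * dg p) by apply: intgD; exact: L2M.
  have i2 : intg leb2 (fun p => u p * g t p + f t p * v p) by apply: intgD; exact: L2M.
  have i3 : intg leb2 (fun p => u p * v p + df p * v p) by apply: intgD; exact: L2M.
  have i4 : intg leb2 (fun p => u p * v p + df p * v p + u p * dg p).
    by apply: intgD => //; exact: L2M.
  have i5 : intg leb2 (fun p => u p * v p + df p * v p + u p * dg p + df p * dg p).
    by apply: intgD => //; exact: L2M.
  rewrite -(RID (L2M Lu Lgt) (L2M Lft Lv)) -(RID (L2M Lu Lv) (L2M Ldf Lv)).
  rewrite -(RID i3 (L2M Lu Ldg)) -(RID i4 (L2M Ldf Ldg)) -(RIZ h i5).
  rewrite -(RID i2 (intgZ h i5)) -(RID i1); last by apply: intgD => //; exact: intgZ.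
  by apply: RI_eq => p; rewrite /u /v /quotient_error -/h; field.
rewrite opprD addrA subrr add0r normrN.
have C1 := cauchy_schwarz Lu Lgt d0 M0 uf B3.
have C2 := cauchy_schwarz Lft Lv M0 d0 B1 vg.
have C3 := cauchy_schwarz Lu Lv d0 d0 uf vg.
have C4 := cauchy_schwarz Ldf Lv M0 d0 B2 vg.
have C5 := cauchy_schwarz Lu Ldg d0 M0 uf B4.
have C6 := cauchy_schwarz Ldf Ldg M0 M0 B2 B4.
apply: le_trans dK; rewrite /K.
apply: (@le_trans _ _ (d * M + M * d + d * (d * d + M * d + d * M + M * M))).
  apply: le_trans (ler_normD _ _) _; apply: lerD.
    by apply: le_trans (ler_normD _ _) _; exact: lerD.
  rewrite normrM ler_pM//.
  do 3?[apply: le_trans (ler_normD _ _) _; apply: lerD => //].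
rewrite [leRHS](_ : _ = d * M + M * d + d * (1 + 2 * M + M * M)); last by ring.
rewrite lerD2l ler_wpM2l//; first exact: ltW.
by nra.
Unshelve. all: by end_near. Qed.

Lemma L2_derivativeD f df g dg : L2_derivative f df -> L2_derivative g dg ->
  L2_derivative (fun r p => f r p + g r p) (fun p => df p + dg p).
Proof.
move=> [Lf Ldf Hf] [Lg Ldg Hg]; split.
- by move=> r rT; apply: L2D; [exact: Lf|exact: Lg].
- exact: L2D.
move=> e e0; have e20 : 0 < e / 2 by rewrite divr_gt0.
near=> r.
have [rT _ _] : [/\ r \in `[0, T], r != t & `|r - t| <= 1] by near: r; exact: near_domain.
have uf : \int[leb2]_(p in setT) (quotient_error f df r p ^+ 2) <= (e / 2) ^+ 2.
  by near: r; exact: Hf.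
have vg : \int[leb2]_(p in setT) (quotient_error g dg r p ^+ 2) <= (e / 2) ^+ 2.
  by near: r; exact: Hg.
have Lu := quotient_error_L2 Lf Ldf rT; have Lv := quotient_error_L2 Lg Ldg rT.
have i1 := intgZ 2 (L2_intg Lu); have i2 := intgZ 2 (L2_intg Lv).
apply: (@le_trans _ _ (\int[leb2]_(p in setT)
   (2 * quotient_error f df r p ^+ 2 + 2 * quotient_error g dg r p ^+ 2))).
  apply: RI_le; [|exact: intgD|].
    have := L2_intg (L2D Lu Lv); apply: eq_integrable => // p _; congr EFin; congr (_ ^+ 2).
    by rewrite /quotient_error; ring.
  move=> p; rewrite [X in X ^+ 2](_ : _ = quotient_error f df r p + quotient_error g dg r p).
    by have := sqr_ge0 (quotient_error f df r p - quotient_error g dg r p); nra.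
  by rewrite /quotient_error; ring.
rewrite (RID i1 i2) (RIZ _ (L2_intg Lu)) (RIZ _ (L2_intg Lv)); nra.
Unshelve. all: by end_near. Qed.

Lemma L2_derivativeMb f df m (M : R) : measurable_fun (setT : set R2) m ->
  (forall p, `|m p| <= M) -> L2_derivative f df ->
  L2_derivative (fun r p => m p * f r p) (fun p => m p * df p).
Proof.
move=> mm mM [Lf Ldf Hf]; split.
- by move=> r rT; apply: L2Mb mM => //; exact: Lf.
- exact: L2Mb mM.
move=> e e0; have M0 : 0 <= M by apply: le_trans (mM (0, 0)).
have M1 : 0 < M + 1 by rewrite ltr_wpDl.
have d0 : 0 < e / (M + 1) by rewrite divr_gt0.
near=> r.
have [rT _ _] : [/\ r \in `[0, T], r != t & `|r - t| <= 1] by near: r; exact: near_domain.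
have uf : \int[leb2]_(p in setT) (quotient_error f df r p ^+ 2) <= (e / (M + 1)) ^+ 2.
  by near: r; exact: Hf.
have Lu := quotient_error_L2 Lf Ldf rT.
apply: (@le_trans _ _ (\int[leb2]_(p in setT) (M ^+ 2 * quotient_error f df r p ^+ 2))).
  apply: RI_le; [|exact/intgZ/L2_intg|].
    have := L2_intg (L2Mb Lu mm mM); apply: eq_integrable => // p _; congr EFin; congr (_ ^+ 2).
    by rewrite /quotient_error; ring.
  move=> p; rewrite [X in X ^+ 2](_ : _ = m p * quotient_error f df r p).
    rewrite exprMn ler_wpM2r ?sqr_ge0// -(real_normK (num_real (m p))).
    by rewrite lerXn2r ?nnegrE.
  by rewrite /quotient_error; ring.
rewrite (RIZ _ (L2_intg Lu)); apply: (@le_trans _ _ ((M + 1) ^+ 2 * (e / (M + 1)) ^+ 2)).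
  by apply: ler_pM => //; [exact: sqr_ge0|exact: RI_sqr_ge0|rewrite lerXn2r ?nnegrE ?lerDl// ltW].
by rewrite -exprMn mulrC divfK ?gt_eqF.
Unshelve. all: by end_near. Qed.

(** The delicate term is the error of [f] times [g t]: as [g t] is only square integrable, the error
    must be small in the sup norm for the product to be small in L^2. *)
Lemma L2_derivativeM f df g dg (M : R) :
  (forall r, r \in `[0, T] -> L2 (fun p => f r p * g r p)) ->
  (forall p, `|f t p| <= M) -> (forall p, `|df p| <= M) -> sup_derivative f df ->
  L2_derivative f df -> L2_derivative g dg ->
  L2_derivative (fun r p => f r p * g r p) (fun p => df p * g t p + f t p * dg p).
Proof.
move=> Lfg fM dfM Sf [Lf Ldf Hf] [Lg Ldg Hg].
have M0 : 0 <= M by apply: le_trans (fM (0, 0)).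
have Lft := Lf t tT; have Lgt := Lg t tT.
have Ldfg : L2 (fun p => df p * g t p + f t p * dg p).
  apply: L2D.
  - exact: (L2Mb Lgt (L2_measurable Ldf) dfM).
  - exact: (L2Mb Ldg (L2_measurable Lft) fM).
split => // e e0.
pose sq (h : R * R -> R) := \int[leb2]_(p in setT) (h p ^+ 2).
have s1 : 0 <= sq (g t) := RI_sqr_ge0 _; have s2 : 0 <= sq dg := RI_sqr_ge0 _.
(* The 4 comes from (x1 + x2 + x3 + x4)^2 <= 4 (x1^2 + ... + x4^2), and 2 M + 1 bounds |f r| = |f t
   + h u + h df| for |h| <= 1 and |u| <= 1, u being the error of [f]. *)
pose K := 4 * (sq (g t) + (2 * M + 1) ^+ 2 + sq dg + M ^+ 2 * sq dg).
have K0 : 0 <= K.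
  by rewrite /K mulr_ge0// !addr_ge0// ?sqr_ge0// mulr_ge0// sqr_ge0.
have K1 : 0 < K + 1 by rewrite ltr_wpDl.
pose d := Num.min 1 (e / (K + 1)).
have d0 : 0 < d by rewrite lt_min ltr01/= divr_gt0.
have d1 : d <= 1 by rewrite ge_min lexx.
have dK : d * (K + 1) <= e by rewrite -ler_pdivlMr// ge_min lexx orbT.
near=> r.
have [rT rt hd] : [/\ r \in `[0, T], r != t & `|r - t| <= d].
  by near: r; exact: near_domain.
have ud : forall p, `|quotient_error f df r p| <= d by near: r; exact: Sf.
have vg : sq (quotient_error g dg r) <= d ^+ 2 by near: r; exact: Hg.
have Lu := quotient_error_L2 Lf Ldf rT; have Lv := quotient_error_L2 Lg Ldg rT.
have LE := quotient_error_L2 Lfg Ldfg rT.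
have h0 : r - t != 0 by rewrite subr_eq0.
apply: (@le_trans _ _ (\int[leb2]_(p in setT) (4 * d ^+ 2 * g t p ^+ 2 +
   4 * (2 * M + 1) ^+ 2 * quotient_error g dg r p ^+ 2 +
   (4 * d ^+ 2 + 4 * d ^+ 2 * M ^+ 2) * dg p ^+ 2))).
  apply: RI_le; [exact: L2_intg LE| |].
    by apply: intgD; [apply: intgD|]; apply: intgZ; exact: L2_intg.
  move=> p.
  have E : quotient_error (fun r p => f r p * g r p)
      (fun p => df p * g t p + f t p * dg p) r p =
    quotient_error f df r p * g t p +
    (f t p + (r - t) * quotient_error f df r p + (r - t) * df p) * quotient_error g dg r p +
    (r - t) * quotient_error f df r p * dg p + (r - t) * df p * dg p.
    by rewrite /quotient_error; field.
  rewrite E.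
  have four (x1 x2 x3 x4 : R) : (x1 + x2 + x3 + x4) ^+ 2 <=
      4 * (x1 ^+ 2 + x2 ^+ 2 + x3 ^+ 2 + x4 ^+ 2).
    have := sqr_ge0 (x1 - x2); have := sqr_ge0 (x1 - x3); have := sqr_ge0 (x1 - x4).
    have := sqr_ge0 (x2 - x3); have := sqr_ge0 (x2 - x4); have := sqr_ge0 (x3 - x4).
    nra.
  have sqM (x y c : R) : `|x| <= c -> (x * y) ^+ 2 <= c ^+ 2 * y ^+ 2.
    move=> xc; rewrite exprMn ler_wpM2r ?sqr_ge0// -(real_normK (num_real x)).
    by rewrite lerXn2r ?nnegrE// (le_trans _ xc).
  have up := ud p; have fp := fM p; have dfp := dfM p.
  have b1 := sqM _ (g t p) _ up.
  have b2 := sqM (f t p + (r - t) * quotient_error f df r p + (r - t) * df p)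
    (quotient_error g dg r p) (2 * M + 1).
  have b3 := sqM ((r - t) * quotient_error f df r p) (dg p) d.
  have b4 := sqM ((r - t) * df p) (dg p) (d * M).
  have h1 : `|r - t| <= 1 := le_trans hd d1.
  have u1 : `|quotient_error f df r p| <= 1 := le_trans up d1.
  have c3 : `|(r - t) * quotient_error f df r p| <= d.
    by rewrite normrM -[leRHS]mulr1 ler_pM.
  have c4 : `|(r - t) * df p| <= d * M by rewrite normrM ler_pM.
  have c2 : `|f t p + (r - t) * quotient_error f df r p + (r - t) * df p| <= 2 * M + 1.
    apply: le_trans (ler_normD _ _) _; have := ler_normD (f t p) ((r - t) * quotient_error f df r p).
    have : d * M <= M by rewrite ler_piMl.
    lra.
  apply: le_trans (four _ _ _ _) _.
  have := b2 c2; have := b3 c3; have := b4 c4; rewrite [(d * M) ^+ 2]exprMn; move: b1.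
  lra.
rewrite (RID (intgD (intgZ _ (L2_intg Lgt)) (intgZ _ (L2_intg Lv))) (intgZ _ (L2_intg Ldg))).
rewrite (RID (intgZ _ (L2_intg Lgt)) (intgZ _ (L2_intg Lv))).
rewrite !RIZ; [|exact: L2_intg..]; rewrite -/(sq _) -/(sq (quotient_error g dg r)) -/(sq dg).
apply: (@le_trans _ _ (d ^+ 2 * K)).
  rewrite /K; have : 4 * (2 * M + 1) ^+ 2 * sq (quotient_error g dg r) <=
    4 * (2 * M + 1) ^+ 2 * d ^+ 2 by rewrite ler_wpM2l// mulr_ge0// sqr_ge0.
  lra.
apply: (@le_trans _ _ ((d * (K + 1)) ^+ 2)).
  rewrite exprMn ler_wpM2l ?sqr_ge0//; nra.
by rewrite lerXn2r// nnegrE ?mulr_ge0 ?ltW.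
Unshelve. all: by end_near. Qed.

End TimeDerivative.

(** * From the weak equations to the classical ones *)

Section WeakToClassical.
Context {R : realType}.
Notation R2 := (measurableTypeR R * measurableTypeR R)%type.
Variables (eps sigma a c d : R) (D eta eta' : R * R -> R) (u u' : R * R -> R * R).
Variables (N A B N' A' B' : R * R -> R).
Hypotheses (tD : TB 2 D) (tN : TL 3 N) (tA : TL 3 A) (tB : TL 3 B).
Hypotheses (tN' : TL 3 N') (tA' : TL 3 A') (tB' : TL 3 B').
Hypotheses (eN : aeq eta N) (eA : aeq (fun x => (u x).1) A) (eB : aeq (fun x => (u x).2) B).
Hypotheses (eN' : aeq eta' N') (eA' : aeq (fun x => (u' x).1) A').
Hypothesis eB' : aeq (fun x => (u' x).2) B'.

(** This turns an equation valid almost everywhere for weak derivatives into one valid at every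
    point for the representatives. *)
Lemma aeq_eq0 (f F : R * R -> R) : aeq f F -> continuous F ->
  {ae leb2, forall p, f p = 0} -> forall p, F p = 0.
Proof.
move=> [_ fF] cF f0 p; have c0 : continuous (fun _ : R * R => 0 : R) by move=> x; exact: cvg_cst.
suff -> : F = fun=> 0 by [].
by apply: continuous_ae_eq => //; apply: aeS2 fF f0 => x <-.
Qed.

Lemma aeq_D k : aeq (fun p => D p ^+ k) (fun p => D p ^+ k).
Proof.
apply: aeq_refl; elim: k => [|k IH]; first by move=> p; exact: cvg_cst.
have -> : (fun p => D p ^+ k.+1) = (fun p => D p * D p ^+ k).
  by apply/funext => p; rewrite exprS.
by move=> p; apply: cvgM; [exact: (TB_continuous tD)|exact: IH].
Qed.

Lemma aeq_cst (k : R) : aeq (fun=> k) (fun=> k).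
Proof. by apply: aeq_refl => p; exact: cvg_cst. Qed.

Lemma aeq_div : aeq (div u) (fun p => dx A p + dy B p).
Proof.
exact: aeqD (aeq_wderiv_x eA (TL_hasdx tA)) (aeq_wderiv_y eB (TL_hasdy tB)).
Qed.

Hypothesis mass : {ae leb2, forall x, eta' x + div (fun y => (D y + eps * eta y) *: u y) x
  + sigma ^+ 2 * div (fun y => a *: grad (fun z => D z ^+ 3 * div u z) y
                       - (d * D y ^+ 2) *: grad eta' y) x = 0}.
Hypothesis momentum : {ae leb2, forall x, u' x + grad eta x
     + (eps / 2) *: grad (fun y => sqnorm2 (u y)) x
     + sigma ^+ 2 *: grad (fun y => c * div (fun z => D z ^+ 2 *: grad eta z) y
                        - d * div (fun z => D z ^+ 2 *: u' z) y) x = 0}.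

Lemma weak_spatial_identity : null_integral (fun p => N p * N' p
  + (D p + eps * N p) * (A p * A' p + B p * B' p)
  + eps / 2 * N' p * (A p ^+ 2 + B p ^+ 2)
  - sigma ^+ 2 * (c * D p ^+ 2 * (dx N p * dx N' p + dy N p * dy N' p)
                  + a * D p ^+ 3 * (dx A p + dy B p) * (dx A' p + dy B' p))).
Proof.
have [[tX1 tX2 tV tG] [tY1 tY2 tM tZ]] := identity_towers eps a c d tD tN tA tB tN' tA' tB'.
have tD2 : TB 2 (fun p => D p ^+ 2) := TBM tD tD.
have eDN := aeqD (aeq_refl (TB_continuous tD)) (aeqZ eps eN).
have eX1 := aeqM eDN eA; have eX2 := aeqM eDN eB.
have eG := aeqM (aeq_D 3) aeq_div.
have edD := aeqM (aeq_cst d) (aeq_D 2).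
have eNx := aeq_wderiv_x eN (TL_hasdx tN); have eNy := aeq_wderiv_y eN (TL_hasdy tN).
have eN'x := aeq_wderiv_x eN' (TL_hasdx tN'); have eN'y := aeq_wderiv_y eN' (TL_hasdy tN').
have eY1 := aeqB (aeqZ a (aeq_wderiv_x eG (TL_hasdx tG))) (aeqM edD eN'x).
have eY2 := aeqB (aeqZ a (aeq_wderiv_y eG (TL_hasdy tG))) (aeqM edD eN'y).
have eM := aeqD (aeqM eA eA) (aeqM eB eB).
have tNx2 := TBL tD2 (TL_dx tN); have tNy2 := TBL tD2 (TL_dy tN).
have tA'2 := TBL tD2 (TLW tA'); have tB'2 := TBL tD2 (TLW tB').
have eZ := aeqB
  (aeqZ c (aeqD (aeq_wderiv_x (aeqM (aeq_D 2) eNx) (TL_hasdx tNx2))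
                (aeq_wderiv_y (aeqM (aeq_D 2) eNy) (TL_hasdy tNy2))))
  (aeqZ d (aeqD (aeq_wderiv_x (aeqM (aeq_D 2) eA') (TL_hasdx tA'2))
                (aeq_wderiv_y (aeqM (aeq_D 2) eB') (TL_hasdy tB'2)))).
have cD (f g : R * R -> R) : continuous f -> continuous g -> continuous (fun p => f p + g p).
  by move=> cf cg p; apply: cvgD; [exact: cf|exact: cg].
have cZ (k : R) (f : R * R -> R) : continuous f -> continuous (fun p => k * f p).
  by move=> cf p; apply: cvgMr; exact: cf.
have wX1 := aeq_wderiv_x eX1 (TL_hasdx tX1); have wX2 := aeq_wderiv_y eX2 (TL_hasdy tX2).
have wY1 := aeq_wderiv_x eY1 (TL_hasdx tY1); have wY2 := aeq_wderiv_y eY2 (TL_hasdy tY2).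
have wMx := aeq_wderiv_x eM (TL_hasdx tM); have wMy := aeq_wderiv_y eM (TL_hasdy tM).
have wZx := aeq_wderiv_x eZ (TL_hasdx tZ); have wZy := aeq_wderiv_y eZ (TL_hasdy tZ).
apply: (spatial_identity tD tN tA tB tN' tA' tB').
- apply: (aeq_eq0 (aeqD (aeqD eN' (aeqD wX1 wX2)) (aeqZ (sigma ^+ 2) (aeqD wY1 wY2)))).
    have cX := cD _ _ (TL_continuous (TL_dx tX1)) (TL_continuous (TL_dy tX2)).
    have cY := cD _ _ (TL_continuous (TL_dx tY1)) (TL_continuous (TL_dy tY2)).
    exact: cD _ _ (cD _ _ (TL_continuous tN') cX) (cZ _ _ cY).
  exact: mass.
- apply: (aeq_eq0 (aeqD (aeqD (aeqD eA' eNx) (aeqZ (eps / 2) wMx)) (aeqZ (sigma ^+ 2) wZx))).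
    exact: cD _ _ (cD _ _ (cD _ _ (TL_continuous tA') (TL_continuous (TL_dx tN))) (cZ _ _ (TL_continuous (TL_dx tM))))
      (cZ _ _ (TL_continuous (TL_dx tZ))).
  by apply: aeS momentum => p /(congr1 fst).
- apply: (aeq_eq0 (aeqD (aeqD (aeqD eB' eNy) (aeqZ (eps / 2) wMy)) (aeqZ (sigma ^+ 2) wZy))).
    exact: cD _ _ (cD _ _ (cD _ _ (TL_continuous tB') (TL_continuous (TL_dy tN))) (cZ _ _ (TL_continuous (TL_dy tM))))
      (cZ _ _ (TL_continuous (TL_dy tZ))).
  by apply: aeS momentum => p /(congr1 snd).
Qed.
End WeakToClassical.

(** * The time derivative of the energy integral *)

Section EnergyRate.
Context {R : realType}.
Notation R2 := (measurableTypeR R * measurableTypeR R)%type.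
Variables (T t : R).
Hypothesis tT : t \in `[0, T].

Definition integral_rate (F : R -> R * R -> R) (dF : R * R -> R) :=
  [/\ forall r, r \in `[0, T] -> intg leb2 (F r), intg leb2 dF &
  (r - t)^-1 * (\int[leb2]_(p in setT) F r p - \int[leb2]_(p in setT) F t p)
    @[r --> within `[0, T] t^'] --> \int[leb2]_(p in setT) dF p].

Lemma near_in_domain (P : R -> Prop) : (forall r, r \in `[0, T] -> P r) ->
  \forall r \near within `[0, T] t^', P r.
Proof.
move=> HP; have H := near_domain T t (@ltr01 R).
by apply: filterS H => r [rT _ _]; exact: HP.
Qed.

Lemma cvg_in_domain (f g : R -> R) (l : R) : (forall r, r \in `[0, T] -> f r = g r) ->
  f r @[r --> within `[0, T] t^'] --> l -> g r @[r --> within `[0, T] t^'] --> l.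
Proof. by move=> /near_in_domain fg; apply: cvg_trans; exact: near_eq_cvg fg. Qed.

Lemma integral_rateD F dF G dG : integral_rate F dF -> integral_rate G dG ->
  integral_rate (fun r p => F r p + G r p) (fun p => dF p + dG p).
Proof.
move=> [iF idF HF] [iG idG HG]; split.
- by move=> r rT; apply: intgD; [exact: iF|exact: iG].
- exact: intgD.
have H := cvgD HF HG; rewrite (RID idF idG); apply: cvg_in_domain (H _) => r rT.
rewrite !RID; [|exact: iF|exact: iG|exact: iF|exact: iG].
by rewrite /GRing.add_fun/=; ring.
Qed.

Lemma integral_rateZ F dF (k : R) : integral_rate F dF ->
  integral_rate (fun r p => k * F r p) (fun p => k * dF p).
Proof.
move=> [iF idF HF]; split.
- by move=> r rT; apply: intgZ; exact: iF.
- exact: intgZ.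
have H := cvgMr (a := k) HF; rewrite (RIZ k idF); apply: cvg_in_domain (H _) => r rT.
by rewrite !RIZ; [ring|exact: iF|exact: iF].
Qed.

Lemma integral_rate_pairing f df g dg : L2_derivative T t f df -> L2_derivative T t g dg ->
  integral_rate (fun r p => f r p * g r p) (fun p => df p * g t p + f t p * dg p).
Proof.
move=> Hf Hg; have [Lf Ldf _] := Hf; have [Lg Ldg _] := Hg; split.
- by move=> r rT; apply: L2M; [exact: Lf|exact: Lg].
- by apply: intgD; apply: L2M => //; [exact: Lg|exact: Lf].
- exact: L2_derivative_pairing.
Qed.

Variables (eps s2 a c : R) (D : R * R -> R) (N A B : R -> R * R -> R).
Variables (N' A' B' : R * R -> R).
Hypothesis tD : TB 2 D.
Hypothesis tN : forall r, r \in `[0, T] -> TL 3 (N r).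
Hypothesis tA : forall r, r \in `[0, T] -> TL 3 (A r).
Hypothesis tB : forall r, r \in `[0, T] -> TL 3 (B r).
Hypothesis tN' : TL 3 N'.
Hypotheses (LN : L2_derivative T t N N') (LA : L2_derivative T t A A').
Hypothesis LB : L2_derivative T t B B'.
Hypotheses (LNx : L2_derivative T t (fun r => dx (N r)) (dx N'))
  (LNy : L2_derivative T t (fun r => dy (N r)) (dy N'))
  (LAx : L2_derivative T t (fun r => dx (A r)) (dx A'))
  (LBy : L2_derivative T t (fun r => dy (B r)) (dy B')).
Hypothesis SN : sup_derivative T t N N'.

(** Every term of the energy is a pairing of two L^2-differentiable curves, the powers of [D] being
    absorbed as bounded multipliers into one of them. The cubic term pairs N A with A, and N B with
    B. *)
Lemma energy_integral_rate : integral_rate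
  (fun r p => N r p ^+ 2 + (D p + eps * N r p) * (A r p ^+ 2 + B r p ^+ 2)
     - s2 * (c * D p ^+ 2 * (dx (N r) p ^+ 2 + dy (N r) p ^+ 2)
                    + a * D p ^+ 3 * (dx (A r) p + dy (B r) p) ^+ 2))
  (fun p => 2 * (N t p * N' p + (D p + eps * N t p) * (A t p * A' p + B t p * B' p)
     + eps / 2 * N' p * (A t p ^+ 2 + B t p ^+ 2)
     - s2 * (c * D p ^+ 2 * (dx (N t) p * dx N' p + dy (N t) p * dy N' p)
             + a * D p ^+ 3 * (dx (A t) p + dy (B t) p) * (dx A' p + dy B' p)))).
Proof.
have tD2 : TB 2 (fun p => D p ^+ 2) := TBM tD tD.
have tD3 : TB 2 (fun p => D p ^+ 3).
  by have := TBM tD tD2; congr TB; apply/funext => p; rewrite -exprS.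
have [[M1 HM1] [M2 HM2] [M3 HM3]] := And3 (TB_bounded tD) (TB_bounded tD2) (TB_bounded tD3).
have [m1 m2 m3] := And3 (continuous_measurable2 (TB_continuous tD))
  (continuous_measurable2 (TB_continuous tD2)) (continuous_measurable2 (TB_continuous tD3)).
have [K1 HK1] := TL_bounded (tN tT); have [K2 HK2] := TL_bounded tN'.
pose K := Num.max K1 K2.
have bN p : `|N t p| <= K by rewrite le_max HK1.
have bN' p : `|N' p| <= K by rewrite le_max HK2 orbT.
have LNM f df (tf : forall r, r \in `[0, T] -> TL 3 (f r)) (Lf : L2_derivative T t f df) :=
  L2_derivativeM tT (fun r rT => TL_L2 (TLM (tN rT) (tf r rT))) bN bN' SN LN Lf.
have LV := L2_derivativeD tT LAx LBy.
have H := integral_rateD (integral_rateD (integral_rateD (integral_rateD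
    (integral_rate_pairing LN LN)
    (integral_rateD (integral_rate_pairing (L2_derivativeMb tT m1 HM1 LA) LA)
                    (integral_rate_pairing (L2_derivativeMb tT m1 HM1 LB) LB)))
    (integral_rateZ eps (integral_rateD (integral_rate_pairing (LNM _ _ tA LA) LA)
                                        (integral_rate_pairing (LNM _ _ tB LB) LB))))
    (integral_rateZ (- (s2 * c))
      (integral_rateD (integral_rate_pairing (L2_derivativeMb tT m2 HM2 LNx) LNx)
                      (integral_rate_pairing (L2_derivativeMb tT m2 HM2 LNy) LNy))))
    (integral_rateZ (- (s2 * a)) (integral_rate_pairing (L2_derivativeMb tT m3 HM3 LV) LV)).
move: H; congr integral_rate.
- by apply/funext => r; apply/funext => p; ring.
- by apply/funext => p; field.
Qed.

End EnergyRate.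

Lemma C1_Hs_derivatives (R : realType) (T s : R) (F F' : R -> R * R -> R) t : 9 <= s ->
  C1_Hs T s F F' -> t \in `[0, T] ->
  [/\ L2_derivative T t (fun r => rep (F r) 0 0) (rep (F' t) 0 0),
      L2_derivative T t (fun r => dx (rep (F r) 0 0)) (dx (rep (F' t) 0 0)),
      L2_derivative T t (fun r => dy (rep (F r) 0 0)) (dy (rep (F' t) 0 0)) &
      sup_derivative T t (fun r => rep (F r) 0 0) (rep (F' t) 0 0)].
Proof.
move=> s9 C1 tT.
have tF r : r \in `[0, T] -> TL 3 (rep (F r) 0 0).
  by move=> rT; have [Hr _ _ _] := C1 r rT; have [] := Hs_rep s9 Hr.
have [_ Ht' _ _] := C1 t tT; have [tF' _] := Hs_rep s9 Ht'.
split; [split|split|split|].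
- by move=> r /tF/TL_L2.
- exact: TL_L2 tF'.
- move=> e e0; have := C1_Hs_rep s9 C1 tT e0; apply: filterS => r [H1 H2 H3 H4]; exact: H2.
- by move=> r /tF/TL_dx/TL_L2.
- exact: TL_L2 (TL_dx tF').
- move=> e e0; have := C1_Hs_rep s9 C1 tT e0; apply: filterS => r [H1 H2 H3 H4]; exact: H3.
- by move=> r /tF/TL_dy/TL_L2.
- exact: TL_L2 (TL_dy tF').
- move=> e e0; have := C1_Hs_rep s9 C1 tT e0; apply: filterS => r [H1 H2 H3 H4]; exact: H4.
- move=> e e0; have := C1_Hs_rep s9 C1 tT e0; apply: filterS => r [H1 H2 H3 H4]; exact: H1.
Qed.

Theorem mainTheorem3 (R : realType) :
  exists s0 : R, forall s : R, s0 <= s ->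
  forall (T eps sigma a b c d : R) (D : R * R -> R)
    (eta eta_t : R -> R * R -> R) (u u_t : R -> R * R -> R * R),
  0 < T -> smooth_bounded D ->
  0 < eps -> 0 < sigma -> a <= 0 -> c <= 0 -> b = d -> 0 <= d ->
  C1_Hs T s eta eta_t ->
  C1_Hs T s (fun t x => (u t x).1) (fun t x => (u_t t x).1) ->
  C1_Hs T s (fun t x => (u t x).2) (fun t x => (u_t t x).2) ->
  (forall t, t \in `[0, T] -> {ae leb2, forall x,
     eta_t t x
     + div (fun y => (D y + eps * eta t y) *: u t y) x
     + sigma ^+ 2 *
         div (fun y => a *: grad (fun z => D z ^+ 3 * div (u t) z) y
                       - (b * D y ^+ 2) *: grad (eta_t t) y) x
     = 0}) ->
  (forall t, t \in `[0, T] -> {ae leb2, forall x,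
     u_t t x + grad (eta t) x
     + (eps / 2) *: grad (fun y => sqnorm2 (u t y)) x
     + sigma ^+ 2 *:
         grad (fun y => c * div (fun z => D z ^+ 2 *: grad (eta t) z) y
                        - d * div (fun z => D z ^+ 2 *: u_t t z) y) x
     = 0}) ->
  let E t := energy eps sigma a c D (eta t) (u t) in
  forall t, t \in `[0, T] ->
    leb2.-integrable setT
      (fun x => (energy_density eps sigma a c D (eta t) (u t) x)%:E)
    /\ (r - t)^-1 * (E r - E t) @[r --> within `[0, T] t^'] --> (0 : R).
Proof.
(* Nine derivatives: three occur in the equations, and the representative of a
   function uses three more in each variable. *)
exists 9 => s s9 T eps sigma a b c d D eta eta_t u u_t _ sD _ _ _ _ bd _.
subst b => Ce Cu Cv mass momentum E t tT.
have tD := smooth_bounded_TB2 sD.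
pose N r := rep (eta r) 0 0; pose A r := rep (fun x => (u r x).1) 0 0.
pose B r := rep (fun x => (u r x).2) 0 0.
have HN r : r \in `[0, T] -> TL 3 (N r) /\ aeq (eta r) (N r).
  by move=> rT; have [h _ _ _] := Ce r rT; exact: Hs_rep s9 h.
have HA r : r \in `[0, T] -> TL 3 (A r) /\ aeq (fun x => (u r x).1) (A r).
  by move=> rT; have [h _ _ _] := Cu r rT; exact: Hs_rep s9 h.
have HB r : r \in `[0, T] -> TL 3 (B r) /\ aeq (fun x => (u r x).2) (B r).
  by move=> rT; have [h _ _ _] := Cv r rT; exact: Hs_rep s9 h.
have [_ h1 _ _] := Ce t tT; have [tN' eN'] := Hs_rep s9 h1.
have [_ h2 _ _] := Cu t tT; have [tA' eA'] := Hs_rep s9 h2.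
have [_ h3 _ _] := Cv t tT; have [tB' eB'] := Hs_rep s9 h3.
have [tN eN] := HN t tT; have [tA eA] := HA t tT; have [tB eB] := HB t tT.
have [in0 I0] := weak_spatial_identity tD tN tA tB tN' tA' tB' eN eA eB eN' eA' eB'
  (mass t tT) (momentum t tT).
have [LN LNx LNy SN] := C1_Hs_derivatives s9 Ce tT.
have [LA LAx _ _] := C1_Hs_derivatives s9 Cu tT.
have [LB _ LBy _] := C1_Hs_derivatives s9 Cv tT.
have [iF _ cF] := energy_integral_rate tT eps (sigma ^+ 2) a c tD
  (fun r rT => (HN r rT).1) (fun r rT => (HA r rT).1) (fun r rT => (HB r rT).1)
  tN' LN LA LB LNx LNy LAx LBy SN.
(* The rate is twice the integral that the spatial identity annihilates. *)
rewrite RIZ// I0 mulr0 in cF.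
(* The energy is formed with weak derivatives; it has to be exchanged, at every time of the
   interval, for the expression in the representatives whose rate is known. *)
have eE r : r \in `[0, T] -> aeq (energy_density eps sigma a c D (eta r) (u r))
  (fun p => N r p ^+ 2 + (D p + eps * N r p) * (A r p ^+ 2 + B r p ^+ 2)
     - sigma ^+ 2 * (c * D p ^+ 2 * (dx (N r) p ^+ 2 + dy (N r) p ^+ 2)
                    + a * D p ^+ 3 * (dx (A r) p + dy (B r) p) ^+ 2)).
  move=> rT; have [tNr eNr] := HN r rT; have [tAr eAr] := HA r rT; have [tBr eBr] := HB r rT.
  have eNx := aeq_wderiv_x eNr (TL_hasdx tNr); have eNy := aeq_wderiv_y eNr (TL_hasdy tNr).
  have eV := aeq_div tAr tBr eAr eBr.
  have eD := aeq_refl (TB_continuous tD).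
  exact: aeqB (aeqD (aeqM eNr eNr) (aeqM (aeqD eD (aeqZ eps eNr))
      (aeqD (aeqM eAr eAr) (aeqM eBr eBr))))
    (aeqZ (sigma ^+ 2) (aeqD
      (aeqM (aeqM (aeq_cst c) (aeq_D tD 2)) (aeqD (aeqM eNx eNx) (aeqM eNy eNy)))
      (aeqM (aeqM (aeq_cst a) (aeq_D tD 3)) (aeqM eV eV)))).
have EE r : r \in `[0, T] -> E r = 2^-1 * \int[leb2]_(p in setT)
  (N r p ^+ 2 + (D p + eps * N r p) * (A r p ^+ 2 + B r p ^+ 2)
     - sigma ^+ 2 * (c * D p ^+ 2 * (dx (N r) p ^+ 2 + dy (N r) p ^+ 2)
                    + a * D p ^+ 3 * (dx (A r) p + dy (B r) p) ^+ 2)).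
  move=> rT; have [mE aE] := eE r rT; rewrite /E /energy; congr (_ * _).
  by apply: RI_ae => //; exact: intg_meas (iF r rT).
split.
  by have [mE aE] := eE t tT; exact: intg_ae mE aE (iF t tT).
have H := cvgMr (a := 2^-1) cF; rewrite mulr0 in H; apply: cvg_in_domain (H _) => // r rT.
by rewrite (EE r rT) (EE t tT) -mulrBr; exact: mulrCA.
Qed.
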